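(* Let $\mathcal{X}_1,\mathcal{X}_2,\mathcal{Y}$ be finite alphabets and let $(X_1,X_2,Y)$ have joint pmf $p(x_1,x_2,y)$ on $\mathcal{X}_1\times\mathcal{X}_2\times\mathcal{Y}$ such that $X_1-Y-X_2$ is a Markov chain. Then $$\mathcal{R}_{\text{CDIB}}^{\text{outer}}(1)=\mathcal{R}_{\text{CDIB}}^{\text{inner}}(1)=\mathcal{R}_{\text{CDIB}}(1).$$
   Context: All logarithms are base 2; $[a]^+=\max\{a,0\}$. $A-B-C$ denotes a Markov chain, i.e. $p(a|b,c)=p(a|b)$. Operational region. Let $(X_1^n,X_2^n,Y^n)$ be $n$ i.i.d. copies of $(X_1,X_2,Y)$. A $1$-step $n$-length CDIB code consists of finite message sets $\mathcal{I}_1,\mathcal{J}_1$ and mappings $f_1:\mathcal{X}_1^n\to\mathcal{I}_1$, $g_1:\mathcal{X}_2^n\times\mathcal{I}_1\to\mathcal{J}_1$; the messages are $I_1=f_1(X_1^n)$, $J_1=g_1(X_2^n,I_1)$. A triple $(R_1,R_2,\mu)\in\mathbb{R}^3_{\geq0}$ is $1$-achievable if for every $\varepsilon>0$ there is $n_0(\varepsilon)$ such that for all $n>n_0(\varepsilon)$ there is such a code with $\frac1n\log|\mathcal{I}_1|\leq R_1+\varepsilon$, $\frac1n\log|\mathcal{J}_1|\leq R_2+\varepsilon$ and $\mu-\varepsilon\leq\frac1nI(Y^n;I_1J_1)$. $\mathcal{R}_{\text{CDIB}}(1)$ is the set of all $1$-achievable triples. $\mathcal{R}_{\text{CDIB}}^{\text{inner}}(1)$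 is the set of $(R_1,R_2,\mu)\in\mathbb{R}^3_{\geq0}$ for which there exist finite-alphabet random variables $V_1,V_2$, jointly distributed with $(X_1,X_2,Y)$, with Markov chains $V_1-X_1-(X_2,Y)$ and $V_2-(V_1,X_2)-(X_1,Y)$, such that $R_1\geq I(X_1;V_1V_2|X_2)$, $R_2\geq I(X_2;V_2|V_1)+I(X_2;V_1|X_1)$, $R_1+R_2\geq I(X_1X_2;V_1V_2)$, $\mu\leq I(Y;V_1V_2)$. (Under the Markov chains the first two read $R_1\geq I(X_1;V_1|X_2)$ and $R_2\geq I(X_2;V_2|V_1)$.) $\mathcal{R}_{\text{CDIB}}^{\text{outer}}(1)$ is the set of $(R_1,R_2,\mu)\in\mathbb{R}^3_{\geq0}$ for which there exist random variables $V_1,V_2$, jointly distributed with $(X_1,X_2,Y)$, with values in finite alphabets satisfying $|\mathcal{V}_1|\leq|\mathcal{X}_1|+4$, $|\mathcal{V}_2|\leq|\mathcal{X}_2||\mathcal{V}_1|+1$, with Markov chains $V_1-X_1-(X_2,Y)$ and $V_2-(V_1,X_2)-(X_1,Y)$, such that $R_1\geq I(X_1;V_1V_2|X_2)$, $R_2\geq[I(X_2;V_1V_2|Y)-I(Y;V_1)+\mu]^+$, $R_1+R_2\geq I(X_1X_2;V_1V_2|Y)+\mu$, $\mu\leq I(Y;V_1V_2)$. *)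

(* Defs.v *)
From HB Require Import structures.
From mathcomp Require Import all_boot all_order all_algebra.
From mathcomp Require Import classical_sets reals exp.

Set Implicit Arguments.
Unset Strict Implicit.
Unset Printing Implicit Defensive.

Import Order.TTheory GRing.Theory Num.Theory.
Local Open Scope ring_scope.
Local Open Scope classical_set_scope.

Definition log2 (R : realType) (x : R) : R := ln x / ln 2.

Definition is_pmf (R : realType) (T : finType) (P : T -> R) : Prop :=
  (forall t, 0 <= P t) /\ \sum_t P t = 1.

(* Random variables are functions on a finite sample space [T] carrying a
   pmf [P]; [law P X] is the pmf of [X]. *)
Definition law (R : realType) (T A : finType) (P : T -> R) (X : T -> A)
    (a : A) : R :=
  \sum_(t | X t == a) P t.

Definition joint (T A B : Type) (X : T -> A) (Y : T -> B) (t : T) : A * B :=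
  (X t, Y t).

(* A summand whose joint probability is 0 vanishes because of its left factor,
   whatever the value of the logarithm: this is the convention 0 log 0 = 0. *)
Definition mutual_info (R : realType) (T A B : finType) (P : T -> R)
    (X : T -> A) (Y : T -> B) : R :=
  \sum_a \sum_b law P (joint X Y) (a, b) *
    log2 (law P (joint X Y) (a, b) / (law P X a * law P Y b)).

(* I(X;Y|Z), the argument of the logarithm being
   p(x,y|z) / (p(x|z) p(y|z)) = p(x,y,z) p(z) / (p(x,z) p(y,z)). *)
Definition cond_mutual_info (R : realType) (T A B C : finType) (P : T -> R)
    (X : T -> A) (Y : T -> B) (Z : T -> C) : R :=
  \sum_a \sum_b \sum_c law P (joint (joint X Y) Z) (a, b, c) *
    log2 (law P (joint (joint X Y) Z) (a, b, c) * law P Z c /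
          (law P (joint X Z) (a, c) * law P (joint Y Z) (b, c))).

(* X - Y - Z: p(x|y,z) = p(x|y), wherever the left-hand side is defined. *)
Definition markov_chain (R : realType) (T A B C : finType) (P : T -> R)
    (X : T -> A) (Y : T -> B) (Z : T -> C) : Prop :=
  forall a b c, 0 < law P (joint Y Z) (b, c) ->
    law P (joint (joint X Y) Z) (a, b, c) / law P (joint Y Z) (b, c) =
    law P (joint X Y) (a, b) / law P Y b.

Definition src_X1 (A1 A2 B : Type) (s : A1 * A2 * B) : A1 := s.1.1.
Definition src_X2 (A1 A2 B : Type) (s : A1 * A2 * B) : A2 := s.1.2.
Definition src_Y (A1 A2 B : Type) (s : A1 * A2 * B) : B := s.2.

(* Coordinates on the sample space of (X1, X2, Y, V1, V2). *)
Definition aux_src (S U1 U2 : Type) (w : S * U1 * U2) : S := w.1.1.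
Definition aux_V1 (S U1 U2 : Type) (w : S * U1 * U2) : U1 := w.1.2.
Definition aux_V2 (S U1 U2 : Type) (w : S * U1 * U2) : U2 := w.2.
Definition aux_X1 (A1 A2 B U1 U2 : Type) (w : A1 * A2 * B * U1 * U2) : A1 :=
  src_X1 (aux_src w).
Definition aux_X2 (A1 A2 B U1 U2 : Type) (w : A1 * A2 * B * U1 * U2) : A2 :=
  src_X2 (aux_src w).
Definition aux_Y (A1 A2 B U1 U2 : Type) (w : A1 * A2 * B * U1 * U2) : B :=
  src_Y (aux_src w).

(* [q] is a joint pmf of (X1, X2, Y, V1, V2) extending the source pmf [p],
   with V1 - X1 - (X2, Y) and V2 - (V1, X2) - (X1, Y). *)
Definition is_aux_extension (R : realType) (A1 A2 B U1 U2 : finType)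
    (p : A1 * A2 * B -> R) (q : A1 * A2 * B * U1 * U2 -> R) : Prop :=
  [/\ is_pmf q,
      forall s, law q (@aux_src _ U1 U2) s = p s,
      markov_chain q (@aux_V1 _ U1 U2) (@aux_X1 A1 A2 B U1 U2)
        (joint (@aux_X2 A1 A2 B U1 U2) (@aux_Y A1 A2 B U1 U2)) &
      markov_chain q (@aux_V2 _ U1 U2)
        (joint (@aux_V1 _ U1 U2) (@aux_X2 A1 A2 B U1 U2))
        (joint (@aux_X1 A1 A2 B U1 U2) (@aux_Y A1 A2 B U1 U2))].

Definition inner_region (R : realType) (A1 A2 B : finType)
    (p : A1 * A2 * B -> R) : set (R * R * R) :=
  [set t | let: (R1, R2, mu) := t in
    [/\ 0 <= R1, 0 <= R2, 0 <= mu &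
    exists (U1 U2 : finType) (q : A1 * A2 * B * U1 * U2 -> R),
      is_aux_extension p q /\
      let X1 := @aux_X1 A1 A2 B U1 U2 in
      let X2 := @aux_X2 A1 A2 B U1 U2 in
      let Y := @aux_Y A1 A2 B U1 U2 in
      let V1 := @aux_V1 (A1 * A2 * B) U1 U2 in
      let V2 := @aux_V2 (A1 * A2 * B) U1 U2 in
      [/\ R1 >= cond_mutual_info q X1 (joint V1 V2) X2,
          R2 >= cond_mutual_info q X2 V2 V1 + cond_mutual_info q X2 V1 X1,
          R1 + R2 >= mutual_info q (joint X1 X2) (joint V1 V2) &
          mu <= mutual_info q Y (joint V1 V2)]]].

Definition outer_region (R : realType) (A1 A2 B : finType)
    (p : A1 * A2 * B -> R) : set (R * R * R) :=
  [set t | let: (R1, R2, mu) := t in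
    [/\ 0 <= R1, 0 <= R2, 0 <= mu &
    exists (U1 U2 : finType) (q : A1 * A2 * B * U1 * U2 -> R),
      [/\ (#|U1| <= #|A1| + 4)%N, (#|U2| <= #|A2| * #|U1| + 1)%N,
          is_aux_extension p q &
      let X1 := @aux_X1 A1 A2 B U1 U2 in
      let X2 := @aux_X2 A1 A2 B U1 U2 in
      let Y := @aux_Y A1 A2 B U1 U2 in
      let V1 := @aux_V1 (A1 * A2 * B) U1 U2 in
      let V2 := @aux_V2 (A1 * A2 * B) U1 U2 in
      [/\ R1 >= cond_mutual_info q X1 (joint V1 V2) X2,
          R2 >= Num.max (cond_mutual_info q X2 (joint V1 V2) Y
                         - mutual_info q Y V1 + mu) 0,
          R1 + R2 >= cond_mutual_info q (joint X1 X2) (joint V1 V2) Y + mu &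
          mu <= mutual_info q Y (joint V1 V2)]]]].

(* The pmf of [n] i.i.d. copies of a source with pmf [p]. *)
Definition iid (R : realType) (S : finType) (p : S -> R) (n : nat)
    (w : {ffun 'I_n -> S}) : R :=
  \prod_(i < n) p (w i).

Definition letterwise (n : nat) (S A : finType) (X : S -> A)
    (w : {ffun 'I_n -> S}) : {ffun 'I_n -> A} :=
  [ffun i => X (w i)].

Definition achievable_region (R : realType) (A1 A2 B : finType)
    (p : A1 * A2 * B -> R) : set (R * R * R) :=
  [set t | let: (R1, R2, mu) := t in
    [/\ 0 <= R1, 0 <= R2, 0 <= mu &
    forall eps : R, 0 < eps -> exists n0 : nat, forall n : nat, (n0 < n)%N ->
    exists (M1 M2 : finType) (f1 : {ffun 'I_n -> A1} -> M1)
           (g1 : {ffun 'I_n -> A2} * M1 -> M2),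
      let X1n := letterwise (n := n) (@src_X1 A1 A2 B) in
      let X2n := letterwise (n := n) (@src_X2 A1 A2 B) in
      let Yn := letterwise (n := n) (@src_Y A1 A2 B) in
      let I1 w := f1 (X1n w) in
      let J1 w := g1 (X2n w, I1 w) in
      [/\ n%:R^-1 * log2 #|M1|%:R <= R1 + eps,
          n%:R^-1 * log2 #|M2|%:R <= R2 + eps &
          mu - eps <= n%:R^-1 * mutual_info (iid p (n := n)) Yn (joint I1 J1)]]].

(* Main.v *)
(* Each region is contained in the next in the cycle
   inner -> achievable -> outer -> inner.

   Inner to achievable: the encoders sample [V1] and [V2] by random binning.
   Part of the hash of an auxiliary sequence serves as common randomness; by the
   leftover hash lemma it is almost independent of the source, so it can be fixed
   in the end, and by Slepian--Wolf decoding the messages then determine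
   [(V1^n, V2^n)] with the right joint law. The relevance is bounded from below
   by a Gibbs-type inequality for the decoded sequences.

   Achievable to outer: the messages are auxiliary variables for the n-letter
   source. Splitting off one letter with [V1 := (V1, X2')] for one part and
   [V1 := (V1, X1, Y)] for the other shows by induction that the time average of
   n realizable quadruples bounds the rates; realizable quadruples are convex
   because a time-sharing variable can be absorbed into [V1]. Cardinality bounds
   (reweighting [V1], then [V2]) and compactness remove the epsilons.

   Outer to inner: a point of the outer region with slack is reached by
   time-sharing between [(V1, V2)], [V1] alone and constants. *)
Require Import Defs.
From mathcomp Require Import all_boot all_order all_algebra.
From mathcomp Require Import boolp classical_sets reals topology normedtype derive exp.
From mathcomp Require Import ring lra.

Set Implicit Arguments.
Unset Strict Implicit.
Unset Printing Implicit Defensive.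

Import Order.TTheory GRing.Theory Num.Theory.
Import numFieldNormedType.Exports.
Local Open Scope ring_scope.

(** * Entropy and mutual information *)

Section Log2.
Variable R : realType.
Implicit Types x y a b : R.

(** Both single-letter regions are read off from the same quadruples [(a, b, c, d)], the values of
    I(X1;V1V2|X2), I(X2;V1V2|Y) - I(Y;V1), I(X1X2;V1V2|Y) and I(Y;V1V2). The outer region asks for
    [a <= R1], [b + mu <= R2], [c + mu <= R1 + R2] and [mu <= d]; the inner one asks for the same
    with [d] instead of [mu] in the two middle bounds. So only points with [mu < d] need work. That
    the inner bounds take this shape is due to X1 - Y - X2: it gives I(X2;V1|Y) = 0, whence [b + d]
    is I(X2;V2|V1). The delicate quantity for blocks is [b], a difference of informations that must
    stay superadditive. This is why the split is asymmetric: the second block's auxiliary receives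
    X1 and Y of the first block but not X2, and X1 - Y - X2 is what makes the extra X1 cost nothing.
    An entropy depends only on the partition that a variable induces on the support. Identities
    between informations thus become linear arithmetic over entropies of subsets of a list of
    variables, and renaming a variable or changing its type is free. *)

Lemma ln2_gt0 : 0 < ln 2 :> R.
Proof. by apply: ln_gt0; lra. Qed.

Lemma log2M x y : 0 < x -> 0 < y -> log2 (x * y) = log2 x + log2 y.
Proof. by move=> x0 y0; rewrite /log2 lnM ?posrE // mulrDl. Qed.

Lemma log2V x : 0 < x -> log2 x^-1 = - log2 x.
Proof. by move=> x0; rewrite /log2 lnV ?posrE // mulNr. Qed.

Lemma log2_div x y : 0 < x -> 0 < y -> log2 (x / y) = log2 x - log2 y.
Proof. by move=> x0 y0; rewrite log2M ?invr_gt0 // log2V. Qed.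

Lemma log2_1 : log2 1 = 0 :> R.
Proof. by rewrite /log2 ln1 mul0r. Qed.

Lemma log2_2 : log2 2 = 1 :> R.
Proof. by rewrite /log2 divff // gt_eqF // ln2_gt0. Qed.

Lemma log2_le x y : 0 < x -> x <= y -> log2 x <= log2 y.
Proof.
move=> x0 xy; rewrite /log2 ler_pM2r ?invr_gt0 ?ln2_gt0 //.
by rewrite ler_ln // posrE ?(lt_le_trans x0).
Qed.

Lemma log2_ge0 x : 1 <= x -> 0 <= log2 x.
Proof. by move=> x1; rewrite -log2_1 log2_le. Qed.

Lemma log2_le0 x : 0 < x -> x <= 1 -> log2 x <= 0.
Proof. by move=> x0 x1; rewrite -log2_1 log2_le. Qed.

Lemma ln_le_sub1 x : 0 < x -> ln x <= x - 1.
Proof. by move=> x0; have := @le_ln1Dx _ (x - 1); rewrite [1 + _]addrC subrK; apply; lra. Qed.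

Lemma ln_eq_sub1 x : 0 < x -> ln x = x - 1 -> x = 1.
Proof.
move=> x0 e; apply/eqP; rewrite -ln_eq0 //; apply: contraT => n0.
by have := expR_gt1Dx n0; rewrite lnK ?posrE // e; lra.
Qed.

Lemma mul_ln_ge a b : 0 < a -> 0 < b -> a - b <= a * ln (a / b).
Proof.
move=> a0 b0; rewrite -[a / b]invf_div lnV ?posrE ?divr_gt0 // mulrN lerNr opprB.
have -> : b - a = a * (b / a - 1) by rewrite mulrBr mulr1 [a * (b / a)]mulrC divfK ?gt_eqF.
by rewrite ler_pM2l // ln_le_sub1 // divr_gt0.
Qed.

Lemma mul_ln_eq a b : 0 < a -> 0 < b -> a * ln (a / b) = a - b -> a = b.
Proof.
move=> a0 b0; rewrite -[a / b]invf_div lnV ?posrE ?divr_gt0 // => h.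
have a0' : a != 0 by rewrite gt_eqF.
have /eqP : b / a = 1.
  apply: ln_eq_sub1; first exact: divr_gt0.
  apply: (mulfI a0'); rewrite mulrBr mulr1 mulrC [a * (b / a)]mulrC divfK //; lra.
by rewrite -subr_eq0 -[1](divff a0') -mulrBl mulf_eq0 invr_eq0 (negPf a0') orbF subr_eq0 => /eqP.
Qed.

Lemma sum_log2 (I : finType) (f g : I -> R) :
  \sum_i f i * log2 (g i) = (\sum_i f i * ln (g i)) / ln 2.
Proof. by rewrite mulr_suml; apply: eq_bigr => i _; rewrite /log2 mulrA. Qed.

Section Gibbs.
Variables (I : finType) (p q : I -> R).
Hypotheses (p0 : forall i, 0 <= p i) (q0 : forall i, 0 <= q i).
Hypothesis (pq : forall i, 0 < p i -> 0 < q i).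
Hypothesis (le : \sum_i q i <= \sum_i p i).

Let ge i : p i - q i <= p i * ln (p i / q i).
Proof.
have [->|n0] := eqVneq (p i) 0; first by rewrite mul0r sub0r oppr_le0.
have pi : 0 < p i by rewrite lt0r n0 p0.
exact: mul_ln_ge (pq _).
Qed.

(** Termwise [a * ln (a / b) >= a - b]. Only the totals are compared, so [q] may be sub-normalised;
    [mutual_info_ge] relies on this. *)
Lemma gibbs : 0 <= \sum_i p i * log2 (p i / q i).
Proof.
rewrite sum_log2 divr_ge0 //; last by rewrite ltW // ln2_gt0.
apply: le_trans (_ : \sum_i (p i - q i) <= _); last exact: ler_sum.
by rewrite big_split /= sumrN subr_ge0.
Qed.

(** The gaps in the termwise inequality are nonnegative and sum to at most 0, so all vanish. Where
    [p i = 0] the gap is [q i] itself. *)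
Lemma gibbs_eq : \sum_i p i * log2 (p i / q i) = 0 -> p =1 q.
Proof.
rewrite sum_log2 => /eqP; rewrite mulf_eq0 invr_eq0 [ln 2 == _]gt_eqF ?ln2_gt0 // orbF.
move=> /eqP e i.
have ge0 j : 0 <= p j * ln (p j / q j) - (p j - q j) by rewrite subr_ge0.
have s0 : \sum_j (p j * ln (p j / q j) - (p j - q j)) = 0.
  apply/eqP; rewrite eq_le sumr_ge0 ?andbT => [|j _]; last exact: ge0.
  by rewrite sumrB e sumrB sub0r opprB subr_le0.
move/eqP: s0; rewrite psumr_eq0 // => /allP /(_ i).
rewrite mem_index_enum => /(_ isT) /eqP.
have [->|n0] := eqVneq (p i) 0; first by rewrite mul0r !sub0r opprK.
have pi : 0 < p i by rewrite lt0r n0 p0.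
by move/eqP; rewrite subr_eq0 => /eqP /mul_ln_eq; apply => //; exact: pq.
Qed.

End Gibbs.

End Log2.

Section Entropy.
Variables (R : realType) (T : finType) (P : T -> R).

(* [A] is only an [eqType] so that sequences of random variables are allowed. *)
Definition entropy (A : eqType) (X : T -> A) : R :=
  - \sum_t P t * log2 (\sum_(t' | X t' == X t) P t').

Lemma law_sum (A : finType) (X : T -> A) (f : A -> R) :
  \sum_a law P X a * f a = \sum_t P t * f (X t).
Proof.
rewrite [RHS](partition_big X predT) //=; apply: eq_bigr => a _.
by rewrite mulr_suml; apply: eq_bigr => t /eqP ->.
Qed.

Lemma law_comp (A B : finType) (X : T -> A) (f : A -> B) :
  law (law P X) f =1 law P (f \o X).
Proof.
move=> b; rewrite /law [RHS](partition_big X (fun a => f a == b)) /=; last by move=> t.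
apply: eq_bigr => a /eqP fa; apply: eq_bigl => t; case: eqP => [->|_]; last by rewrite andbF.
by rewrite fa eqxx.
Qed.

Hypothesis hP : is_pmf P.

Let P0 t : 0 <= P t. Proof. by case: hP. Qed.

Lemma law_ge0 (A : finType) (X : T -> A) a : 0 <= law P X a.
Proof. exact: sumr_ge0. Qed.

Lemma law_pmf (A : finType) (X : T -> A) : is_pmf (law P X).
Proof.
split=> [a|]; first exact: law_ge0.
have := law_sum X (fun=> 1); under eq_bigr do rewrite mulr1.
by move=> ->; under eq_bigr do rewrite mulr1; case: hP.
Qed.

Lemma pr_gt0 (A : eqType) (X : T -> A) t : 0 < P t -> 0 < \sum_(t' | X t' == X t) P t'.
Proof.
move=> Pt; rewrite (bigD1 t) //=; apply: ltr_wpDr => //; exact: sumr_ge0.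
Qed.

Lemma law_gt0 (A : finType) (X : T -> A) t : 0 < P t -> 0 < law P X (X t).
Proof. exact: pr_gt0. Qed.

Lemma law_eq0 (A : finType) (X : T -> A) a : law P X a = 0 ->
  forall t, X t = a -> P t = 0.
Proof.
move=> /eqP; rewrite psumr_eq0 // => /allP h t e.
by have := h t (mem_index_enum _); rewrite e eqxx => /eqP.
Qed.

Lemma law_le (A B : finType) (X : T -> A) (Y : T -> B) a b :
  (forall t, X t = a -> Y t = b) -> law P X a <= law P Y b.
Proof.
move=> h; rewrite /law [X in _ <= X](bigID (fun t => X t == a)) /=.
rewrite [X in X + _](_ : _ = \sum_(t | X t == a) P t) ?lerDl ?sumr_ge0 //.
by apply: eq_bigl => t; case: (X t =P a) => [/h ->|_]; rewrite ?eqxx ?andbF.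
Qed.

Lemma law_eq0_sub (A B : finType) (X : T -> A) (Y : T -> B) a b : law P Y b = 0 ->
  (forall t, X t = a -> Y t = b) -> law P X a = 0.
Proof. by move=> e h; apply/eqP; rewrite eq_le law_ge0 andbT -e; exact: law_le. Qed.

Lemma entropyE (A : finType) (X : T -> A) :
  entropy X = - \sum_a law P X a * log2 (law P X a).
Proof. by rewrite law_sum. Qed.

(** Entropy sees a random variable only through the partition it induces on the support of [P].
    Regrouping of tuples, changes of type and relabellings all rest on this. *)
Lemma entropy_ext (A B : eqType) (X : T -> A) (Y : T -> B) :
  (forall t t', 0 < P t -> 0 < P t' -> (X t == X t') = (Y t == Y t')) ->
  entropy X = entropy Y.
Proof.
move=> h; congr (- _); apply: eq_bigr => t _.
have [->|n0] := eqVneq (P t) 0; first by rewrite !mul0r.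
have Pt : 0 < P t by rewrite lt0r n0 P0.
congr (_ * log2 _); rewrite big_mkcond [RHS]big_mkcond; apply: eq_bigr => t' _.
have [->|n0'] := eqVneq (P t') 0; first by rewrite !if_same.
by rewrite h // lt0r n0' P0.
Qed.

Lemma entropy_mono (A B : eqType) (X : T -> A) (Y : T -> B) :
  (forall t t', X t = X t' -> Y t = Y t') -> entropy Y <= entropy X.
Proof.
move=> h; rewrite lerN2; apply: ler_sum => t _.
have [->|n0] := eqVneq (P t) 0; first by rewrite !mul0r.
have Pt : 0 < P t by rewrite lt0r n0 P0.
rewrite ler_pM2l // log2_le ?pr_gt0 //.
rewrite [X in _ <= X](bigID (fun t' => X t' == X t)) /=.
rewrite [X in X + _](_ : _ = \sum_(t' | X t' == X t) P t') ?lerDl ?sumr_ge0 //.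
by apply: eq_bigl => t'; case: (X t' =P X t) => [/h ->|_]; rewrite ?eqxx ?andbF.
Qed.

Lemma joint_eq (A B : eqType) (X : T -> A) (Y : T -> B) t t' :
  (joint X Y t == joint X Y t') = (X t == X t') && (Y t == Y t').
Proof. by rewrite /joint xpair_eqE. Qed.

Lemma mutual_infoE (A B : finType) (X : T -> A) (Y : T -> B) :
  mutual_info P X Y = entropy X + entropy Y - entropy (joint X Y).
Proof.
rewrite /mutual_info.
rewrite (eq_bigr (fun a => \sum_b law P (joint X Y) (a, b) *
  (fun ab : A * B => log2 (law P (joint X Y) ab / (law P X ab.1 * law P Y ab.2))) (a, b))) //.
rewrite pair_bigA /=.
rewrite [LHS](eq_bigr (fun ab => law P (joint X Y) ab *
 log2 (law P (joint X Y) ab / (law P X ab.1 * law P Y ab.2)))); last by case.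
rewrite law_sum /entropy opprK -!sumrN -!big_split /=; apply: eq_bigr => t _.
have [->|n0] := eqVneq (P t) 0; first by rewrite !mul0r; ring.
have Pt : 0 < P t by rewrite lt0r n0 P0.
rewrite log2_div ?log2M ?mulr_gt0 ?law_gt0 //.
rewrite /law /joint; ring.
Qed.

Lemma cond_mutual_infoE (A B C : finType) (X : T -> A) (Y : T -> B) (Z : T -> C) :
  cond_mutual_info P X Y Z = entropy (joint X Z) + entropy (joint Y Z)
     - entropy (joint (joint X Y) Z) - entropy Z.
Proof.
pose f (abc : A * B * C) := log2 (law P (joint (joint X Y) Z) abc * law P Z abc.2 /
   (law P (joint X Z) (abc.1.1, abc.2) * law P (joint Y Z) (abc.1.2, abc.2))).
have -> : cond_mutual_info P X Y Z = \sum_abc law P (joint (joint X Y) Z) abc * f abc.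
  rewrite /cond_mutual_info pair_bigA /= pair_bigA /=.
  by apply: eq_bigr; case; case.
rewrite law_sum /entropy !opprK -!sumrN -!big_split /=; apply: eq_bigr => t _.
have [->|n0] := eqVneq (P t) 0; first by rewrite !mul0r; ring.
have Pt : 0 < P t by rewrite lt0r n0 P0.
rewrite /f log2_div ?log2M ?mulr_gt0 ?(@law_gt0 _ (joint X Z) t) ?(@law_gt0 _ (joint Y Z) t) ?law_gt0 //.
rewrite /law /joint /=; ring.
Qed.

Section LawJoint.
Variables (A B : finType) (X : T -> A) (Y : T -> B).

Lemma law_joint_suml b : \sum_a law P (joint X Y) (a, b) = law P Y b.
Proof.
rewrite /law [RHS](partition_big X predT) //=; apply: eq_bigr => a _.
by apply: eq_bigl => t; rewrite /joint xpair_eqE andbC.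
Qed.

Lemma law_joint_sumr a : \sum_b law P (joint X Y) (a, b) = law P X a.
Proof.
rewrite /law [RHS](partition_big Y predT) //=.
Qed.

End LawJoint.

(** The summand p(x,z) p(y,z) / p(z) is the law that makes X and Y independent given Z; conditional
    mutual information is the divergence from it. *)
Lemma cmi_sumq (A B C : finType) (X : T -> A) (Y : T -> B) (Z : T -> C) :
  \sum_(abc : A * B * C) law P (joint X Z) (abc.1.1, abc.2) *
  law P (joint Y Z) (abc.1.2, abc.2) / law P Z abc.2 = 1.
Proof.
have [_ <-] := law_pmf Z.
rewrite -[LHS](pair_bigA _ (fun ab c => law P (joint X Z) (ab.1, c) *
  law P (joint Y Z) (ab.2, c) / law P Z c)) /= exchange_big /=.
apply: eq_bigr => c _.
rewrite -[LHS](pair_bigA _ (fun a b => law P (joint X Z) (a, c) *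
  law P (joint Y Z) (b, c) / law P Z c)) /=.
transitivity (\sum_a law P (joint X Z) (a, c) * (law P Z c / law P Z c)).
  by apply: eq_bigr => a _; rewrite -mulr_suml -mulr_sumr law_joint_suml mulrA.
rewrite -mulr_suml law_joint_suml.
by have [->|n0] := eqVneq (law P Z c) 0; [rewrite mul0r | rewrite divff // mulr1].
Qed.

Section CMI.
Variables (A B C : finType) (X : T -> A) (Y : T -> B) (Z : T -> C).
Let p abc := law P (joint (joint X Y) Z) abc.
Let q (abc : A * B * C) := law P (joint X Z) (abc.1.1, abc.2) *
  law P (joint Y Z) (abc.1.2, abc.2) / law P Z abc.2.

Let cmi_gibbs : cond_mutual_info P X Y Z = \sum_i p i * log2 (p i / q i).
Proof.
rewrite /cond_mutual_info pair_bigA /= pair_bigA /=.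
by apply: eq_bigr => -[[a b] c] _; rewrite /p /q /= invf_div; congr (_ * log2 _); rewrite mulrA.
Qed.

Let q0 i : 0 <= q i.
Proof. by rewrite /q divr_ge0 ?mulr_ge0 ?law_ge0. Qed.

Let pq i : 0 < p i -> 0 < q i.
Proof.
case: i => [[a b] c] pi; rewrite /q /= divr_gt0 ?mulr_gt0 //; apply: lt_le_trans pi _;
 by apply: law_le => t; rewrite /joint => -[ex ey ez]; rewrite ?ex ?ey ?ez.
Qed.

Let le : \sum_i q i <= \sum_i p i.
Proof. by rewrite cmi_sumq; have [_ ->] := law_pmf (joint (joint X Y) Z). Qed.

Lemma cmi_ge0 : 0 <= cond_mutual_info P X Y Z.
Proof. by rewrite cmi_gibbs; apply: gibbs => // i; exact: law_ge0. Qed.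

(** Equality case of Gibbs. The cross-multiplied form also holds where Z has mass 0, and it is
    homogeneous, so it survives reweighting. *)
Lemma cmi_eq0 : cond_mutual_info P X Y Z = 0 <->
  forall a b c, law P (joint (joint X Y) Z) (a, b, c) * law P Z c =
    law P (joint X Z) (a, c) * law P (joint Y Z) (b, c).
Proof.
split=> [e a b c|e].
  have h : p =1 q.
    by apply: gibbs_eq => //; [move=> i; exact: law_ge0 | rewrite -cmi_gibbs].
  have := h (a, b, c); rewrite /p /q /= => ->.
  have [z0|n0] := eqVneq (law P Z c) 0; last by rewrite divfK.
  by rewrite z0 mulr0 (law_eq0_sub z0) ?mul0r // => t [].
rewrite /cond_mutual_info big1 // => a _; rewrite big1 // => b _; rewrite big1 // => c _.
have [->|n0] := eqVneq (law P (joint (joint X Y) Z) (a, b, c)) 0; first by rewrite mul0r.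
rewrite e divff ?log2_1 ?mulr0 // -e mulf_neq0 //.
by apply: contra n0 => /eqP z0; apply/eqP/(law_eq0_sub z0) => t [].
Qed.

End CMI.

(** The middle variable of the chain becomes the conditioning one, here the last argument. Pairs of
    mass 0, which [markov_chain] skips, satisfy the product identity because both sides vanish. *)
Lemma markov_chainE (A B C : finType) (X : T -> A) (Y : T -> B) (Z : T -> C) :
  markov_chain P X Y Z <-> cond_mutual_info P X Z Y = 0.
Proof.
have l3 a b c : law P (joint (joint X Y) Z) (a, b, c) = law P (joint (joint X Z) Y) (a, c, b).
  by apply: eq_bigl => t; rewrite /joint !xpair_eqE andbAC.
have l2 b c : law P (joint Y Z) (b, c) = law P (joint Z Y) (c, b).
  by apply: eq_bigl => t; rewrite /joint !xpair_eqE andbC.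
rewrite cmi_eq0; split=> [m a c b|m a b c pos].
  have [z0|n0] := eqVneq (law P (joint Y Z) (b, c)) 0.
    by rewrite -l2 z0 mulr0 (law_eq0_sub z0) ?mul0r // => t; rewrite /joint => -[_ -> ->].
  have pos : 0 < law P (joint Y Z) (b, c) by rewrite lt0r n0 law_ge0.
  have posb : law P Y b != 0.
    by rewrite gt_eqF //; apply: lt_le_trans pos _; apply: law_le => t [].
  have /eqP := m a b c pos; rewrite eqr_div // => /eqP.
  by rewrite l3 -l2.
have posb : law P Y b != 0.
  by rewrite gt_eqF //; apply: lt_le_trans pos _; apply: law_le => t [].
have posbc : law P (joint Y Z) (b, c) != 0 by rewrite gt_eqF.
by apply/eqP; rewrite eqr_div // l3 m l2.
Qed.

(** Gibbs against p(z) r(z,y): any guess [r z] of the posterior law of Y given [Z = z] bounds the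
    information from below. The achievability proof feeds it the posterior computed from the decoded
    sequences. *)
Lemma mutual_info_ge (A B : finType) (Y : T -> A) (Z : T -> B) (r : B -> A -> R) :
  (forall z y, 0 < r z y) -> (forall z, \sum_y r z y <= 1) ->
  entropy Y + \sum_t P t * log2 (r (Z t) (Y t)) <= mutual_info P Y Z.
Proof.
move=> r0 r1; rewrite mutual_infoE.
suff : 0 <= entropy Z - entropy (joint Y Z) - \sum_t P t * log2 (r (Z t) (Y t)) by lra.
pose p ab := law P (joint Y Z) ab.
pose q (ab : A * B) := law P Z ab.2 * r ab.2 ab.1.
have := @gibbs R _ p q; rewrite (_ : \sum_i p i * log2 (p i / q i) =
  entropy Z - entropy (joint Y Z) - \sum_t P t * log2 (r (Z t) (Y t))).
  apply.
  - by move=> i; exact: law_ge0.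
  - by move=> i; rewrite mulr_ge0 ?law_ge0 ?ltW.
  - move=> [y z] pos; rewrite mulr_gt0 //; apply: lt_le_trans pos _.
    by apply: law_le => t [].
  - have [_ ->] := law_pmf (joint Y Z); have [_ <-] := law_pmf Z.
    rewrite -(pair_bigA _ (fun y z => law P Z z * r z y)) /= exchange_big /=.
    by apply: ler_sum => z _; rewrite -mulr_sumr ler_piMr ?law_ge0.
rewrite /p law_sum /entropy !opprK -!sumrN -!big_split /=; apply: eq_bigr => t _.
have [->|n0] := eqVneq (P t) 0; first by rewrite !mul0r; ring.
have Pt : 0 < P t by rewrite lt0r n0 P0.
rewrite /q /= log2_div ?log2M ?mulr_gt0 ?law_gt0 //.
rewrite /law; ring.
Qed.

Lemma entropy_le_log (A : finType) (X : T -> A) : entropy X <= log2 #|A|%:R.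
Proof.
have [t _] : exists t, P t != 0.
  apply/existsP; apply: contraT; rewrite negb_exists => /forallP h.
  have : \sum_t P t = 0 by apply: big1 => t _; have /negPn/eqP := h t.
  by case: hP => _ ->; move/eqP; rewrite oner_eq0.
have A0 : 0 < #|A|%:R :> R by rewrite ltr0n; apply/card_gt0P; exists (X t).
suff : 0 <= log2 #|A|%:R - entropy X by lra.
have -> : log2 #|A|%:R - entropy X = \sum_a law P X a * log2 (law P X a / #|A|%:R^-1).
  rewrite law_sum /entropy opprK -[X in X + _]mul1r; case: hP => _ {1}<-.
  rewrite mulr_suml -big_split; apply: eq_bigr => u _ /=.
  have [->|n0] := eqVneq (P u) 0; first by rewrite !mul0r; ring.
  have Pt : 0 < P u by rewrite lt0r n0 P0.
  by rewrite invrK log2M ?law_gt0 // mulrDr addrC.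
apply: gibbs => [i|i|i _|]; rewrite ?law_ge0 ?invr_ge0 ?invr_gt0 ?(ltW A0) //.
rewrite big_const iter_addr_0 -[_ *+ _]mulr_natl divff ?gt_eqF //.
by have [_ ->] := law_pmf X.
Qed.

End Entropy.

(** * Shannon inequalities for up to eight variables *)

Section EntropySubmod.
Variables (R : realType) (T : finType) (P : T -> R).
Hypothesis hP : is_pmf P.

(** The class of [t] in the partition induced by [X]. All variables then take values in the one type
    [{set T}] and fit into a list, with unchanged entropies. *)
Definition fiber (A : eqType) (X : T -> A) t := [set t' | X t' == X t].

Lemma fiber_eq (A : eqType) (X : T -> A) t t' : (fiber X t == fiber X t') = (X t == X t').
Proof.
apply/eqP/eqP => [/setP /(_ t)|e]; first by rewrite !inE eqxx => /esym/eqP.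
by apply/setP => u; rewrite !inE e.
Qed.

(** Nonnegativity of I(X;Y|Z), phrased by functional dependence instead of tuples: Z is any common
    function of X and Y, and W any function of the pair. *)
Lemma entropy_submod (A B C D : eqType) (X : T -> A) (Y : T -> B) (Z : T -> C)
    (W : T -> D) :
  (forall t t', X t = X t' -> Z t = Z t') -> (forall t t', Y t = Y t' -> Z t = Z t') ->
  (forall t t', X t = X t' -> Y t = Y t' -> W t = W t') ->
  entropy P W + entropy P Z <= entropy P X + entropy P Y.
Proof.
move=> xz yz xyw.
have := cmi_ge0 hP (fiber X) (fiber Y) (fiber Z).
rewrite cond_mutual_infoE //.
have -> : entropy P (joint (fiber X) (fiber Z)) = entropy P X.
  apply: entropy_ext => // t t' _ _; rewrite joint_eq !fiber_eq.
  by case: eqP => // /xz ->; rewrite eqxx.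
have -> : entropy P (joint (fiber Y) (fiber Z)) = entropy P Y.
  apply: entropy_ext => // t t' _ _; rewrite joint_eq !fiber_eq.
  by case: eqP => // /yz ->; rewrite eqxx.
have -> : entropy P (fiber Z) = entropy P Z.
  by apply: entropy_ext => // t t' _ _; rewrite fiber_eq.
have : entropy P W <= entropy P (joint (joint (fiber X) (fiber Y)) (fiber Z)).
  apply: entropy_mono => // t t' /eqP; rewrite !joint_eq !fiber_eq.
  by move=> /andP[/andP[/eqP ? /eqP ?] _]; apply: xyw.
lra.
Qed.

End EntropySubmod.

(* A set of at most 8 variables is written as a list of indices; [bits] turns
   it into a canonical form that is the same for all lists of the same set. *)
Definition bits (s : seq nat) : seq bool := [seq has (eqn i) s | i <- iota 0 8].

Section FamilyEntropy.
Variables (R : realType) (T : finType) (P : T -> R).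
Hypothesis hP : is_pmf P.
Variable xs : seq (T -> {set T}).

Definition family_entropy (bs : seq bool) : R :=
  entropy P (fun t => mask bs [seq x t | x <- xs]).

Lemma eq_mask (A : eqType) (x0 : A) bs u v : size u = size bs -> size v = size bs ->
  mask bs u = mask bs v <-> forall i, nth false bs i -> nth x0 u i = nth x0 v i.
Proof.
elim: bs u v => [|b bs IH] [|x u] [|y v] //=.
move=> [su] [sv].
have [h1 h2] := IH u v su sv.
case: b => /=; split.
- by case=> -> /h1 h [|i] //=; exact: h.
- move=> h; congr (_ :: _); first exact: (h 0).
  by apply: h2 => i; exact: (h i.+1).
- by move=> /h1 h [|i] //=; exact: h.
- by move=> h; apply: h2 => i; exact: (h i.+1).
Qed.

Hypothesis xs8 : size xs = 8%N.

Lemma mask_bits s t t' :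
  mask (bits s) [seq x t | x <- xs] = mask (bits s) [seq x t' | x <- xs] <->
  forall i, (i < 8)%N -> i \in s -> nth (@fiber T unit (fun=> tt)) xs i t = nth (@fiber T unit (fun=> tt)) xs i t'.
Proof.
have sb : size (bits s) = 8 by rewrite size_map size_iota.
have nb i : (i < 8)%N -> nth false (bits s) i = (i \in s).
  move=> i8; rewrite (nth_map 0%N) ?size_iota // nth_iota // add0n.
  by elim: s {sb} => //= a s ->; rewrite inE.
have [||h1 h2] := @eq_mask {set T} finset.set0 (bits s) [seq x t | x <- xs] [seq x t' | x <- xs].
- by rewrite size_map xs8 sb.
- by rewrite size_map xs8 sb.
split=> [/h1 h i|h]; last apply: h2 => i.
  move=> i8 si; have := h i; rewrite nb // => /(_ si).
  by rewrite !(nth_map (@fiber T unit (fun=> tt))) ?xs8.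
have [i8|i8] := ltnP i 8; last by rewrite nth_default // sb.
by rewrite nb // => si; rewrite !(nth_map (@fiber T unit (fun=> tt))) ?xs8 ?h.
Qed.

(** The lists may overlap: [bits] forgets repetitions, so [cmi_of g a a c] is the conditional
    entropy of [a] given [c]. The value of [g] at the empty set is kept, not assumed to be 0. *)
Definition cmi_of (g : seq bool -> R) (a b c : seq nat) : R :=
  g (bits (a ++ c)) + g (bits (b ++ c)) - g (bits (a ++ b ++ c)) - g (bits c).

Lemma family_entropy_shannon a b c : 0 <= cmi_of family_entropy a b c.
Proof.
have H := @entropy_submod _ _ P hP _ _ _ _
  (fun t => mask (bits (a ++ c)) [seq x t | x <- xs])
  (fun t => mask (bits (b ++ c)) [seq x t | x <- xs])
  (fun t => mask (bits c) [seq x t | x <- xs])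
  (fun t => mask (bits (a ++ b ++ c)) [seq x t | x <- xs]).
suff : family_entropy (bits (a ++ b ++ c)) + family_entropy (bits c) <=
  family_entropy (bits (a ++ c)) + family_entropy (bits (b ++ c)) by rewrite /cmi_of; lra.
apply: H => t t' /mask_bits h; [| |move=> /mask_bits h']; apply/mask_bits => i i8.
- by move=> ic; apply: h; rewrite // mem_cat ic orbT.
- by move=> ic; apply: h; rewrite // mem_cat ic orbT.
rewrite !mem_cat => /or3P[] si; [apply: h|apply: h'|apply: h]; by rewrite // mem_cat si ?orbT.
Qed.

End FamilyEntropy.

Section Polymatroid.
Variables (R : realType) (g : seq bool -> R).
Local Notation I := (cmi_of g).
Hypothesis sh : forall a b c, 0 <= I a b c.

Lemma bits_ext s s' : s =i s' -> bits s = bits s'.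
Proof.
move=> e; apply: eq_map => i.
have hasE u : has (eqn i) u = (i \in u) by elim: u => //= a u ->; rewrite inE.
by rewrite !hasE e.
Qed.

Lemma cmi_ofC a b c : I a b c = I b a c.
Proof.
rewrite /cmi_of (_ : bits (b ++ a ++ c) = bits (a ++ b ++ c)); first by rewrite [g _ + g _]addrC.
by apply: bits_ext => i; rewrite !mem_cat orbCA.
Qed.

Lemma cmi_of_weak a1 a b c : {subset a1 <= a} -> I a b (a1 ++ c) <= I a b c.
Proof.
move=> s; have := sh a1 b c; rewrite /cmi_of.
rewrite (@bits_ext (a ++ a1 ++ c) (a ++ c)); last first.
  move=> i; rewrite !mem_cat; case ia1: (i \in a1); rewrite ?orbT ?orFb //=.
  by rewrite (s _ ia1).
rewrite (@bits_ext (a ++ b ++ a1 ++ c) (a ++ b ++ c)); last first.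
  move=> i; rewrite !mem_cat; case ia1: (i \in a1); rewrite ?orbT ?orFb //=.
  by rewrite (s _ ia1).
rewrite (@bits_ext (a1 ++ b ++ c) (b ++ a1 ++ c)); last first.
  by move=> i; rewrite !mem_cat orbCA.
lra.
Qed.

Lemma cmi_of_decomp a1 a b c : {subset a1 <= a ++ c} -> I a1 b c <= I a b c.
Proof.
move=> s; have := sh a b (a1 ++ c); rewrite /cmi_of.
rewrite (@bits_ext (a ++ a1 ++ c) (a ++ c)); last first.
  move=> i; rewrite !mem_cat; case ia1: (i \in a1); rewrite ?orbT ?orFb //=.
  by have := s _ ia1; rewrite mem_cat => ->.
rewrite (@bits_ext (a ++ b ++ a1 ++ c) (a ++ b ++ c)); last first.
  move=> i; rewrite !mem_cat; case ia1: (i \in a1); rewrite ?orbT ?orFb //=.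
  by have := s _ ia1; rewrite mem_cat => /orP[]->; rewrite ?orbT.
rewrite (@bits_ext (a1 ++ b ++ c) (b ++ a1 ++ c)); last first.
  by move=> i; rewrite !mem_cat orbCA.
lra.
Qed.

Lemma cmi_of_ext a b c c' : c =i c' -> I a b c = I a b c'.
Proof.
move=> e; rewrite /cmi_of; congr (_ + _ - _ - _); congr g; apply: bits_ext => i;
 by rewrite ?mem_cat e.
Qed.

(** Weak union and decomposition in one step: parts of [a] and [b] may move into the condition, and
    the rest may shrink. On concrete lists the side condition is decided by computation. *)
Lemma ci_sub a b c a' b' c' : I a b c = 0 ->
  [&& all (mem c') c, all (mem (a ++ b ++ c)) c', all (mem (a ++ c')) a' & all (mem (b ++ c')) b'] ->
  I a' b' c' = 0.
Proof.
move=> e /and4P[/allP cc' /allP c'c /allP aa' /allP bb'].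
apply/eqP; rewrite eq_le sh andbT -e.
(* The parts of the new condition that come from [a] and from [b]; they are moved there one after
   the other. *)
pose a1 := seq.filter (mem a) c'; pose b1 := seq.filter (mem b) c'.
have s1 : {subset a1 <= a} by move=> i; rewrite mem_filter => /andP[].
have s2 : {subset b1 <= b} by move=> i; rewrite mem_filter => /andP[].
have ec : c' =i b1 ++ a1 ++ c.
  move=> i; rewrite !mem_cat !mem_filter /=; apply/idP/idP.
    by move=> h; have := c'c _ h; rewrite /= !mem_cat h !andbT => /or3P[]->; rewrite ?orbT.
  by case/or3P => [/andP[]|/andP[]|/cc'].
apply: le_trans (cmi_of_weak b c s1).
rewrite [I a b _]cmi_ofC; apply: le_trans (cmi_of_weak a (a1 ++ c) s2).
rewrite -(cmi_of_ext b a ec) [I b a _]cmi_ofC.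
apply: le_trans (cmi_of_decomp _ aa') _.
rewrite cmi_ofC [I a b _]cmi_ofC; exact: cmi_of_decomp bb'.
Qed.

(** The contraction rule, that is, the chain rule for I(a; b d | c). *)
Lemma ci_contract a b c d : I a b c = 0 -> I a d (b ++ c) = 0 -> I a (b ++ d) c = 0.
Proof.
rewrite /cmi_of.
rewrite (@bits_ext (d ++ b ++ c) ((b ++ d) ++ c)); last first.
  by move=> i; rewrite !mem_cat -orbA orbCA.
rewrite (@bits_ext (a ++ d ++ b ++ c) (a ++ (b ++ d) ++ c)); last first.
  by move=> i; rewrite !mem_cat; do !bool_congr.
lra.
Qed.

(* Variables: 0, 1, 2 = X1, X2, Y of the first block, 3, 4, 5 = X1, X2, Y of
   the second block, 6, 7 = V1, V2. *)
Section TwoBlocks.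
Hypothesis ind : I [:: 0; 1; 2] [:: 3; 4; 5] [::] = 0.
Hypothesis ma : I [:: 0] [:: 1] [:: 2] = 0.
Hypothesis mb : I [:: 3] [:: 4] [:: 5] = 0.
Hypothesis m1 : I [:: 6] [:: 1; 2; 4; 5] [:: 0; 3] = 0.
Hypothesis m2 : I [:: 7] [:: 0; 2; 3; 5] [:: 6; 1; 4] = 0.

Let sub := ci_sub.
Let ind' : I [:: 3; 4; 5] [:: 0; 1; 2] [::] = 0. Proof. by rewrite cmi_ofC. Qed.
Let m1' : I [:: 1; 2; 4; 5] [:: 6] [:: 0; 3] = 0. Proof. by rewrite cmi_ofC. Qed.
Let m2' : I [:: 0; 2; 3; 5] [:: 7] [:: 6; 1; 4] = 0. Proof. by rewrite cmi_ofC. Qed.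
Let ma' : I [:: 1] [:: 0] [:: 2] = 0. Proof. by rewrite cmi_ofC. Qed.
Let mb' : I [:: 4] [:: 3] [:: 5] = 0. Proof. by rewrite cmi_ofC. Qed.

(** Given X1 of the first block, (X2, Y) of that block is independent of the second block and of V1:
    the blocks are independent and V1 is generated from the two X1. *)
Let k12 : I [:: 1; 2] [:: 3; 4; 5; 6] [:: 0] = 0.
Proof.
have h1 : I [:: 1; 2] [:: 3; 4; 5] [:: 0] = 0 by apply: sub ind _.
have h2 : I [:: 1; 2] [:: 6] [:: 3; 4; 5; 0] = 0 by apply: sub m1' _.
by have := ci_contract h1 h2.
Qed.

Let k45 : I [:: 4; 5] [:: 0; 1; 2; 6] [:: 3] = 0.
Proof.
have h1 : I [:: 4; 5] [:: 0; 1; 2] [:: 3] = 0 by apply: sub ind' _.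
have h2 : I [:: 4; 5] [:: 6] [:: 0; 1; 2; 3] = 0 by apply: sub m1' _.
by have := ci_contract h1 h2.
Qed.

Lemma block1_V1 : I [:: 6; 4] [:: 1; 2] [:: 0] = 0.
Proof. by rewrite cmi_ofC; apply: sub k12 _. Qed.

Lemma block1_V2 : I [:: 7] [:: 0; 2] [:: 6; 4; 1] = 0.
Proof. by apply: sub m2 _. Qed.

Lemma block2_V1 : I [:: 6; 0; 2] [:: 4; 5] [:: 3] = 0.
Proof. by rewrite cmi_ofC; apply: sub k45 _. Qed.

Let k1 : I [:: 1] [:: 3; 4; 5; 6] [:: 0; 2] = 0.
Proof. by apply: sub k12 _. Qed.

(** V2 is generated from V1 and both X2, but the new first auxiliary (V1, X1, Y) omits X2 of the
    first block. Given the auxiliary and the second X2, that missing variable is independent of the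
    second X1 and Y, so contraction removes it. *)
Lemma block2_V2 : I [:: 7] [:: 3; 5] [:: 6; 0; 2; 4] = 0.
Proof.
have h1 : I [:: 3; 5] [:: 1] [:: 6; 0; 2; 4] = 0 by rewrite cmi_ofC; apply: sub k1 _.
have h2 : I [:: 3; 5] [:: 7] [:: 1; 6; 0; 2; 4] = 0 by apply: sub m2' _.
by have := ci_contract h1 h2; rewrite cmi_ofC => h; apply: sub h _.
Qed.

Lemma two_blocks_source : I [:: 0; 3] [:: 1; 4] [:: 2; 5] = 0.
Proof.
have a1 : I [:: 1] [:: 3; 5] [:: 0; 2] = 0 by apply: sub ind _.
have a2 : I [:: 1] [:: 0; 3; 5] [:: 2] = 0 by have := ci_contract ma' a1.
have a3 : I [:: 1] [:: 0; 3] [:: 2; 5] = 0 by apply: sub a2 _.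
have b1 : I [:: 4] [:: 0; 1; 2] [:: 3; 5] = 0 by apply: sub ind' _.
have b2 : I [:: 4] [:: 3; 0; 1; 2] [:: 5] = 0 by have := ci_contract mb' b1.
have b3 : I [:: 4] [:: 0; 3] [:: 1; 2; 5] = 0 by apply: sub b2 _.
by rewrite cmi_ofC in a3; rewrite cmi_ofC in b3; have := ci_contract a3 b3.
Qed.

(** The chain of the two-block source survives conditioning on V1 and adjoining V2 on the X2
    side. *)
Let k0314 : I [:: 0; 3] [:: 1; 4; 7] [:: 2; 5; 6] = 0.
Proof.
have c1 := two_blocks_source.
have c2 : I [:: 1; 4] [:: 6] [:: 0; 3; 2; 5] = 0 by apply: sub m1' _.
have c3 : I [:: 1; 4] [:: 0; 3; 6] [:: 2; 5] = 0.
  by rewrite cmi_ofC in c1; have := ci_contract c1 c2.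
have d1 : I [:: 0; 3] [:: 1; 4] [:: 2; 5; 6] = 0 by rewrite cmi_ofC; apply: sub c3 _.
have d2 : I [:: 0; 3] [:: 7] [:: 1; 4; 2; 5; 6] = 0 by apply: sub m2' _.
by have := ci_contract d1 d2.
Qed.

(** V2 drops out of all three terms by its Markov chain. After that everything is an equality up to
    one discarded term, [e9]. *)
Lemma two_blocks_a : I [:: 0] [:: 6; 4; 7] [:: 1] + I [:: 3] [:: 6; 0; 2; 7] [:: 4] <=
  I [:: 0; 3] [:: 6; 7] [:: 1; 4].
Proof.
have e2 : I [:: 0; 3] [:: 7] [:: 6; 1; 4] = 0 by apply: sub m2' _.
have e3 : I [:: 0] [:: 7] [:: 6; 1; 4] = 0 by apply: sub m2' _.
have e4 : I [:: 3] [:: 7] [:: 6; 0; 2; 4] = 0 by rewrite cmi_ofC; apply: sub block2_V2 _.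
have e5 : I [:: 0] [:: 4] [:: 1] = 0 by apply: sub ind _.
have e6 : I [:: 3] [:: 0] [:: 4] = 0 by apply: sub ind' _.
have e7 : I [:: 3] [:: 1] [:: 0; 4] = 0 by apply: sub ind' _.
have e8 : I [:: 3] [:: 2] [:: 0; 4; 6] = 0 by rewrite cmi_ofC; apply: sub k12 _.
have e9 := sh [:: 3] [:: 1] [:: 0; 4; 6].
move: e2 e3 e4 e5 e6 e7 e8 e9; rewrite /cmi_of /bits /=; lra.
Qed.

(** By [e4], which rests on the chain X1 - Y - X2, the first block's X1 enters the auxiliary of the
    second block at no cost. *)
Let two_blocks_X2 : I [:: 1] [:: 6; 4; 7] [:: 2] + I [:: 4] [:: 6; 0; 2; 7] [:: 5] <=
  I [:: 1; 4] [:: 6; 7] [:: 2; 5].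
Proof.
have e1 : I [:: 1] [:: 4] [:: 2] = 0 by apply: sub ind _.
have e2 : I [:: 1] [:: 5] [:: 2; 4] = 0 by apply: sub ind _.
have e3 : I [:: 4] [:: 2] [:: 5] = 0 by apply: sub ind' _.
have e4 : I [:: 4] [:: 0] [:: 2; 5; 6; 7] = 0 by rewrite cmi_ofC; apply: sub k0314 _.
have e5 := sh [:: 1] [:: 5] [:: 2; 4; 6; 7].
move: e1 e2 e3 e4 e5; rewrite /cmi_of /bits /=; lra.
Qed.

(** To [two_blocks_X2] it adds the bound for the subtracted terms: with primes for the second block,
    I(Y Y';V1) <= I(Y;V1 X2') + I(Y';V1 X1 Y). *)
Lemma two_blocks_b : I [:: 1] [:: 6; 4; 7] [:: 2] - I [:: 2] [:: 6; 4] [::]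
    + (I [:: 4] [:: 6; 0; 2; 7] [:: 5] - I [:: 5] [:: 6; 0; 2] [::]) <=
  I [:: 1; 4] [:: 6; 7] [:: 2; 5] - I [:: 2; 5] [:: 6] [::].
Proof.
have := two_blocks_X2.
have e1 := sh [:: 2] [:: 4] [:: 6].
have e2 := sh [:: 5] [:: 2] [::].
have e3 := sh [:: 5] [:: 0] [:: 2; 6].
move: e1 e2 e3; rewrite /cmi_of /bits /=; lra.
Qed.

Lemma two_blocks_c : I [:: 0; 1] [:: 6; 4; 7] [:: 2] + I [:: 3; 4] [:: 6; 0; 2; 7] [:: 5] <=
  I [:: 0; 3; 1; 4] [:: 6; 7] [:: 2; 5].
Proof.
have := two_blocks_X2.
have e1 : I [:: 0; 3] [:: 7] [:: 6; 1; 4; 2; 5] = 0 by apply: sub m2' _.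
have e2 : I [:: 0] [:: 7] [:: 6; 1; 4; 2] = 0 by apply: sub m2' _.
have e3 : I [:: 0] [:: 4] [:: 1; 2] = 0 by apply: sub ind _.
have e4 : I [:: 0] [:: 5] [:: 1; 2; 4] = 0 by apply: sub ind _.
have e5 : I [:: 3] [:: 7] [:: 6; 0; 2; 4; 5] = 0 by rewrite cmi_ofC; apply: sub block2_V2 _.
have e6 : I [:: 3] [:: 0; 2] [:: 4; 5] = 0 by apply: sub ind' _.
have e7 : I [:: 3] [:: 1] [:: 0; 2; 4; 5] = 0 by apply: sub ind' _.
have e8 := sh [:: 0] [:: 5] [:: 6; 1; 2; 4].
have e9 := sh [:: 3] [:: 1] [:: 6; 0; 2; 4; 5].
move: e1 e2 e3 e4 e5 e6 e7 e8 e9; rewrite /cmi_of /bits /=; lra.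
Qed.

(** Opposite direction to the three rates: the enlarged auxiliaries can only know more about Y. *)
Lemma two_blocks_d : I [:: 2; 5] [:: 6; 7] [::] <=
  I [:: 2] [:: 6; 4; 7] [::] + I [:: 5] [:: 6; 0; 2; 7] [::].
Proof.
have e1 := sh [:: 2] [:: 4] [:: 6; 7].
have e2 := sh [:: 5] [:: 2] [::].
have e3 := sh [:: 5] [:: 0] [:: 2; 6; 7].
move: e1 e2 e3; rewrite /cmi_of /bits /=; lra.
Qed.

End TwoBlocks.
End Polymatroid.

(** * The four rate expressions and their behaviour on two blocks *)

Section Rates.
Variables (R : realType) (T : finType) (P : T -> R) (A1 A2 B U1 U2 : finType).
Variables (X1 : T -> A1) (X2 : T -> A2) (Y : T -> B) (V1 : T -> U1) (V2 : T -> U2).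

Definition rate1 := cond_mutual_info P X1 (joint V1 V2) X2.
(** The outer bound on [R2] without its summand [mu]; adding [relevance] instead gives the inner
    bound ([rate2_relevance]). It may be negative: for a source with X1 - Y - X2 and constant V2 it
    is minus the relevance. *)
Definition rate2 := cond_mutual_info P X2 (joint V1 V2) Y - mutual_info P Y V1.
Definition rate12 := cond_mutual_info P (joint X1 X2) (joint V1 V2) Y.
Definition relevance := mutual_info P Y (joint V1 V2).
Definition aux_markov := cond_mutual_info P V1 (joint X2 Y) X1 = 0 /\
  cond_mutual_info P V2 (joint X1 Y) (joint V1 X2) = 0.

End Rates.

Lemma entropy_const (R : realType) (T : finType) (P : T -> R) (A : eqType) (X : T -> A) :
  is_pmf P -> (forall t t', X t = X t') -> entropy P X = 0.
Proof.
move=> [_ hP] h; rewrite /entropy big1 ?oppr0 // => t _.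
rewrite (eq_bigl predT) ?hP ?log2_1 ?mulr0 // => t'.
by rewrite (h t' t) eqxx.
Qed.

Lemma mutual_info_cmi (R : realType) (T : finType) (P : T -> R) (A B : finType)
  (X : T -> A) (Y : T -> B) : is_pmf P ->
  mutual_info P X Y = cond_mutual_info P X Y (fun=> tt).
Proof.
move=> hP; rewrite mutual_infoE // cond_mutual_infoE // (@entropy_const _ _ _ _ (fun=> tt)) //.
rewrite subr0; congr (_ + _ - _); apply: entropy_ext => // t t' _ _;
  by rewrite !joint_eq andbT.
Qed.

Lemma entropy_eq (R : realType) (T : finType) (P : T -> R) (A B : eqType) (X : T -> A) (Y : T -> B) :
  is_pmf P -> (forall t t', (X t == X t') = (Y t == Y t')) -> entropy P X = entropy P Y.
Proof. by move=> hP h; apply: entropy_ext. Qed.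

Ltac bool_cases := repeat match goal with
  |- context [?a == ?b] => let c := fresh in set c := (a == b); clearbody c; case: c => //= end.

Ltac solve_entropy := apply: entropy_eq => // t t';
  rewrite /= ?eqseq_cons ?fiber_eq ?joint_eq; bool_cases.

Section TwoBlocks.
Variables (R : realType) (T : finType) (P : T -> R).
Hypothesis hP : is_pmf P.
Variables (A1 A2 B A1' A2' B' A1'' A2'' B'' U1 U2 : finType).
Variables (X1 : T -> A1) (X2 : T -> A2) (Y : T -> B).
Variables (X1' : T -> A1') (X2' : T -> A2') (Y' : T -> B').
Variables (X1'' : T -> A1'') (X2'' : T -> A2'') (Y'' : T -> B'').
Variables (V1 : T -> U1) (V2 : T -> U2).

(** The double-primed variables need only induce the same partition as the pairs. A sequence of n +
    1 letters can thus play the role of (first letter, rest) without change of type. *)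
Hypothesis X1E : forall t t', (X1'' t == X1'' t') = (X1 t == X1 t') && (X1' t == X1' t').
Hypothesis X2E : forall t t', (X2'' t == X2'' t') = (X2 t == X2 t') && (X2' t == X2' t').
Hypothesis YE : forall t t', (Y'' t == Y'' t') = (Y t == Y t') && (Y' t == Y' t').

Hypothesis ind : mutual_info P (joint (joint X1 X2) Y) (joint (joint X1' X2') Y') = 0.
Hypothesis src : cond_mutual_info P X1 X2 Y = 0.
Hypothesis src' : cond_mutual_info P X1' X2' Y' = 0.
Hypothesis aux : aux_markov P X1'' X2'' Y'' V1 V2.

Let xs := [:: fiber X1; fiber X2; fiber Y; fiber X1'; fiber X2'; fiber Y'; fiber V1; fiber V2].
Let g := family_entropy P xs.
Let sh : forall a b c, 0 <= cmi_of g a b c.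
Proof. exact: family_entropy_shannon. Qed.

Let V1a := joint V1 X2'.
Let V1b := joint (joint V1 X1) Y.

Ltac solve_cmi := rewrite ?mutual_info_cmi // cond_mutual_infoE // /g /cmi_of /family_entropy;
  congr (_ + _ - _ - _); apply: entropy_eq => // t t';
  rewrite /= ?eqseq_cons ?fiber_eq /V1a /V1b ?joint_eq ?X1E ?X2E ?YE; bool_cases.

Let gind : cmi_of g [:: 0; 1; 2] [:: 3; 4; 5] [::] = 0.
Proof. rewrite -ind; symmetry; solve_cmi. Qed.
Let gsrc : cmi_of g [:: 0] [:: 1] [:: 2] = 0.
Proof. rewrite -src; symmetry; solve_cmi. Qed.
Let gsrc' : cmi_of g [:: 3] [:: 4] [:: 5] = 0.
Proof. rewrite -src'; symmetry; solve_cmi. Qed.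

Lemma two_blocks_src : cond_mutual_info P X1'' X2'' Y'' = 0.
Proof. rewrite -(two_blocks_source sh gind gsrc gsrc'); solve_cmi. Qed.

Let gm1 : cmi_of g [:: 6] [:: 1; 2; 4; 5] [:: 0; 3] = 0.
Proof. case: aux => <- _; symmetry; solve_cmi. Qed.
Let gm2 : cmi_of g [:: 7] [:: 0; 2; 3; 5] [:: 6; 1; 4] = 0.
Proof. case: aux => _ <-; symmetry; solve_cmi. Qed.

Lemma two_blocks_aux1 : aux_markov P X1 X2 Y V1a V2.
Proof.
split.
- by rewrite -(block1_V1 sh gind gm1); solve_cmi.
- by rewrite -(block1_V2 sh gm2); solve_cmi.
Qed.

Lemma two_blocks_aux2 : aux_markov P X1' X2' Y' V1b V2.
Proof.
split.
- by rewrite -(block2_V1 sh gind gm1); solve_cmi.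
- by rewrite -(block2_V2 sh gind gm1 gm2); solve_cmi.
Qed.

Lemma two_blocks_rate1 : rate1 P X1 X2 V1a V2 + rate1 P X1' X2' V1b V2 <= rate1 P X1'' X2'' V1 V2.
Proof.
have -> : rate1 P X1'' X2'' V1 V2 = cmi_of g [:: 0; 3] [:: 6; 7] [:: 1; 4] by rewrite /rate1; solve_cmi.
have -> : rate1 P X1 X2 V1a V2 = cmi_of g [:: 0] [:: 6; 4; 7] [:: 1] by rewrite /rate1; solve_cmi.
have -> : rate1 P X1' X2' V1b V2 = cmi_of g [:: 3] [:: 6; 0; 2; 7] [:: 4] by rewrite /rate1; solve_cmi.
exact: two_blocks_a.
Qed.

Lemma two_blocks_rate2 : rate2 P X2 Y V1a V2 + rate2 P X2' Y' V1b V2 <= rate2 P X2'' Y'' V1 V2.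
Proof.
have -> : rate2 P X2'' Y'' V1 V2 =
    cmi_of g [:: 1; 4] [:: 6; 7] [:: 2; 5] - cmi_of g [:: 2; 5] [:: 6] [::].
  by rewrite /rate2; congr (_ - _); solve_cmi.
have -> : rate2 P X2 Y V1a V2 =
    cmi_of g [:: 1] [:: 6; 4; 7] [:: 2] - cmi_of g [:: 2] [:: 6; 4] [::].
  by rewrite /rate2; congr (_ - _); solve_cmi.
have -> : rate2 P X2' Y' V1b V2 =
    cmi_of g [:: 4] [:: 6; 0; 2; 7] [:: 5] - cmi_of g [:: 5] [:: 6; 0; 2] [::].
  by rewrite /rate2; congr (_ - _); solve_cmi.
exact: two_blocks_b.
Qed.

Lemma two_blocks_rate12 :
  rate12 P X1 X2 Y V1a V2 + rate12 P X1' X2' Y' V1b V2 <= rate12 P X1'' X2'' Y'' V1 V2.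
Proof.
have -> : rate12 P X1'' X2'' Y'' V1 V2 = cmi_of g [:: 0; 3; 1; 4] [:: 6; 7] [:: 2; 5].
  by rewrite /rate12; solve_cmi.
have -> : rate12 P X1 X2 Y V1a V2 = cmi_of g [:: 0; 1] [:: 6; 4; 7] [:: 2].
  by rewrite /rate12; solve_cmi.
have -> : rate12 P X1' X2' Y' V1b V2 = cmi_of g [:: 3; 4] [:: 6; 0; 2; 7] [:: 5].
  by rewrite /rate12; solve_cmi.
exact: two_blocks_c.
Qed.

Lemma two_blocks_relevance :
  relevance P Y'' V1 V2 <= relevance P Y V1a V2 + relevance P Y' V1b V2.
Proof.
have -> : relevance P Y'' V1 V2 = cmi_of g [:: 2; 5] [:: 6; 7] [::].
  by rewrite /relevance; solve_cmi.
have -> : relevance P Y V1a V2 = cmi_of g [:: 2] [:: 6; 4; 7] [::].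
  by rewrite /relevance; solve_cmi.
have -> : relevance P Y' V1b V2 = cmi_of g [:: 5] [:: 6; 0; 2; 7] [::].
  by rewrite /relevance; solve_cmi.
exact: two_blocks_d.
Qed.

End TwoBlocks.

(** * Realizable rate quadruples *)

Section LawComp.
Variables (R : realType) (T W : finType) (P : T -> R) (Z : T -> W).

Lemma mutual_info_law (A B : finType) (X : W -> A) (Y : W -> B) :
  mutual_info (law P Z) X Y = mutual_info P (X \o Z) (Y \o Z).
Proof. by apply: eq_bigr => a _; apply: eq_bigr => b _; rewrite !law_comp. Qed.

Lemma cond_mutual_info_law (A B C : finType) (X : W -> A) (Y : W -> B) (V : W -> C) :
  cond_mutual_info (law P Z) X Y V = cond_mutual_info P (X \o Z) (Y \o Z) (V \o Z).
Proof.
by apply: eq_bigr => a _; apply: eq_bigr => b _; apply: eq_bigr => c _; rewrite !law_comp.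
Qed.

End LawComp.

Lemma cmi_ker (R : realType) (T : finType) (P : T -> R) (A B C A' B' C' : finType)
  (X : T -> A) (Y : T -> B) (Z : T -> C) (X' : T -> A') (Y' : T -> B') (Z' : T -> C') :
  is_pmf P ->
  (forall t t', 0 < P t -> 0 < P t' -> (X t == X t') = (X' t == X' t')) ->
  (forall t t', 0 < P t -> 0 < P t' -> (Y t == Y t') = (Y' t == Y' t')) ->
  (forall t t', 0 < P t -> 0 < P t' -> (Z t == Z t') = (Z' t == Z' t')) ->
  cond_mutual_info P X Y Z = cond_mutual_info P X' Y' Z'.
Proof.
move=> hP hX hY hZ; rewrite !cond_mutual_infoE //.
congr (_ + _ - _ - _); apply: entropy_ext => // t t' Pt Pt'; by rewrite ?joint_eq ?hX ?hY ?hZ.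
Qed.

Lemma law_eq_pmf (R : realType) (T S : finType) (P : T -> R) (p : S -> R) (X : T -> S) :
  is_pmf p -> law P X =1 p -> (forall t, 0 <= P t) -> is_pmf P.
Proof.
move=> [_ p1] e P0; split=> //; have := law_sum P X (fun=> 1).
under eq_bigr do rewrite mulr1; under [in RHS]eq_bigr do rewrite mulr1.
by move=> <-; under eq_bigr do rewrite e.
Qed.

Section Realizable.
Variables (R : realType) (A1 A2 B : finType) (p : A1 * A2 * B -> R).
Hypothesis hp : is_pmf p.

Section System.
Variables (T : finType) (P : T -> R) (S : T -> A1 * A2 * B) (U1 U2 : finType).
Variables (V1 : T -> U1) (V2 : T -> U2).

(** The conditions of [is_aux_extension] on an arbitrary sample space with source [S], so that
    variables can be built freely and pushed to the canonical space at the end. *)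
Definition aux_system := [/\ is_pmf P, law P S =1 p &
  aux_markov P (@src_X1 A1 A2 B \o S) (@src_X2 A1 A2 B \o S) (@src_Y A1 A2 B \o S) V1 V2].

Definition has_rates (r1 r2 r12 d : R) :=
  [/\ r1 = rate1 P (@src_X1 A1 A2 B \o S) (@src_X2 A1 A2 B \o S) V1 V2,
      r2 = rate2 P (@src_X2 A1 A2 B \o S) (@src_Y A1 A2 B \o S) V1 V2,
      r12 = rate12 P (@src_X1 A1 A2 B \o S) (@src_X2 A1 A2 B \o S)
              (@src_Y A1 A2 B \o S) V1 V2 &
      d = relevance P (@src_Y A1 A2 B \o S) V1 V2].

End System.

Definition realizable (r1 r2 r12 d : R) := exists (U1 U2 : finType) (q : A1 * A2 * B * U1 * U2 -> R),
  is_aux_extension p q /\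
  has_rates q (@aux_src _ U1 U2) (@aux_V1 _ U1 U2) (@aux_V2 _ U1 U2) r1 r2 r12 d.

Lemma is_aux_extensionE (U1 U2 : finType) (q : A1 * A2 * B * U1 * U2 -> R) :
  is_aux_extension p q <-> aux_system q (@aux_src _ U1 U2) (@aux_V1 _ U1 U2) (@aux_V2 _ U1 U2).
Proof.
split=> [[h1 h2 h3 h4]|[h1 h2 [h3 h4]]]; split => //.
- by split; apply/markov_chainE.
- by apply/markov_chainE.
- by apply/markov_chainE.
Qed.

Lemma aux_system_push (T U1 U2 : finType) (P : T -> R) (S : T -> A1 * A2 * B) (V1 : T -> U1) (V2 : T -> U2)
  (q := law P (joint (joint S V1) V2)) :
  aux_system P S V1 V2 -> is_aux_extension p q.
Proof.
move=> [hP hS [h1 h2]]; apply/is_aux_extensionE; split.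
- exact: law_pmf.
- by move=> s; rewrite law_comp -hS.
- by split; rewrite cond_mutual_info_law.
Qed.

Lemma has_rates_push (T U1 U2 : finType) (P : T -> R) (S : T -> A1 * A2 * B) (V1 : T -> U1) (V2 : T -> U2)
  (q := law P (joint (joint S V1) V2)) a b c d :
  has_rates P S V1 V2 a b c d ->
  has_rates q (@aux_src _ U1 U2) (@aux_V1 _ U1 U2) (@aux_V2 _ U1 U2) a b c d.
Proof.
case=> -> -> -> ->; split; rewrite /rate1 /rate2 /rate12 /relevance /q;
  by rewrite ?cond_mutual_info_law ?mutual_info_law.
Qed.

Lemma realizable_system (T U1 U2 : finType) (P : T -> R) (S : T -> A1 * A2 * B)
    (V1 : T -> U1) (V2 : T -> U2) a b c d :
  aux_system P S V1 V2 -> has_rates P S V1 V2 a b c d -> realizable a b c d.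
Proof.
move=> h hr; exists U1, U2, (law P (joint (joint S V1) V2)).
by split; [exact: aux_system_push | exact: has_rates_push].
Qed.

(** * Mixtures of two sample spaces *)

Section Mixture.
Variables (T1 T2 : finType) (P1 : T1 -> R) (P2 : T2 -> R) (l : R).
Hypotheses (hP1 : is_pmf P1) (hP2 : is_pmf P2) (l0 : 0 <= l) (l1 : l <= 1).

Definition mixture (t : T1 + T2) : R :=
  match t with inl t => l * P1 t | inr t => (1 - l) * P2 t end.

Lemma sum_mixture (Q : pred (T1 + T2)) (f : T1 + T2 -> R) :
  \sum_(t | Q t) mixture t * f t =
  l * (\sum_(t | Q (inl t)) P1 t * f (inl t)) + (1 - l) * (\sum_(t | Q (inr t)) P2 t * f (inr t)).
Proof.
by rewrite big_sumType /= !mulr_sumr; congr (_ + _); apply: eq_bigr => t _; rewrite mulrA.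
Qed.

Lemma sum_mixture1 (Q : pred (T1 + T2)) :
  \sum_(t | Q t) mixture t =
  l * (\sum_(t | Q (inl t)) P1 t) + (1 - l) * (\sum_(t | Q (inr t)) P2 t).
Proof. by rewrite big_sumType /= !mulr_sumr. Qed.

Lemma mixture_pmf : is_pmf mixture.
Proof.
case: (hP1) (hP2) => [p1 s1] [p2 s2].
split; first by case=> t /=; rewrite mulr_ge0 // subr_ge0.
by rewrite sum_mixture1 s1 s2 !mulr1 addrC subrK.
Qed.

Definition binary_entropy := - (l * log2 l) - (1 - l) * log2 (1 - l).

(** Every variable that reveals the component carries the same extra term, the entropy of the
    component, which then cancels in conditional mutual informations. *)
Lemma entropy_mixture_sep (A : eqType) (X : T1 + T2 -> A) :
  (forall t t', X (inl t) != X (inr t')) ->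
  entropy mixture X = l * entropy P1 (X \o inl) + (1 - l) * entropy P2 (X \o inr)
    + binary_entropy.
Proof.
move=> sep; rewrite /entropy sum_mixture.
have key (T : finType) (P : T -> R) (k : R) (f : T -> R) : is_pmf P -> 0 <= k ->
    (forall t, 0 < P t -> 0 < f t) ->
    k * (\sum_t P t * log2 (k * f t)) = k * log2 k + k * \sum_t P t * log2 (f t).
  move=> [p0 s1]; rewrite le0r => /orP[/eqP ->|k0]; first by rewrite !mul0r addr0.
  move=> f0; rewrite -mulrDr -[log2 k]mul1r -s1 mulr_suml -big_split; congr (_ * _).
  apply: eq_bigr => t _ /=; have [->|n0] := eqVneq (P t) 0; first by rewrite !mul0r addr0.
  by rewrite log2M ?mulrDr // f0 // lt0r n0 p0.
have e1 t : \sum_(t' | X t' == X (inl t)) mixture t' = l * \sum_(t' | X (inl t') == X (inl t)) P1 t'.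
  rewrite sum_mixture1 [X in _ + _ * X]big1 ?mulr0 ?addr0 // => t'.
  by rewrite eq_sym (negPf (sep _ _)).
have e2 t : \sum_(t' | X t' == X (inr t)) mixture t' = (1 - l) * \sum_(t' | X (inr t') == X (inr t)) P2 t'.
  rewrite sum_mixture1 big1 ?mulr0 ?add0r // => t'.
  by rewrite (negPf (sep _ _)).
under eq_bigr do rewrite e1.
under [X in _ + _ * X]eq_bigr do rewrite e2.
rewrite key // => [|t Pt]; last exact: (@pr_gt0 _ _ _ hP1 _ (X \o inl)).
rewrite key // => [||t Pt]; rewrite ?subr_ge0 //; last exact: (@pr_gt0 _ _ _ hP2 _ (X \o inr)).
by rewrite /binary_entropy /=; ring.
Qed.

Lemma law_mixture_same (A : finType) (X : T1 + T2 -> A) :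
  law P1 (X \o inl) =1 law P2 (X \o inr) -> law mixture X =1 law P1 (X \o inl).
Proof.
move=> e a; rewrite {1}/law sum_mixture1; have := e a; rewrite /law /= => ->.
by rewrite mulrBl mul1r addrC subrK.
Qed.

Lemma entropy_mixture_same (A : finType) (X : T1 + T2 -> A) :
  law P1 (X \o inl) =1 law P2 (X \o inr) ->
  entropy mixture X = l * entropy P1 (X \o inl) + (1 - l) * entropy P2 (X \o inr).
Proof.
move=> e; rewrite !entropyE.
under eq_bigr do rewrite law_mixture_same //.
under [X in _ = _ + _ * - X]eq_bigr do rewrite -e.
ring.
Qed.

(** Y reveals the component while (X, Z) is independent of it. Two of the four entropies contain
    [binary_entropy], with opposite signs, so the information is affine. *)
Lemma cmi_mixture (A B' C : finType) (X : T1 + T2 -> A) (Y : T1 + T2 -> B') (Z : T1 + T2 -> C) :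
  law P1 (joint X Z \o inl) =1 law P2 (joint X Z \o inr) ->
  (forall t t', Y (inl t) != Y (inr t')) ->
  cond_mutual_info mixture X Y Z = l * cond_mutual_info P1 (X \o inl) (Y \o inl) (Z \o inl)
   + (1 - l) * cond_mutual_info P2 (X \o inr) (Y \o inr) (Z \o inr).
Proof.
move=> e sep; rewrite !cond_mutual_infoE //; try exact: mixture_pmf.
have eZ : law P1 (Z \o inl) =1 law P2 (Z \o inr).
  move=> c; rewrite -(law_joint_suml _ (X \o inl)) -(law_joint_suml _ (X \o inr)).
  by apply: eq_bigr => a _; apply: e.
rewrite (entropy_mixture_same e) (entropy_mixture_same eZ).
rewrite entropy_mixture_sep; last by move=> t t'; rewrite xpair_eqE (negPf (sep _ _)).
rewrite entropy_mixture_sep; last by move=> t t'; rewrite !xpair_eqE (negPf (sep _ _)) andbF.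
rewrite /comp /=; ring.
Qed.

Lemma cmi_mixture_sep (A B' C : finType) (X : T1 + T2 -> A) (Y : T1 + T2 -> B') (Z : T1 + T2 -> C) :
  (forall t t', Z (inl t) != Z (inr t')) ->
  cond_mutual_info mixture X Y Z = l * cond_mutual_info P1 (X \o inl) (Y \o inl) (Z \o inl)
   + (1 - l) * cond_mutual_info P2 (X \o inr) (Y \o inr) (Z \o inr).
Proof.
move=> sep; rewrite !cond_mutual_infoE //; try exact: mixture_pmf.
rewrite !entropy_mixture_sep; try by move=> t t'; rewrite ?xpair_eqE (negPf (sep _ _)) ?andbF.
rewrite /comp /=; ring.
Qed.

End Mixture.

Lemma cmiC (T : finType) (P : T -> R) (A B' C : finType) (X : T -> A) (Y : T -> B') (Z : T -> C) :
  is_pmf P -> cond_mutual_info P X Y Z = cond_mutual_info P Y X Z.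
Proof.
move=> hP; rewrite !cond_mutual_infoE // [entropy P (joint X Z) + _]addrC.
by congr (_ - _ - _); apply: entropy_eq => // t t'; rewrite !joint_eq [(X t == _) && _]andbC.
Qed.

Lemma realizable_convex (l r1 r2 r12 d r1' r2' r12' d' : R) : 0 <= l <= 1 ->
  realizable r1 r2 r12 d -> realizable r1' r2' r12' d' ->
  realizable (l * r1 + (1 - l) * r1') (l * r2 + (1 - l) * r2')
    (l * r12 + (1 - l) * r12') (l * d + (1 - l) * d').
Proof.
move=> /andP[l0 l1] [U1 [U2 [q [/is_aux_extensionE [hq sq [m1 m2]] [-> -> -> ->]]]]].
move=> [U1' [U2' [q' [/is_aux_extensionE [hq' sq' [m1' m2']] [-> -> -> ->]]]]].
pose P := mixture q q' l.
have hP : is_pmf P by exact: mixture_pmf.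
pose S (t : _ + _) := match t with
  inl t => @aux_src (A1 * A2 * B) U1 U2 t | inr t => @aux_src (A1 * A2 * B) U1' U2' t end.
pose V1 (t : _ + _) : U1 + U1' := match t with
  inl t => inl (@aux_V1 (A1 * A2 * B) U1 U2 t) | inr t => inr (@aux_V1 (A1 * A2 * B) U1' U2' t) end.
pose V2 (t : _ + _) : U2 + U2' := match t with
  inl t => inl (@aux_V2 (A1 * A2 * B) U1 U2 t) | inr t => inr (@aux_V2 (A1 * A2 * B) U1' U2' t) end.
have eS (A : finType) (f : A1 * A2 * B -> A) :
    law q ((f \o S) \o inl) =1 law q' ((f \o S) \o inr).
  move=> a; transitivity (law p f a).
    by rewrite -[LHS](law_comp q (S \o inl)) /law; apply: eq_bigr => s _; rewrite -sq.
  by rewrite -[RHS](law_comp q' (S \o inr)) /law; apply: eq_bigr => s _; rewrite -sq'.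
have mixE (A D : finType) (f : A1 * A2 * B -> A) (g : A1 * A2 * B -> D) (C : finType)
   (W : _ -> C) : (forall t t', W (inl t) != W (inr t')) ->
   cond_mutual_info P (f \o S) W (g \o S) =
   l * cond_mutual_info q (f \o S \o inl) (W \o inl) (g \o S \o inl)
   + (1 - l) * cond_mutual_info q' (f \o S \o inr) (W \o inr) (g \o S \o inr).
  move=> sep; apply: cmi_mixture => //.
  exact: (eS _ (joint f g)).
apply: (@realizable_system _ _ _ P S V1 V2).
  split => //.
  - move=> s; rewrite law_mixture_same; first exact: sq.
    by move=> s'; rewrite sq sq'.
  - split.
    (* [cmi_mixture] wants the variable revealing the component in second place, hence the symmetry.
       The second chain conditions on V1, which reveals the component, so [cmi_mixture_sep] applies
       there. *)
    + rewrite cmiC // (@mixE _ _ (joint (@src_X2 A1 A2 B) (@src_Y A1 A2 B)) (@src_X1 A1 A2 B)) //.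
      rewrite !(cmiC (joint _ _ \o S \o _)) //.
      rewrite [X in l * X](_ : _ = 0); last by rewrite -m1; apply: cmi_ker.
      rewrite [X in _ + _ * X](_ : _ = 0) ?mulr0 ?addr0 //; last by rewrite -m1'; apply: cmi_ker.
    + rewrite cmi_mixture_sep //.
      rewrite [X in l * X](_ : _ = 0); last by rewrite -m2; apply: cmi_ker.
      rewrite [X in _ + _ * X](_ : _ = 0) ?mulr0 ?addr0 //; last by rewrite -m2'; apply: cmi_ker.
split; rewrite /rate1 /rate2 /rate12 /relevance ?mutual_info_cmi //.
- rewrite mixE //; congr (_ * _ + _ * _); exact: cmi_ker.
- rewrite (@mixE _ _ (@src_X2 A1 A2 B) (@src_Y A1 A2 B)) //.
  rewrite (@mixE _ _ (@src_Y A1 A2 B) (fun=> tt)) //.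
  rewrite !mulrBr opprD [RHS]addrACA; congr (_ * _ - _ * _ + (_ * _ - _ * _)); exact: cmi_ker.
- rewrite (@mixE _ _ (joint (@src_X1 A1 A2 B) (@src_X2 A1 A2 B)) (@src_Y A1 A2 B)) //.
  congr (_ * _ + _ * _); exact: cmi_ker.
- rewrite (@mixE _ _ (@src_Y A1 A2 B) (fun=> tt)) //.
  congr (_ * _ + _ * _); exact: cmi_ker.
Qed.

End Realizable.

(** * Single-letter identities and time-sharing *)

Section SingleLetter.
Variables (R : realType) (T : finType) (P : T -> R).
Hypothesis hP : is_pmf P.
Variables (A1 A2 B U1 U2 : finType).
Variables (X1 : T -> A1) (X2 : T -> A2) (Y : T -> B) (V1 : T -> U1) (V2 : T -> U2).
Hypothesis src : cond_mutual_info P X1 X2 Y = 0.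
Hypothesis aux : aux_markov P X1 X2 Y V1 V2.

Let nil (t : T) := tt.
(** The calculus is set up for eight variables; three constants pad the list. *)
Let xs := [:: fiber X1; fiber X2; fiber Y; fiber V1; fiber V2; fiber nil; fiber nil; fiber nil].
Let g := family_entropy P xs.
Let sh : forall a b c, 0 <= cmi_of g a b c.
Proof. exact: family_entropy_shannon. Qed.

Ltac solve_cmi := rewrite ?mutual_info_cmi // cond_mutual_infoE // /g /cmi_of /family_entropy;
  congr (_ + _ - _ - _); apply: entropy_eq => // t t';
  rewrite /= ?eqseq_cons ?fiber_eq ?joint_eq /nil ?eqxx; bool_cases.

Let m1 : cmi_of g [:: 3] [:: 1; 2] [:: 0] = 0.
Proof. case: aux => <- _; symmetry; solve_cmi. Qed.
Let m2 : cmi_of g [:: 4] [:: 0; 2] [:: 3; 1] = 0.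
Proof. case: aux => _ <-; symmetry; solve_cmi. Qed.
Let m0 : cmi_of g [:: 0] [:: 1] [:: 2] = 0.
Proof. rewrite -src; symmetry; solve_cmi. Qed.
Let m0' : g (bits [::]) = 0.
Proof. exact: entropy_const. Qed.

(** Here X1 - Y - X2 enters: together with V1 - X1 - (X2, Y) it yields V1 - Y - X2. *)
Let m13 : cmi_of g [:: 1] [:: 3] [:: 2] = 0.
Proof.
have h : cmi_of g [:: 1] [:: 3] [:: 0; 2] = 0 by rewrite cmi_ofC; apply: ci_sub m1 _.
have m0C : cmi_of g [:: 1] [:: 0] [:: 2] = 0 by rewrite cmi_ofC.
by apply: (ci_sub sh (ci_contract m0C h)).
Qed.

Let e1 : rate1 P X1 X2 V1 V2 = cmi_of g [:: 0] [:: 3; 4] [:: 1].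
Proof. rewrite /rate1; solve_cmi. Qed.
Let e2 : rate2 P X2 Y V1 V2 = cmi_of g [:: 1] [:: 3; 4] [:: 2] - cmi_of g [:: 2] [:: 3] [::].
Proof. rewrite /rate2; congr (_ - _); solve_cmi. Qed.
Let e3 : rate12 P X1 X2 Y V1 V2 = cmi_of g [:: 0; 1] [:: 3; 4] [:: 2].
Proof. rewrite /rate12; solve_cmi. Qed.
Let e4 : relevance P Y V1 V2 = cmi_of g [:: 2] [:: 3; 4] [::].
Proof. rewrite /relevance; solve_cmi. Qed.

(** By [m13] the left side is I(X2;V2|V1,Y) + I(Y;V2|V1) = I(X2,Y;V2|V1), and V2 - (V1, X2) - Y
    removes Y. *)
Lemma rate2_relevance : rate2 P X2 Y V1 V2 + relevance P Y V1 V2 = cond_mutual_info P X2 V2 V1.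
Proof.
have -> : cond_mutual_info P X2 V2 V1 = cmi_of g [:: 1] [:: 4] [:: 3] by solve_cmi.
have h : cmi_of g [:: 4] [:: 2] [:: 3; 1] = 0 by apply: ci_sub m2 _.
rewrite e2 e4; move: h m13; rewrite /cmi_of /bits /=; move: (g) => f; lra.
Qed.

Let hV1 : entropy P V1 = g (bits [:: 3]).
Proof. by apply: entropy_eq => // t t'; rewrite /= ?eqseq_cons ?fiber_eq; bool_cases. Qed.
Let hV2 : entropy P V2 = g (bits [:: 4]).
Proof. by apply: entropy_eq => // t t'; rewrite /= ?eqseq_cons ?fiber_eq; bool_cases. Qed.

(** In the converse V1 and V2 are the messages; this bound and the next two, with [entropy_le_log],
    link the rates to the numbers of messages. *)
Lemma rate1_le : rate1 P X1 X2 V1 V2 <= entropy P V1.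
Proof.
have h : cmi_of g [:: 0] [:: 4] [:: 3; 1] = 0 by rewrite cmi_ofC; apply: ci_sub m2 _.
have s1 := sh [:: 1] [:: 3] [::].
have s2 := sh [:: 3] [:: 3] [:: 0; 1].
rewrite e1 hV1; move: h s1 s2 m0'; rewrite /cmi_of /bits /=; move: (g) => f; lra.
Qed.

Lemma rate2_le : rate2 P X2 Y V1 V2 + relevance P Y V1 V2 <= entropy P V2.
Proof.
have h : cmi_of g [:: 4] [:: 2] [:: 3; 1] = 0 by apply: ci_sub m2 _.
have s1 := sh [:: 4] [:: 3] [::].
have s2 := sh [:: 4] [:: 4] [:: 1; 3].
rewrite e2 e4 hV2; move: h m13 s1 s2 m0'; rewrite /cmi_of /bits /=; move: (g) => f; lra.
Qed.

Lemma rate12_le : rate12 P X1 X2 Y V1 V2 + relevance P Y V1 V2 <= entropy P V1 + entropy P V2.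
Proof.
have k : cmi_of g [:: 4] [:: 2] [:: 3; 1; 0] = 0 by apply: ci_sub m2 _.
have k' : cmi_of g [:: 3] [:: 2] [:: 1; 0] = 0 by apply: ci_sub m1 _.
have s1 := sh [:: 4] [:: 3] [::].
have s2 := sh [:: 3; 4] [:: 3; 4] [:: 0; 1].
rewrite e3 e4 hV1 hV2; move: k k' s1 s2 m0'; rewrite /cmi_of /bits /=; move: (g) => f; lra.
Qed.

Lemma rate1_V1 : rate1 P X1 X2 V1 V2 = cond_mutual_info P X1 V1 X2.
Proof.
have -> : cond_mutual_info P X1 V1 X2 = cmi_of g [:: 0] [:: 3] [:: 1] by solve_cmi.
have h : cmi_of g [:: 0] [:: 4] [:: 3; 1] = 0 by rewrite cmi_ofC; apply: ci_sub m2 _.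
rewrite e1; move: h; rewrite /cmi_of /bits /=; move: (g) => f; lra.
Qed.

(** Needed when V2 is reduced: [rate12] is then preserved as soon as [rate2] and the joint law of
    the source and V1 are. *)
Lemma rate12_rate2 : rate12 P X1 X2 Y V1 V2 =
  rate2 P X2 Y V1 V2 + mutual_info P Y V1 + cond_mutual_info P X1 V1 (joint X2 Y).
Proof.
have -> : mutual_info P Y V1 = cmi_of g [:: 2] [:: 3] [::] by solve_cmi.
have -> : cond_mutual_info P X1 V1 (joint X2 Y) = cmi_of g [:: 0] [:: 3] [:: 1; 2] by solve_cmi.
have h : cmi_of g [:: 4] [:: 0] [:: 2; 3; 1] = 0 by apply: ci_sub m2 _.
rewrite e2 e3; move: h; rewrite /cmi_of /bits /=; move: (g) => f; lra.
Qed.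

(** H(V1|X2) - H(V1|X1), the form in which random binning meets the rate: the hash needed to decode
    V1 from X2, minus the part supplied as common randomness. [rate12_entropy] does the same for the
    sum rate. *)
Lemma rate1_entropy : rate1 P X1 X2 V1 V2 =
  (entropy P (joint V1 X2) - entropy P X2) - (entropy P (joint V1 X1) - entropy P X1).
Proof.
have -> : entropy P (joint V1 X2) = g (bits [:: 1; 3]) by solve_entropy.
have -> : entropy P X2 = g (bits [:: 1]) by solve_entropy.
have -> : entropy P (joint V1 X1) = g (bits [:: 0; 3]) by solve_entropy.
have -> : entropy P X1 = g (bits [:: 0]) by solve_entropy.
have h : cmi_of g [:: 0] [:: 4] [:: 3; 1] = 0 by rewrite cmi_ofC; apply: ci_sub m2 _.
have h' : cmi_of g [:: 3] [:: 1] [:: 0] = 0 by apply: ci_sub m1 _.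
rewrite e1; move: h h'; rewrite /cmi_of /bits /=; move: (g) => f; lra.
Qed.

Lemma rate12_entropy : rate12 P X1 X2 Y V1 V2 + relevance P Y V1 V2 =
  rate2 P X2 Y V1 V2 + relevance P Y V1 V2 +
  (entropy P V1 - (entropy P (joint V1 X1) - entropy P X1)).
Proof.
have -> : entropy P (joint V1 X1) = g (bits [:: 0; 3]) by solve_entropy.
have -> : entropy P X1 = g (bits [:: 0]) by solve_entropy.
rewrite e2 e3 e4 hV1.
have h1 : cmi_of g [:: 4] [:: 0] [:: 2; 3; 1] = 0 by apply: ci_sub m2 _.
have h2 : cmi_of g [:: 3] [:: 1; 2] [:: 0] = 0 := m1.
move: h1 h2 m13 m0'; rewrite /cmi_of /bits /=; move: (g) => f; lra.
Qed.

Lemma cmi_X2_V1_X1 : cond_mutual_info P X2 V1 X1 = 0.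
Proof.
have -> : cond_mutual_info P X2 V1 X1 = cmi_of g [:: 1] [:: 3] [:: 0] by solve_cmi.
by rewrite cmi_ofC; apply: ci_sub m1 _.
Qed.

Lemma rate12_relevance :
  rate12 P X1 X2 Y V1 V2 + relevance P Y V1 V2 = mutual_info P (joint X1 X2) (joint V1 V2).
Proof.
have -> : mutual_info P (joint X1 X2) (joint V1 V2) = cmi_of g [:: 0; 1] [:: 3; 4] [::] by solve_cmi.
have h : cmi_of g [:: 4] [:: 2] [:: 3; 1; 0] = 0 by apply: ci_sub m2 _.
have h' : cmi_of g [:: 3] [:: 2] [:: 1; 0] = 0 by apply: ci_sub m1 _.
rewrite e3 e4; move: h h'; rewrite /cmi_of /bits /=; move: (g) => f; lra.
Qed.

Lemma aux_markov_V1 : aux_markov P X1 X2 Y V1 nil.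
Proof.
split; first by case: aux.
have -> : cond_mutual_info P nil (joint X1 Y) (joint V1 X2) = cmi_of g [::] [:: 0; 2] [:: 3; 1] by solve_cmi.
by rewrite /cmi_of /bits /=; move: (g) => f; lra.
Qed.

Lemma aux_markov_nil : aux_markov P X1 X2 Y nil nil.
Proof.
split.
- have -> : cond_mutual_info P nil (joint X2 Y) X1 = cmi_of g [::] [:: 1; 2] [:: 0] by solve_cmi.
  by rewrite /cmi_of /bits /=; move: (g) => f; lra.
- have -> : cond_mutual_info P nil (joint X1 Y) (joint nil X2) = cmi_of g [::] [:: 0; 2] [:: 1] by solve_cmi.
  by rewrite /cmi_of /bits /=; move: (g) => f; lra.
Qed.

Lemma nil_rates : [/\ rate1 P X1 X2 nil nil = 0, rate2 P X2 Y nil nil = 0,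
  rate12 P X1 X2 Y nil nil = 0 & relevance P Y nil nil = 0].
Proof.
have -> : rate1 P X1 X2 nil nil = cmi_of g [:: 0] [::] [:: 1] by rewrite /rate1; solve_cmi.
have -> : rate2 P X2 Y nil nil = cmi_of g [:: 1] [::] [:: 2] - cmi_of g [:: 2] [::] [::].
  by rewrite /rate2; congr (_ - _); solve_cmi.
have -> : rate12 P X1 X2 Y nil nil = cmi_of g [:: 0; 1] [::] [:: 2] by rewrite /rate12; solve_cmi.
have -> : relevance P Y nil nil = cmi_of g [:: 2] [::] [::] by rewrite /relevance; solve_cmi.
split; rewrite /cmi_of /bits /=; move: (g) => f; lra.
Qed.

Section V1Rates.
Let a := rate1 P X1 X2 V1 V2.
Let b := rate2 P X2 Y V1 V2.
Let c := rate12 P X1 X2 Y V1 V2.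
Let d := relevance P Y V1 V2.
Let a1 := rate1 P X1 X2 V1 nil.
Let b1 := rate2 P X2 Y V1 nil.
Let c1 := rate12 P X1 X2 Y V1 nil.
Let d1 := relevance P Y V1 nil.

(** Compares (V1, V2) with V1 and a constant. By the chain rule [c + d] is I(X1;V1) + I(X2;V2|V1),
    and [d - d1 <= b + d] is the data processing inequality I(Y;V2|V1) <= I(X2;V2|V1). *)
Lemma V1_rates : [/\ a1 <= a, b1 + d1 = 0, c + d = (c1 + d1) + (b + d),
  0 <= d1 <= d & d - d1 <= b + d /\ 0 <= c1].
Proof.
have -> : a1 = cmi_of g [:: 0] [:: 3] [:: 1] by rewrite /a1 /rate1; solve_cmi.
have -> : b1 = cmi_of g [:: 1] [:: 3] [:: 2] - cmi_of g [:: 2] [:: 3] [::].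
  by rewrite /b1 /rate2; congr (_ - _); solve_cmi.
have -> : c1 = cmi_of g [:: 0; 1] [:: 3] [:: 2] by rewrite /c1 /rate12; solve_cmi.
have -> : d1 = cmi_of g [:: 2] [:: 3] [::] by rewrite /d1 /relevance; solve_cmi.
rewrite /a /b /c /d e1 e2 e3 e4.
have h1 : cmi_of g [:: 4] [:: 2] [:: 3; 1] = 0 by apply: ci_sub m2 _.
have h2 := m13.
have h3 : cmi_of g [:: 4] [:: 0] [:: 2; 3; 1] = 0 by apply: ci_sub m2 _.
have s1 := sh [:: 0] [:: 4] [:: 1; 3].
have s2 := sh [:: 2] [:: 3] [::].
have s3 := sh [:: 2] [:: 4] [:: 3].
have s4 := sh [:: 1] [:: 4] [:: 2; 3].
have s5 := sh [:: 0; 1] [:: 3] [:: 2].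
move: h1 h2 h3 s1 s2 s3 s4 s5; rewrite /cmi_of /bits /=; move: (g) => f *.
by split; [lra|lra|lra|apply/andP; split; lra|split; lra].
Qed.

End V1Rates.
End SingleLetter.

Section Source.
Variables (R : realType) (A1 A2 B : finType) (p : A1 * A2 * B -> R).
Hypothesis hp : is_pmf p.
Hypothesis hmarkov : markov_chain p (@src_X1 A1 A2 B) (@src_Y A1 A2 B) (@src_X2 A1 A2 B).

Local Notation rX1 := (@src_X1 A1 A2 B).
Local Notation rX2 := (@src_X2 A1 A2 B).
Local Notation rY := (@src_Y A1 A2 B).

Lemma cond_mutual_info_eq (T C1 C2 C3 : finType) (P Q : T -> R) (X : T -> C1) (Y : T -> C2)
    (Z : T -> C3) : P =1 Q -> cond_mutual_info P X Y Z = cond_mutual_info Q X Y Z.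
Proof.
move=> e; have el (A : finType) (W : T -> A) : law P W =1 law Q W by move=> a; apply: eq_bigr.
by apply: eq_bigr => a _; apply: eq_bigr => b _; apply: eq_bigr => c _; rewrite !el.
Qed.

Lemma source_cmi (T : finType) (P : T -> R) (S : T -> A1 * A2 * B) : law P S =1 p ->
  cond_mutual_info P (rX1 \o S) (rX2 \o S) (rY \o S) = 0.
Proof.
move=> e; rewrite -cond_mutual_info_law (cond_mutual_info_eq _ _ _ e).
exact/markov_chainE.
Qed.

Lemma realizable_V1 a b c d : realizable p a b c d ->
  exists a1 b1 c1 d1, [/\ realizable p a1 b1 c1 d1, a1 <= a, b1 + d1 = 0,
    c + d = (c1 + d1) + (b + d) & [/\ 0 <= d1 <= d, d - d1 <= b + d & 0 <= c1]].
Proof.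
move=> [U1 [U2 [q [/is_aux_extensionE [hq sq aux] [-> -> -> ->]]]]].
have src := source_cmi sq.
have [h1 h2 h3 h4 [h5 h6]] := V1_rates hq src aux.
do 4!eexists; split; [|exact: h1|exact: h2|exact: h3|by split].
apply: (@realizable_system _ _ _ _ _ _ _ _ _ (@aux_src _ U1 U2) (@aux_V1 _ U1 U2) (fun=> tt)).
  by split; [exact: hq|exact: sq|exact: (aux_markov_V1 hq aux)].
by split.
Qed.

Lemma realizable0 : realizable p 0 0 0 0.
Proof.
have sp : law p id =1 p by move=> s; rewrite /law big_pred1_eq.
apply: (@realizable_system _ _ _ _ _ _ _ _ p id (fun=> tt) (fun=> tt)).
  by split; [exact: hp|exact: sp|exact: (aux_markov_nil hp _ _ _ (fun=> tt) (fun=> tt))].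
by have [e1 e2 e3 e4] := nil_rates hp (rX1 \o id) (rX2 \o id) (rY \o id) (fun=> tt) (fun=> tt); split.
Qed.

(** I(X2;V1|X1) vanishes by the first chain; the other bounds are [rate2_relevance] and
    [rate12_relevance]. *)
Lemma inner_regionP (R1 R2 mu : R) : inner_region p (R1, R2, mu) <->
  [/\ 0 <= R1, 0 <= R2, 0 <= mu & exists a b c d, [/\ realizable p a b c d,
    a <= R1, b + d <= R2, c + d <= R1 + R2 & mu <= d]].
Proof.
split=> -[R10 R20 mu0 h]; split => //.
  case: h => U1 [U2 [q [hq /= [h1 h2 h3 h4]]]].
  have [qp sq aux] := (is_aux_extensionE p q).1 hq.
  do 4!eexists; split; first by exists U1, U2, q; split=> //; split.
  - exact: h1.
  - move: h2; rewrite (cmi_X2_V1_X1 qp aux) addr0; apply: le_trans.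
    by rewrite (rate2_relevance qp (source_cmi sq) aux).
  - by rewrite (rate12_relevance qp aux).
  - exact: h4.
case: h => a [b [c [d [[U1 [U2 [q [hq [-> -> -> ->]]]]] h1 h2 h3 h4]]]].
have [qp sq aux] := (is_aux_extensionE p q).1 hq.
exists U1, U2, q; split=> //=; split.
- exact: h1.
- by rewrite (cmi_X2_V1_X1 qp aux) addr0 -(rate2_relevance qp (source_cmi sq) aux).
- by move: h3; rewrite (rate12_relevance qp aux).
- exact: h4.
Qed.

(* A point with [mu < d] is reached by time-sharing between [(V1, V2)], [V1]
   alone and the trivial auxiliary variables. *)
Lemma outer_sub_inner (R1 R2 mu : R) : outer_region p (R1, R2, mu) -> inner_region p (R1, R2, mu).
Proof.
move=> [R10 R20 mu0 [U1 [U2 [q [_ _ hq [h1 h2 h3 h4]]]]]].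
apply/inner_regionP; split => //.
pose a := rate1 q (rX1 \o @aux_src _ U1 U2) (rX2 \o @aux_src _ U1 U2) (@aux_V1 _ U1 U2) (@aux_V2 _ U1 U2).
pose b := rate2 q (rX2 \o @aux_src _ U1 U2) (rY \o @aux_src _ U1 U2) (@aux_V1 _ U1 U2) (@aux_V2 _ U1 U2).
pose c := rate12 q (rX1 \o @aux_src _ U1 U2) (rX2 \o @aux_src _ U1 U2) (rY \o @aux_src _ U1 U2) (@aux_V1 _ U1 U2) (@aux_V2 _ U1 U2).
pose d := relevance q (rY \o @aux_src _ U1 U2) (@aux_V1 _ U1 U2) (@aux_V2 _ U1 U2).
have r : realizable p a b c d by exists U1, U2, q.
have {}h1 : a <= R1 by [].
have {}h2 : b + mu <= R2 by move: h2; rewrite ge_max => /andP[].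
have {}h3 : c + mu <= R1 + R2 by [].
have {}h4 : mu <= d by [].
move: a b c d r h1 h2 h3 h4 => {hq q U1 U2} a b c d r h1 h2 h3 h4.
have [a1 [b1 [c1 [y [r1 e1 e2 e3 [/andP[y0 yd] e4 c10]]]]]] := realizable_V1 r.
(* [y] is the relevance of V1 alone. Above it (V1, V2) is mixed with V1, below it V1 is mixed with
   constants; the weight [l] makes the relevance of the mixture exactly [mu]. *)
have [ymu|muy] := leP y mu.
  (* Here [y <= mu <= d <= y], so [mu = d] and the given quadruple already works. *)
  have [dy|yd'] := leP d y.
    by exists a, b, c, d; split=> //; lra.
  pose l := (mu - y) / (d - y).
  have dy0 : 0 < d - y by rewrite subr_gt0.
  have l0 : 0 <= l by rewrite divr_ge0 ?subr_ge0 // ltW.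
  have l1 : l <= 1 by rewrite ler_pdivrMr // mul1r lerB.
  have lE : l * (d - y) = mu - y by rewrite divfK ?gt_eqF.
  have l01 : 0 <= l <= 1 by rewrite l0.
  exists (l * a + (1 - l) * a1), (l * b + (1 - l) * b1), (l * c + (1 - l) * c1), (l * d + (1 - l) * y).
  (* Dropping V2 for a fraction [1 - l] of the time saves [(1 - l) * (b + d)], at least the
     relevance it loses, [(1 - l) * (d - y) = d - mu]. This saving turns [b + mu] into an admissible
     inner bound. *)
  have key : (1 - l) * (d - y) <= (1 - l) * (b + d) by rewrite ler_wpM2l // subr_ge0.
  have e2' : (1 - l) * (b1 + y) = 0 by rewrite e2 mulr0.
  have key3 : (1 - l) * a1 <= (1 - l) * a by rewrite ler_wpM2l // subr_ge0.
  have e3' : l * (c + d) = l * ((c1 + y) + (b + d)) by rewrite e3.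
  split; [exact: realizable_convex|lra|lra|lra|lra].
have y0' : 0 < y by lra.
pose l := mu / y.
have l0 : 0 <= l by rewrite divr_ge0.
have l1 : l <= 1 by rewrite ler_pdivrMr // mul1r ltW.
have lE : l * y = mu by rewrite divfK ?gt_eqF.
have l01 : 0 <= l <= 1 by rewrite l0.
have := realizable_convex l01 r1 realizable0.
rewrite !mulr0 !addr0 => rl; exists (l * a1), (l * b1), (l * c1), (l * y).
have e2' : l * (b1 + y) = 0 by rewrite e2 mulr0.
have k1 : 0 <= (1 - l) * c1 by rewrite mulr_ge0 // subr_ge0.
have k2 : l * a1 <= l * a by rewrite ler_wpM2l.
have k3 : l * a <= l * R1 by rewrite ler_wpM2l.
have k4 : l * R1 <= R1 by rewrite ler_piMl.
split=> //; lra.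
Qed.

End Source.

(** * Converse for n letters *)

Section ConsFfun.
Variables (S : Type) (n : nat).

Definition fcons (s : S) (w : {ffun 'I_n -> S}) : {ffun 'I_n.+1 -> S} :=
  [ffun i => if unlift ord0 i is Some j then w j else s].
Definition fbehead (w : {ffun 'I_n.+1 -> S}) : {ffun 'I_n -> S} :=
  [ffun i => w (lift ord0 i)].

Lemma fcons0 s w : fcons s w ord0 = s.
Proof. by rewrite ffunE unlift_none. Qed.
Lemma fconsS s w i : fcons s w (lift ord0 i) = w i.
Proof. by rewrite ffunE liftK. Qed.
Lemma fbeheadK s w : fbehead (fcons s w) = w.
Proof. by apply/ffunP => i; rewrite ffunE fconsS. Qed.
Lemma fconsK (w : {ffun 'I_n.+1 -> S}) : fcons (w ord0) (fbehead w) = w.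
Proof.
apply/ffunP => i; case: (unliftP ord0 i) => [j|] ->; first by rewrite fconsS ffunE.
by rewrite fcons0.
Qed.

End ConsFfun.

Section IIDCons.
Variables (R : realType) (W : finType) (q : W -> R).

Lemma sum_fcons n (f : {ffun 'I_n.+1 -> W} -> R) :
  \sum_w f w = \sum_s \sum_w f (fcons s w).
Proof.
rewrite pair_bigA /= (reindex (fun sw : W * {ffun 'I_n -> W} => fcons sw.1 sw.2)) //=.
exists (fun w : {ffun 'I_n.+1 -> W} => (w ord0, fbehead w)) => [[s w] _|w _] /=; last exact: fconsK.
by rewrite fcons0 fbeheadK.
Qed.

Lemma iid_fcons n s (w : {ffun 'I_n -> W}) : iid q (fcons s w) = q s * iid q w.
Proof.
by rewrite /iid big_ord_recl fcons0; congr (_ * _); apply: eq_bigr => i _; rewrite fconsS.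
Qed.

Lemma iid_is_pmf n : is_pmf q -> is_pmf (iid q (n := n)).
Proof.
case=> q0 q1; split; first by move=> w; exact: prodr_ge0.
by rewrite /iid -(bigA_distr_bigA (fun (_ : 'I_n) s => q s)) big1 // => i _.
Qed.

End IIDCons.

Section Nletter.
Variables (R : realType) (A1 A2 B : finType) (p : A1 * A2 * B -> R).
Hypothesis hp : is_pmf p.
Hypothesis hmarkov : markov_chain p (@src_X1 A1 A2 B) (@src_Y A1 A2 B) (@src_X2 A1 A2 B).

Local Notation S := (A1 * A2 * B)%type.
Local Notation rX1 := (@src_X1 A1 A2 B).
Local Notation rX2 := (@src_X2 A1 A2 B).
Local Notation rY := (@src_Y A1 A2 B).

Section Split.
Variables (T : finType) (P : T -> R) (n : nat) (W : T -> {ffun 'I_n.+1 -> S}).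
Hypothesis hP : is_pmf P.
Hypothesis hW : law P W =1 iid p (n := n.+1).

Let Sa t := W t ord0.
Let Wb t := fbehead (W t).

Let law_split s w : law P (joint Sa Wb) (s, w) = p s * iid p w.
Proof.
rewrite -iid_fcons -hW; apply: eq_bigl => t; rewrite xpair_eqE /Sa /Wb.
apply/andP/eqP => [[/eqP <- /eqP <-]|->]; first by rewrite fconsK.
by rewrite fcons0 fbeheadK.
Qed.

Lemma law_first : law P Sa =1 p.
Proof.
move=> s; rewrite -(law_joint_sumr _ _ Wb); under eq_bigr do rewrite law_split.
by rewrite -mulr_sumr; have [_ ->] := iid_is_pmf n hp; rewrite mulr1.
Qed.

Lemma law_rest : law P Wb =1 iid p (n := n).
Proof.
move=> w; rewrite -(law_joint_suml _ Sa); under eq_bigr do rewrite law_split.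
by rewrite -mulr_suml; case: hp => _ ->; rewrite mul1r.
Qed.

Lemma first_rest_indep : mutual_info P Sa Wb = 0.
Proof.
rewrite /mutual_info big1 // => s _; rewrite big1 // => w _.
rewrite law_split law_first law_rest.
have [->|n0] := eqVneq (p s * iid p w) 0; first by rewrite mul0r.
by rewrite divff // log2_1 mulr0.
Qed.

Lemma letterwise_eq (A : finType) (X : S -> A) t t' :
  (letterwise X (W t) == letterwise X (W t')) =
  ((X \o Sa) t == (X \o Sa) t') && ((letterwise X \o Wb) t == (letterwise X \o Wb) t').
Proof.
apply/eqP/andP => [/ffunP e|[/eqP e0 /eqP /ffunP e]].
  split; first by have := e ord0; rewrite !ffunE => /eqP.
  by apply/eqP/ffunP => i; have := e (lift ord0 i); rewrite !ffunE.
apply/ffunP => i; case: (unliftP ord0 i) => [j|] ->; rewrite !ffunE //.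
by have := e j; rewrite !ffunE.
Qed.

End Split.

Lemma letterwise_source_eq n (w w' : {ffun 'I_n -> S}) :
  [&& letterwise rX1 w == letterwise rX1 w', letterwise rX2 w == letterwise rX2 w' &
      letterwise rY w == letterwise rY w'] = (w == w').
Proof.
apply/idP/eqP => [/and3P[/eqP/ffunP e1 /eqP/ffunP e2 /eqP/ffunP e3]|->]; last by rewrite !eqxx.
apply/ffunP => i; move: (e1 i) (e2 i) (e3 i); rewrite !ffunE /src_X1 /src_X2 /src_Y.
by case: (w i) => [[? ?] ?]; case: (w' i) => [[? ?] ?] /= -> -> ->.
Qed.

Lemma first_rest_indep' (T : finType) (P : T -> R) n (W : T -> {ffun 'I_n.+1 -> S}) :
  is_pmf P -> law P W =1 iid p (n := n.+1) ->
  let Sa t := W t ord0 in let Wb t := fbehead (W t) in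
  mutual_info P (joint (joint (rX1 \o Sa) (rX2 \o Sa)) (rY \o Sa))
    (joint (joint (letterwise rX1 \o Wb) (letterwise rX2 \o Wb)) (letterwise rY \o Wb)) = 0.
Proof.
move=> hP hW Sa Wb; rewrite -(first_rest_indep hW) !mutual_info_cmi //.
apply: cmi_ker => // t t' _ _.
by rewrite !joint_eq -andbA letterwise_source_eq.
Qed.

Lemma cmi_constl (T : finType) (P : T -> R) (C1 C2 C3 : finType) (X : T -> C1) (Y : T -> C2)
    (Z : T -> C3) : is_pmf P -> (forall t t', X t = X t') -> cond_mutual_info P X Y Z = 0.
Proof.
move=> hP hX; rewrite cond_mutual_infoE //.
rewrite (@entropy_eq _ _ _ _ _ (joint X Z) Z) //; last first.
  by move=> t t'; rewrite joint_eq (hX t t') eqxx.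
rewrite (@entropy_eq _ _ _ _ _ (joint (joint X Y) Z) (joint Y Z)) //; last first.
  by move=> t t'; rewrite !joint_eq (hX t t') eqxx.
ring.
Qed.

Lemma letterwise_source_cmi n (T : finType) (P : T -> R) (W : T -> {ffun 'I_n -> S}) :
  is_pmf P -> law P W =1 iid p (n := n) ->
  cond_mutual_info P (letterwise rX1 \o W) (letterwise rX2 \o W) (letterwise rY \o W) = 0.
Proof.
move=> hP; elim: n W => [|n IH] W hW.
  by apply: cmi_constl => // t t'; apply/ffunP => -[].
pose Sa t := W t ord0; pose Wb t := fbehead (W t).
apply: (@two_blocks_src _ _ _ hP _ _ _ _ _ _ _ _ _ _ _
  (rX1 \o Sa) (rX2 \o Sa) (rY \o Sa)
  (letterwise rX1 \o Wb) (letterwise rX2 \o Wb) (letterwise rY \o Wb) _ _ _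
  (fun=> tt) (fun=> tt)).
- by move=> t t'; exact: letterwise_eq.
- by move=> t t'; exact: letterwise_eq.
- by move=> t t'; exact: letterwise_eq.
- exact: first_rest_indep'.
- exact/(source_cmi hp hmarkov)/law_first.
- exact/IH/law_rest.
Qed.

(** Convexity merges the letters into a single quadruple. The auxiliaries and their types are
    generalised in the induction because the remaining letters inherit V1 enlarged by X1 and Y of
    the first letter. *)
Lemma nletter_converse n (T U1 U2 : finType) (P : T -> R) (W : T -> {ffun 'I_n -> S})
    (V1 : T -> U1) (V2 : T -> U2) :
  is_pmf P -> law P W =1 iid p (n := n) ->
  aux_markov P (letterwise rX1 \o W) (letterwise rX2 \o W) (letterwise rY \o W) V1 V2 ->
  exists a b c d, [/\ realizable p a b c d,
    n%:R * a <= rate1 P (letterwise rX1 \o W) (letterwise rX2 \o W) V1 V2,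
    n%:R * b <= rate2 P (letterwise rX2 \o W) (letterwise rY \o W) V1 V2,
    n%:R * c <= rate12 P (letterwise rX1 \o W) (letterwise rX2 \o W) (letterwise rY \o W) V1 V2 &
    relevance P (letterwise rY \o W) V1 V2 <= n%:R * d].
Proof.
move=> hP; elim: n U1 U2 W V1 V2 => [|n IH] U1 U2 W V1 V2 hW aux.
  exists 0, 0, 0, 0; rewrite !mulr0; split; first exact: realizable0.
  - exact: cmi_ge0.
  - rewrite /rate2 (mutual_info_cmi _ V1) // [X in _ - X]cmi_constl ?subr0 ?cmi_ge0 //.
    by move=> t t'; apply/ffunP => -[].
  - exact: cmi_ge0.
  - rewrite /relevance mutual_info_cmi // cmi_constl //.
    by move=> t t'; apply/ffunP => -[].
pose Sa t := W t ord0; pose Wb t := fbehead (W t).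
have ind := first_rest_indep' hP hW.
have srca := source_cmi hp hmarkov (law_first hW).
have srcb := letterwise_source_cmi hP (law_rest hW).
have eX1 := @letterwise_eq _ _ W _ rX1.
have eX2 := @letterwise_eq _ _ W _ rX2.
have eY := @letterwise_eq _ _ W _ rY.
have auxa := two_blocks_aux1 hP eX1 eX2 eY ind aux.
have auxb := two_blocks_aux2 hP eX1 eX2 eY ind aux.
have [a [b [c [d [r h1 h2 h3 h4]]]]] := IH _ _ _ _ _ (law_rest hW) auxb.
have k1 := two_blocks_rate1 hP eX1 eX2 eY ind aux.
have k2 := two_blocks_rate2 hP eX1 eX2 eY ind srca srcb aux.
have k3 := two_blocks_rate12 hP eX1 eX2 eY ind srca srcb aux.
have k4 := two_blocks_relevance hP (rX1 \o Sa) (rX2 \o Sa) (letterwise rX1 \o Wb) (letterwise rX2 \o Wb) V1 V2 eY.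
set V1a := joint V1 _ in k1 k2 k3 k4 auxa.
pose a1 := rate1 P (rX1 \o Sa) (rX2 \o Sa) V1a V2.
pose b1 := rate2 P (rX2 \o Sa) (rY \o Sa) V1a V2.
pose c1 := rate12 P (rX1 \o Sa) (rX2 \o Sa) (rY \o Sa) V1a V2.
pose d1 := relevance P (rY \o Sa) V1a V2.
have r1 : realizable p a1 b1 c1 d1.
  apply: (@realizable_system _ _ _ _ _ _ _ _ P Sa V1a V2); last by split.
  by split; [exact: hP|exact: law_first hW|exact: auxa].
(* Weight 1/(n+1) for the first letter, n/(n+1) for the average over the others. *)
pose l : R := n.+1%:R^-1.
have n0 : 0 < n.+1%:R :> R by rewrite ltr0n.
have l01 : 0 <= l <= 1.
  by rewrite invr_ge0 ler0n invf_le1 // ler1n.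
have r' := realizable_convex l01 r1 r.
have nl : n.+1%:R * l = 1 by rewrite mulfV ?gt_eqF.
have nl' : n.+1%:R * (1 - l) = n%:R by rewrite mulrBr nl mulr1 -natr1 addrK.
have mixE x y : n.+1%:R * (l * x + (1 - l) * y) = x + n%:R * y.
  by rewrite mulrDr !mulrA nl nl' mul1r.
do 4!eexists; split; first exact: r'.
- by rewrite mixE; apply: le_trans k1; rewrite lerD2l.
- by rewrite mixE; apply: le_trans k2; rewrite lerD2l.
- by rewrite mixE; apply: le_trans k3; rewrite lerD2l.
- by rewrite mixE; apply: le_trans k4 _; rewrite lerD2l.
Qed.

End Nletter.

Lemma cmi_func (R : realType) (T : finType) (P : T -> R) (A B C : finType)
    (X : T -> A) (Y : T -> B) (Z : T -> C) : is_pmf P ->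
  (forall t t', Z t = Z t' -> X t = X t') -> cond_mutual_info P X Y Z = 0.
Proof.
move=> hP h; rewrite cond_mutual_infoE //.
rewrite (@entropy_eq _ _ _ _ _ (joint X Z) Z) //; last first.
  by move=> t t'; rewrite joint_eq andbC; case: eqP => // /h ->; rewrite eqxx.
rewrite (@entropy_eq _ _ _ _ _ (joint (joint X Y) Z) (joint Y Z)) //; last first.
  by move=> t t'; rewrite !joint_eq; case: (Z t =P Z t') => [/h ->|]; rewrite ?eqxx ?andbF.
ring.
Qed.

Section Converse.
Variables (R : realType) (A1 A2 B : finType) (p : A1 * A2 * B -> R).
Hypothesis hp : is_pmf p.
Hypothesis hmarkov : markov_chain p (@src_X1 A1 A2 B) (@src_Y A1 A2 B) (@src_X2 A1 A2 B).

(** A single block length suffices. The Markov chains hold because each message is a function of the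
    variables its chain conditions on. Of the [2 * eps] and [3 * eps], one [eps] per rate comes from
    the code and one from its relevance being only [mu - eps]. *)
Lemma achievable_realizable (R1 R2 mu eps : R) : achievable_region p (R1, R2, mu) -> 0 < eps ->
  exists a b c d, [/\ realizable p a b c d, a <= R1 + eps, b + mu <= R2 + 2 * eps,
    c + mu <= R1 + R2 + 3 * eps & mu - eps <= d].
Proof.
move=> [_ _ _ h] e0; have [n0 {}h] := h eps e0.
have [M1 [M2 [f1 [g1 [h1 h2 h3]]]]] := h n0.+1 (ltnSn _).
set n := n0.+1 in h h1 h2 h3.
pose P := iid p (n := n).
have hP : is_pmf P by exact: iid_is_pmf.
have sP : law P id =1 iid p (n := n) by move=> s; rewrite /law big_pred1_eq.
pose X1 := letterwise (n := n) (@src_X1 A1 A2 B) \o id.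
pose X2 := letterwise (n := n) (@src_X2 A1 A2 B) \o id.
pose Y := letterwise (n := n) (@src_Y A1 A2 B) \o id.
pose I1 w := f1 (X1 w).
pose J1 w := g1 (X2 w, I1 w).
have aux : aux_markov P X1 X2 Y I1 J1.
  split; apply: cmi_func => // t t'; first by rewrite /I1 => ->.
  by rewrite /J1 => -[-> ->].
have src := letterwise_source_cmi hp hmarkov hP sP.
have [a [b [c [d [r k1 k2 k3 k4]]]]] := nletter_converse hp hmarkov hP sP aux.
have l1 : rate1 P X1 X2 I1 J1 <= log2 #|M1|%:R.
  exact: le_trans (rate1_le hP aux) (entropy_le_log hP _).
have l2 := le_trans (rate2_le hP src aux) (entropy_le_log hP _).
have l3 := le_trans (rate12_le hP aux) (lerD (entropy_le_log hP _) (entropy_le_log hP _)).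
have n0' : 0 < n%:R :> R by rewrite ltr0n.
exists a, b, c, d.
have {}h3 : n%:R * (mu - eps) <= relevance P Y I1 J1 by rewrite -ler_pdivlMl.
have {}h1 : log2 #|M1|%:R <= n%:R * (R1 + eps) by rewrite -ler_pdivrMl.
have {}h2 : log2 #|M2|%:R <= n%:R * (R2 + eps) by rewrite -ler_pdivrMl.
have {}k2 : n%:R * b <= rate2 P X2 Y I1 J1 by [].
have {}k3 : n%:R * c <= rate12 P X1 X2 Y I1 J1 by [].
have {}k4 : relevance P Y I1 J1 <= n%:R * d by [].
have {}l2 : rate2 P X2 Y I1 J1 + relevance P Y I1 J1 <= log2 #|M2|%:R by [].
split=> //; rewrite -(ler_pM2l n0').
- by apply: le_trans k1 _; apply: le_trans l1 _.
- move: (rate2 _ _ _ _ _) (relevance _ _ _ _) (log2 _) l2 h2 h3 k2 => *; lra.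
- move: (rate12 _ _ _ _ _ _) (relevance _ _ _ _) (log2 #|M1|%:R) (log2 #|M2|%:R) l3 h1 h2 h3 k3 => *; lra.
- exact: le_trans k4.
Qed.

End Converse.

(** * Cardinality bounds *)

Section SupportReduction.
Variables (R : realType) (U J : finType) (L : J -> U -> R) (G : U -> R) (c : J -> R).

Local Notation supp r := [set u | r u != 0].

(** More unknowns than equations: the matrix of the constraints restricted to [D] has a nonzero left
    kernel, extended by 0 outside [D]. *)
Lemma kernel_vector (D : {set U}) : (#|J| < #|D|)%N -> exists v : U -> R,
  [/\ exists u, v u != 0, forall u, v u != 0 -> u \in D & forall j, \sum_u v u * L j u = 0].
Proof.
move=> JD; pose M := \matrix_(i < #|D|, j < #|J|) L (enum_val j) (enum_val i).
have : kermx M != 0.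
  by rewrite -mxrank_eq0 mxrank_ker subn_eq0 -ltnNge (leq_ltn_trans (rank_leq_col M)).
case/rowV0Pn => w /sub_kermxP wM w0.
have [i wi] : exists i, w 0 i != 0.
  by case/rV0Pn: w0 => i; exists i.
pose v (u : U) : R := if @idP (u \in D) is ReflectT uD then w 0 (enum_rank_in uD u) else 0.
have vE (k : 'I_#|D|) : v (enum_val k) = w 0 k.
  by rewrite /v; case: {-}_ / idP => [uD|[]]; [rewrite enum_valK_in | exact: enum_valP].
have vD u : v u != 0 -> u \in D by rewrite /v; case: {-}_ / idP => //; rewrite eqxx.
exists v; split=> [||j]; [|exact: vD|].
  by exists (enum_val i); rewrite vE.
transitivity ((w *m M) 0 (enum_rank j)); last by rewrite wM mxE.
rewrite mxE (bigID (mem D)) /= [X in _ + X]big1 ?addr0; last first.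
  by move=> u uD; rewrite (_ : v u = 0) ?mul0r //; apply/eqP; apply: contraNT uD; exact: vD.
rewrite big_enum_val /=; apply: eq_bigr => k _.
by rewrite vE mxE enum_rankK.
Qed.

(* Caratheodory's argument; since [G] only has to be nondecreasing under the
   moves, it does not count as a constraint. *)
Lemma support_reduction (r0 : U -> R) : (forall u, 0 <= r0 u) ->
  (forall u, r0 u != 0 -> 0 < \sum_j c j * L j u) ->
  exists r : U -> R, [/\ forall u, 0 <= r u, (#|supp r| <= #|J|)%N,
    forall j, \sum_u r u * L j u = \sum_u r0 u * L j u,
    \sum_u r0 u * G u <= \sum_u r u * G u & forall u, r u != 0 -> r0 u != 0].
Proof.
move: {-1}(#|supp r0|) (leqnn #|supp r0|) => n.
elim: n r0 => [|n IH] r0 hn r00 pos.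
  by exists r0; split => //; apply: leq_trans hn _.
have [le|lt] := leqP #|supp r0| #|J|; first by exists r0.
have [v [[u1 vu1] vD vL]] := kernel_vector lt.
(* [v] may be replaced by [- v], so that moving along it does not decrease the value of [G]. *)
wlog vG : v vu1 vD vL / 0 <= \sum_u v u * G u.
  move=> H; have [/H|/ltW neg] := leP 0 (\sum_u v u * G u); first exact.
  apply: (H (fun u => - v u)) => [|u|j|]; rewrite ?oppr_eq0 //; first exact: vD.
  - by under eq_bigr do rewrite mulNr; rewrite sumrN vL oppr0.
  - by under eq_bigr do rewrite mulNr; rewrite sumrN oppr_ge0.
(* The combination of the constraints with coefficients [c] is positive on the support but pairs to
   0 with [v], so [v] cannot be nonnegative. *)
have [u0 vu0] : exists u, v u < 0.
  apply/existsP; apply: contraT; rewrite negb_exists => /forallP nneg.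
  have v0 u : 0 <= v u by rewrite leNgt.
  have : 0 < \sum_u v u * \sum_j c j * L j u.
    rewrite (bigD1 u1) //= ltr_wpDr //.
      apply: sumr_ge0 => u _; have [->|vu] := eqVneq (v u) 0; first by rewrite mul0r.
      by apply: mulr_ge0 => //; apply/ltW/pos; have := vD _ vu; rewrite inE.
    apply: mulr_gt0; first by rewrite lt0r vu1 v0.
    by apply: pos; have := vD _ vu1; rewrite inE.
  rewrite (_ : \sum_u _ = 0) ?ltxx //.
  transitivity (\sum_j c j * \sum_u v u * L j u); last first.
    by rewrite big1 // => j _; rewrite vL mulr0.
  under eq_bigr do rewrite mulr_sumr.
  rewrite exchange_big; apply: eq_bigr => j _ /=; rewrite mulr_sumr.
  by apply: eq_bigr => u _; rewrite mulrCA.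
(* The longest step along [v] that keeps all weights nonnegative; it sends the weight of the
   minimiser [um] to 0. *)
have [um vum hmin] := @arg_minP _ _ _ u0 (fun u => v u < 0) (fun u => r0 u / - v u) vu0.
pose t := r0 um / - v um.
have t0 : 0 <= t by rewrite divr_ge0 // oppr_ge0 ltW.
pose r u := r0 u + t * v u.
have r_ge0 u : 0 <= r u.
  have [vu|vu] := ltP (v u) 0; last by rewrite addr_ge0 // mulr_ge0.
  have := hmin u vu; rewrite -/t ler_pdivlMr ?oppr_gt0 // mulrN.
  by rewrite /r -subr_ge0 opprK.
have rsub u : r u != 0 -> r0 u != 0.
  apply: contra => /eqP r0u; rewrite /r r0u add0r.
  have [->|vu] := eqVneq (v u) 0; first by rewrite mulr0.
  by have := vD _ vu; rewrite inE r0u eqxx.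
have rum : r um = 0.
  by rewrite /r /t -{2}[v um]opprK mulrN divfK ?subrr // oppr_eq0 lt_eqF.
have : (#|supp r| <= n)%N.
  rewrite -ltnS; apply: leq_trans hn; apply: proper_card; apply/properP; split.
    by apply/fintype.subsetP => u; rewrite !inE => /rsub.
  exists um; rewrite inE; last by rewrite rum eqxx.
  by have := vD um; rewrite inE lt_eqF //; apply.
move=> /IH /(_ r_ge0) [|r' [h1 h2 h3 h4 h5]].
  by move=> u /rsub; exact: pos.
have rE F : \sum_u r u * F u = \sum_u r0 u * F u + t * \sum_u v u * F u.
  by rewrite mulr_sumr -big_split; apply: eq_bigr => u _; rewrite /r mulrDl mulrA.
exists r'; split => //.
- by move=> j; rewrite h3 rE vL mulr0 addr0.
- by apply: le_trans h4; rewrite rE lerDl mulr_ge0.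
- by move=> u /h5 /rsub.
Qed.

End SupportReduction.

(** * Reweighting one variable while keeping the conditional laws given it *)

Section Reweight.
Variables (R : realType) (T U : finType) (P : T -> R) (V : T -> U) (r : U -> R).

(** [r] is a density relative to [P], not the new law of V: the indicator of the support of V gives
    back [P]. *)
Definition reweight t := r (V t) * P t.

(* P(V = u) H(X | V = u). *)
Definition cond_entropy_at (A : eqType) (X : T -> A) (u : U) : R :=
  - \sum_(t | V t == u) P t *
      log2 ((\sum_(t' | (X t' == X t) && (V t' == V t)) P t') / \sum_(t' | V t' == V t) P t').

Lemma law_reweight (A : finType) (X : T -> A) a u : (forall t, X t = a -> V t = u) ->
  law reweight X a = r u * law P X a.
Proof.
by move=> h; rewrite /law mulr_sumr; apply: eq_bigr => t /eqP /h e; rewrite /reweight e.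
Qed.

Lemma law_reweight_sum (A : finType) (X : T -> A) a :
  law reweight X a = \sum_u r u * law P (joint X V) (a, u).
Proof.
rewrite /law (partition_big V predT) //=; apply: eq_bigr => u _; rewrite mulr_sumr.
by apply: eq_big => [t|t /andP[_ /eqP e]]; rewrite ?xpair_eqE // /reweight e.
Qed.

Hypotheses (P0 : forall t, 0 <= P t) (r0 : forall u, 0 <= r u).

(** The law given [V = u] does not depend on [r], so H(X|V) is linear in [r]. The nonlinear term
    H(V) cancels in each rate. *)
Lemma entropy_reweight (A : eqType) (X : T -> A) :
  entropy reweight (joint X V) = entropy reweight V + \sum_u r u * cond_entropy_at X u.
Proof.
rewrite addrC -[LHS](subrK (entropy reweight V)); congr (_ + _).
rewrite /entropy opprK addrC -sumrB (partition_big V predT) //=; apply: eq_bigr => u _.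
rewrite /cond_entropy_at mulrN mulr_sumr -sumrN; apply: eq_bigr => t /eqP <-.
have [e0|n0] := eqVneq (P t) 0; first by rewrite /reweight e0; ring.
have [e0|nr] := eqVneq (r (V t)) 0; first by rewrite /reweight e0; ring.
have Pt : 0 < P t by rewrite lt0r n0 P0.
have rt : 0 < r (V t) by rewrite lt0r nr r0.
have -> : \sum_(t' | joint X V t' == joint X V t) reweight t' =
    r (V t) * \sum_(t' | (X t' == X t) && (V t' == V t)) P t'.
  rewrite mulr_sumr; apply: eq_big => [t'|t']; rewrite joint_eq // => /andP[_ /eqP e].
  by rewrite /reweight e.
have -> : \sum_(t' | V t' == V t) reweight t' = r (V t) * \sum_(t' | V t' == V t) P t'.
  by rewrite mulr_sumr; apply: eq_bigr => t' /eqP e; rewrite /reweight e.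
have pos (Q : pred T) : Q t -> 0 < \sum_(t' | Q t') P t'.
  by move=> Qt; rewrite (bigD1 t) //= ltr_wpDr // sumr_ge0.
have p1 := pos (fun t' => (X t' == X t) && (V t' == V t)).
have p2 := pos (fun t' => V t' == V t).
rewrite /= !eqxx in p1 p2.
rewrite log2_div ?p1 ?p2 // !log2M ?p1 ?p2 // /reweight; ring.
Qed.

End Reweight.

Lemma entropy_eq_pmf (R : realType) (T : finType) (P Q : T -> R) (A : eqType) (X : T -> A) :
  P =1 Q -> entropy P X = entropy Q X.
Proof.
move=> e; congr (- _); apply: eq_bigr => t _; rewrite e; congr (_ * log2 _).
by apply: eq_bigr.
Qed.

Lemma entropy_law (R : realType) (T T' W A : finType) (P : T -> R) (P' : T' -> R)
    (Z : T -> W) (Z' : T' -> W) (f : W -> A) :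
  law P Z =1 law P' Z' -> entropy P (f \o Z) = entropy P' (f \o Z').
Proof.
move=> e; rewrite !entropyE; congr (- _); apply: eq_bigr => a _.
suff -> : law P (f \o Z) a = law P' (f \o Z') a by [].
rewrite -(law_comp P Z) -(law_comp P' Z').
by apply: eq_bigr => w _; exact: e.
Qed.

Lemma injection_on_support (U : finType) (D : {set U}) k : (0 < k)%N -> (#|D| <= k)%N ->
  exists f : U -> 'I_k, {in D &, injective f}.
Proof.
case: k => // k _ Dk; exists (fun u => inord (index u (enum D))).
have lt u : u \in D -> (index u (enum D) < k.+1)%N.
  by move=> uD; apply: leq_trans Dk; rewrite cardE index_mem mem_enum.
move=> u v uD vD /(congr1 val) /=; rewrite !inordK ?lt // => e.
by rewrite -(nth_index u (_ : u \in enum D)) ?mem_enum // e nth_index ?mem_enum.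
Qed.

Lemma reweight_support (R : realType) (T U : finType) (P : T -> R) (V : T -> U) : is_pmf P ->
  reweight P V (fun u => (law P V u != 0)%:R) =1 P.
Proof.
move=> hP t; rewrite /reweight; case: eqVneq => [e|_]; last by rewrite mul1r.
by rewrite mul0r; apply/esym/(law_eq0 hP e).
Qed.

Lemma reweight_gt0 (R : realType) (T U : finType) (P : T -> R) (V : T -> U) (r : U -> R) t :
  0 < reweight P V r t -> V t \in [set u | r u != 0].
Proof. by rewrite inE /reweight; case: eqVneq => [->|//]; rewrite mul0r ltxx. Qed.

Section ReduceAux.
Variables (R : realType) (A1 A2 B : finType) (p : A1 * A2 * B -> R).
Hypothesis hp : is_pmf p.
Variables (T U1 U2 : finType) (P : T -> R) (S : T -> A1 * A2 * B).
Variables (V1 : T -> U1) (V2 : T -> U2).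
Hypothesis hsys : aux_system p P S V1 V2.

Let hP : is_pmf P. Proof. by case: hsys. Qed.
Let P0 t : 0 <= P t. Proof. by case: hP. Qed.
Let hS : law P S =1 p. Proof. by case: hsys. Qed.
Let X1 := @src_X1 A1 A2 B \o S.
Let X2 := @src_X2 A1 A2 B \o S.
Let Y := @src_Y A1 A2 B \o S.
Let hm1 : cond_mutual_info P V1 (joint X2 Y) X1 = 0. Proof. by case: hsys => _ _ []. Qed.
Let hm2 : cond_mutual_info P V2 (joint X1 Y) (joint V1 X2) = 0. Proof. by case: hsys => _ _ []. Qed.

Section ReduceV1.
Let cH (A : eqType) (X : T -> A) := cond_entropy_at P V1 X.

(** Coefficients of [r] in the four rates; what remains besides are entropies of source variables
    alone ([rates_decomp]). *)
Definition V1_rates_at (i : 'I_4) (u : U1) : R := nth 0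
  [:: cH (joint V2 X2) u - cH (joint (joint X1 V2) X2) u;
      cH (joint V2 Y) u - cH (joint (joint X2 V2) Y) u + cH Y u;
      cH (joint V2 Y) u - cH (joint (joint (joint X1 X2) V2) Y) u;
      cH V2 u - cH (joint Y V2) u] i.

(** The law of X1 and the four rates: the origin of [#|A1| + 4]. The law of X1 takes care of the
    total mass and, by the first chain, of the whole source law. *)
Definition V1_constraints (j : A1 + 'I_4) (u : U1) : R :=
  match j with inl x => law P (joint X1 V1) (x, u) | inr i => V1_rates_at i u end.

(** Values of mass 0 get weight 0; [support_reduction] needs positive mass wherever the initial
    weight is nonzero. *)
Let r0 u : R := (law P V1 u != 0)%:R.

Let reweight_r0 : reweight P V1 r0 =1 P := reweight_support V1 hP.

Lemma V1_reweight : exists r : U1 -> R, [/\ forall u, 0 <= r u,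
  (#|[set u | r u != 0%R]| <= #|A1| + 4)%N,
  forall x, \sum_u r u * law P (joint X1 V1) (x, u) = law P X1 x &
  forall i, \sum_u r u * V1_rates_at i u = \sum_u r0 u * V1_rates_at i u].
Proof.
pose c (j : A1 + 'I_4) : R := if j is inl _ then 1 else 0.
have [||r [h1 h2 h3 _ _]] := @support_reduction R U1 (A1 + 'I_4)%type V1_constraints (fun=> 0) c r0.
- by move=> u; rewrite /r0 ler0n.
- move=> u; rewrite /r0 pnatr_eq0 eqb0 negbK => n0; rewrite big_sumType /=.
  rewrite [X in _ + X]big1 ?addr0; last by move=> i _; rewrite mul0r.
  under eq_bigr do rewrite mul1r.
  by rewrite law_joint_suml lt0r n0 law_ge0.
exists r; split=> //; first by rewrite card_sum card_ord in h2.
- move=> x; rewrite (h3 (inl x)) /= -law_reweight_sum.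
  by rewrite /law; apply: eq_bigr => t _; exact: reweight_r0.
- by move=> i; rewrite (h3 (inr i)).
Qed.

(** The chain V1 - X1 - (X2, Y) without division; it shows that reweighting V1 leaves the source law
    unchanged once the law of X1 is. *)
Lemma law_S_V1 x1 x2 y u :
  law P (joint S V1) ((x1, x2, y), u) * law P X1 x1 =
  law P (joint X1 V1) (x1, u) * p (x1, x2, y).
Proof.
have /cmi_eq0 -/(_ hP) := hm1; move=> /(_ u (x2, y) x1) e.
rewrite -hS; transitivity (law P (joint (joint V1 (joint X2 Y)) X1) (u, (x2, y), x1) * law P X1 x1).
  congr (_ * _); apply: eq_bigl => t; rewrite !xpair_eqE /X1 /X2 /Y /src_X1 /src_X2 /src_Y /=.
  by case: (S t) => [[s1 s2] s3] /=; rewrite !xpair_eqE; bool_cases.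
rewrite e; congr (_ * _); apply: eq_bigl => t; rewrite !xpair_eqE /X1 /X2 /Y /src_X1 /src_X2 /src_Y /=.
  by rewrite andbC.
by case: (S t) => [[s1 s2] s3] /=; rewrite !xpair_eqE; bool_cases.
Qed.

Section Reweighted.
Variable r : U1 -> R.
Hypothesis r_ge0 : forall u, 0 <= r u.
Hypothesis r_X1 : forall x, \sum_u r u * law P (joint X1 V1) (x, u) = law P X1 x.
Hypothesis r_rates : forall i, \sum_u r u * V1_rates_at i u = \sum_u r0 u * V1_rates_at i u.

Let P' := reweight P V1 r.

Let hS' : law P' S =1 p.
Proof.
move=> [[x1 x2] y]; rewrite law_reweight_sum.
have [e0|n0] := eqVneq (law P X1 x1) 0.
  rewrite big1 => [|u _].
    by rewrite -hS (law_eq0_sub hP e0) // => t e; rewrite /X1 /= e.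
  by rewrite (law_eq0_sub hP e0) ?mulr0 // => t [e _]; rewrite /X1 /= e.
apply: (mulIf n0); rewrite -(r_X1 x1) [RHS]mulrC !mulr_suml; apply: eq_bigr => u _.
by rewrite -!mulrA -law_S_V1 r_X1.
Qed.

Let hP' : is_pmf P'.
Proof. by apply: (law_eq_pmf hp hS') => t; rewrite mulr_ge0. Qed.

Let law_src (A : finType) (f : A1 * A2 * B -> A) : law P' (f \o S) =1 law P (f \o S).
Proof.
move=> a; rewrite -(law_comp P' S) -(law_comp P S).
by apply: eq_bigr => s _; rewrite hS' hS.
Qed.

Let entropy_src (A : finType) (f : A1 * A2 * B -> A) : entropy P' (f \o S) = entropy P (f \o S).
Proof. by apply: entropy_law => s; rewrite hS' hS. Qed.

Lemma reweight_V1_system : aux_system p P' S V1 V2.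
Proof.
split; [exact: hP'|exact: hS'|split].
  apply/(cmi_eq0 hP') => u xy x1.
  rewrite (law_src (@src_X1 A1 A2 B)) (law_src (joint (joint (@src_X2 A1 A2 B) (@src_Y A1 A2 B)) (@src_X1 A1 A2 B))).
  rewrite !(@law_reweight _ _ _ P V1 r _ _ _ u); try by move=> t; rewrite /joint => -[].
  by have /(cmi_eq0 hP) e := hm1; rewrite -!mulrA e.
apply/(cmi_eq0 hP') => v xy [u x2].
rewrite !(@law_reweight _ _ _ P V1 r _ _ _ u); try by move=> t; rewrite /joint => -[].
have /(cmi_eq0 hP) e := hm2.
by rewrite mulrACA e mulrACA.
Qed.

Let decomp (Q : T -> R) (w : U1 -> R) : Q =1 reweight P V1 w -> (forall u, 0 <= w u) ->
  forall (A : eqType) (X : T -> A), entropy Q (joint X V1) = entropy Q V1 + \sum_u w u * cH X u.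
Proof.
move=> e w0 A X; rewrite !(entropy_eq_pmf _ e); exact: entropy_reweight.
Qed.

Let rates_decomp (Q : T -> R) (w : U1 -> R) : is_pmf Q -> Q =1 reweight P V1 w -> (forall u, 0 <= w u) ->
  [/\ rate1 Q X1 X2 V1 V2 = entropy Q (joint X1 X2) - entropy Q X2 + \sum_u w u * V1_rates_at 0 u,
      rate2 Q X2 Y V1 V2 = entropy Q (joint X2 Y) - entropy Q Y *+ 2 + \sum_u w u * V1_rates_at 1 u,
      rate12 Q X1 X2 Y V1 V2 = entropy Q (joint (joint X1 X2) Y) - entropy Q Y + \sum_u w u * V1_rates_at 2 u &
      relevance Q Y V1 V2 = entropy Q Y + \sum_u w u * V1_rates_at 3 u].
Proof.
move=> hQ e w0; have d := decomp e w0.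
have sumN (f : U1 -> R) : \sum_u w u * - f u = - \sum_u w u * f u.
  by rewrite -sumrN; apply: eq_bigr => u _; rewrite mulrN.
have sumD (f g : U1 -> R) : \sum_u w u * (f u + g u) = \sum_u w u * f u + \sum_u w u * g u.
  by rewrite -big_split; apply: eq_bigr => u _; rewrite mulrDr.
split; rewrite /rate1 /rate2 /rate12 /relevance ?cond_mutual_infoE ?mutual_infoE // /V1_rates_at /=;
  do ?rewrite sumD; rewrite sumN.
- have -> : entropy Q (joint (joint V1 V2) X2) = entropy Q (joint (joint V2 X2) V1) by solve_entropy.
  have -> : entropy Q (joint (joint X1 (joint V1 V2)) X2) = entropy Q (joint (joint (joint X1 V2) X2) V1) by solve_entropy.
  rewrite !d; ring.
- have -> : entropy Q (joint (joint V1 V2) Y) = entropy Q (joint (joint V2 Y) V1) by solve_entropy.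
  have -> : entropy Q (joint (joint X2 (joint V1 V2)) Y) = entropy Q (joint (joint (joint X2 V2) Y) V1) by solve_entropy.
  rewrite !d; ring.
- have -> : entropy Q (joint (joint V1 V2) Y) = entropy Q (joint (joint V2 Y) V1) by solve_entropy.
  have -> : entropy Q (joint (joint (joint X1 X2) (joint V1 V2)) Y) = entropy Q (joint (joint (joint (joint X1 X2) V2) Y) V1) by solve_entropy.
  rewrite !d; ring.
- have -> : entropy Q (joint V1 V2) = entropy Q (joint V2 V1) by solve_entropy.
  have -> : entropy Q (joint Y (joint V1 V2)) = entropy Q (joint (joint Y V2) V1) by solve_entropy.
  rewrite !d; ring.
Qed.

Lemma reweight_V1_rates a b c d : has_rates P S V1 V2 a b c d -> has_rates P' S V1 V2 a b c d.
Proof.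
move=> [-> -> -> ->]; rewrite -/X1 -/X2 -/Y.
have r00 u : 0 <= r0 u by rewrite /r0 ler0n.
have [k1 k2 k3 k4] := rates_decomp hP (fsym reweight_r0) r00.
have [k1' k2' k3' k4'] := rates_decomp hP' (frefl _) r_ge0.
have s1 := entropy_src (joint (@src_X1 A1 A2 B) (@src_X2 A1 A2 B)).
have s2 := entropy_src (@src_X2 A1 A2 B).
have s3 := entropy_src (@src_Y A1 A2 B).
have s4 := entropy_src (joint (@src_X2 A1 A2 B) (@src_Y A1 A2 B)).
have s5 := entropy_src (joint (joint (@src_X1 A1 A2 B) (@src_X2 A1 A2 B)) (@src_Y A1 A2 B)).
split; rewrite -/X1 -/X2 -/Y.
- by rewrite k1 k1' r_rates s2 s1.
- by rewrite k2 k2' r_rates s4 s3.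
- by rewrite k3 k3' r_rates s5 s3.
- by rewrite k4 k4' r_rates s3.
Qed.

End Reweighted.
End ReduceV1.

Section ReduceV2.
Let cH (A : eqType) (X : T -> A) := cond_entropy_at P V2 X.

Definition V2_rate_at (u : U2) : R := cH (joint V1 Y) u - cH (joint (joint X2 V1) Y) u.
Definition V2_relevance_at (u : U2) : R := cH V1 u - cH (joint Y V1) u.

(** The law of (V1, X2) and [rate2]: the origin of [#|A2| * #|U1| + 1]. [rate1] depends only on V1
    and the source, [rate12] follows by [rate12_rate2], and the relevance, which may grow, is the
    objective [G]. *)
Definition V2_constraints (j : U1 * A2 + unit) (u : U2) : R :=
  match j with inl xv => law P (joint (joint V1 X2) V2) (xv, u) | inr _ => V2_rate_at u end.

Let r0 u : R := (law P V2 u != 0)%:R.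

Let reweight_r0 : reweight P V2 r0 =1 P := reweight_support V2 hP.

Lemma V2_reweight : exists r : U2 -> R, [/\ forall u, 0 <= r u,
  (#|[set u | r u != 0%R]| <= #|A2| * #|U1| + 1)%N,
  forall x, \sum_u r u * law P (joint (joint V1 X2) V2) (x, u) = law P (joint V1 X2) x,
  \sum_u r u * V2_rate_at u = \sum_u r0 u * V2_rate_at u &
  \sum_u r0 u * V2_relevance_at u <= \sum_u r u * V2_relevance_at u].
Proof.
pose c (j : U1 * A2 + unit) : R := if j is inl _ then 1 else 0.
have [||r [h1 h2 h3 h4 _]] := @support_reduction R U2 _ V2_constraints V2_relevance_at c r0.
- by move=> u; rewrite /r0 ler0n.
- move=> u; rewrite /r0 pnatr_eq0 eqb0 negbK => n0; rewrite big_sumType /=.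
  rewrite [X in _ + X]big1 ?addr0; last by move=> i _; rewrite mul0r.
  under eq_bigr do rewrite mul1r.
  by rewrite law_joint_suml lt0r n0 law_ge0.
exists r; split=> //; first by rewrite card_sum card_prod card_unit mulnC in h2.
- move=> x; rewrite (h3 (inl x)) /= -law_reweight_sum.
  by rewrite /law; apply: eq_bigr => t _; exact: reweight_r0.
- exact: (h3 (inr tt)).
Qed.

Lemma law_S_V1_V2 x1 x2 y v u :
  law P (joint (joint S V1) V2) ((x1, x2, y), v, u) * law P (joint V1 X2) (v, x2) =
  law P (joint (joint V1 X2) V2) ((v, x2), u) * law P (joint S V1) ((x1, x2, y), v).
Proof.
have /(cmi_eq0 hP) /(_ u (x1, y) (v, x2)) e := hm2.
transitivity (law P (joint (joint V2 (joint X1 Y)) (joint V1 X2)) (u, (x1, y), (v, x2)) *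
  law P (joint V1 X2) (v, x2)).
  congr (_ * _); apply: eq_bigl => t; rewrite !xpair_eqE /X1 /X2 /Y /src_X1 /src_X2 /src_Y /=.
  by case: (S t) => [[s1 s2] s3] /=; rewrite !xpair_eqE; bool_cases.
rewrite e; congr (_ * _); apply: eq_bigl => t; rewrite !xpair_eqE /X1 /X2 /Y /src_X1 /src_X2 /src_Y /=.
  by rewrite andbC.
by case: (S t) => [[s1 s2] s3] /=; rewrite !xpair_eqE; bool_cases.
Qed.

Section Reweighted.
Variable r : U2 -> R.
Hypothesis r_ge0 : forall u, 0 <= r u.
Hypothesis r_V1X2 : forall x, \sum_u r u * law P (joint (joint V1 X2) V2) (x, u) = law P (joint V1 X2) x.
Hypothesis r_rate : \sum_u r u * V2_rate_at u = \sum_u r0 u * V2_rate_at u.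
Hypothesis r_relevance : \sum_u r0 u * V2_relevance_at u <= \sum_u r u * V2_relevance_at u.

Let P' := reweight P V2 r.

Let hSV : law P' (joint S V1) =1 law P (joint S V1).
Proof.
move=> [[[x1 x2] y] v]; rewrite law_reweight_sum.
have [e0|n0] := eqVneq (law P (joint V1 X2) (v, x2)) 0.
  rewrite big1 => [|u _].
    by rewrite (law_eq0_sub hP e0) // => t [e <-]; rewrite /joint /X2 /= e.
  by rewrite (law_eq0_sub hP e0) ?mulr0 // => t [e <- _]; rewrite /joint /X2 /= e.
apply: (mulIf n0); rewrite -(r_V1X2 (v, x2)) [RHS]mulrC !mulr_suml; apply: eq_bigr => u _.
by rewrite -!mulrA -law_S_V1_V2 r_V1X2.
Qed.

Let hS' : law P' S =1 p.
Proof.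
move=> s; rewrite -hS -[RHS](law_joint_sumr P S V1) -(law_joint_sumr P' S V1).
by apply: eq_bigr => v _; exact: hSV.
Qed.

Let hP' : is_pmf P'.
Proof. by apply: (law_eq_pmf hp hS') => t; rewrite mulr_ge0. Qed.

Let law_SV (A : finType) (f : A1 * A2 * B * U1 -> A) :
  law P' (f \o joint S V1) =1 law P (f \o joint S V1).
Proof.
move=> a; rewrite -(law_comp P' (joint S V1)) -(law_comp P (joint S V1)).
by apply: eq_bigr => s _; exact: hSV.
Qed.

Let entropy_SV (A : finType) (f : A1 * A2 * B * U1 -> A) :
  entropy P' (f \o joint S V1) = entropy P (f \o joint S V1).
Proof. exact: entropy_law. Qed.

Let cmi_SV (C1 C2 C3 : finType) (f1 : A1 * A2 * B * U1 -> C1) (f2 : _ -> C2) (f3 : _ -> C3) :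
  cond_mutual_info P' (f1 \o joint S V1) (f2 \o joint S V1) (f3 \o joint S V1) =
  cond_mutual_info P (f1 \o joint S V1) (f2 \o joint S V1) (f3 \o joint S V1).
Proof. by rewrite -(cond_mutual_info_law P' (joint S V1)) -(cond_mutual_info_law P (joint S V1)); exact: cond_mutual_info_eq. Qed.

Let fX1 (w : A1 * A2 * B * U1) := src_X1 w.1.
Let fX2 (w : A1 * A2 * B * U1) := src_X2 w.1.
Let fY (w : A1 * A2 * B * U1) := src_Y w.1.
Let fV1 (w : A1 * A2 * B * U1) := w.2.

Lemma reweight_V2_system : aux_system p P' S V1 V2.
Proof.
split; [exact: hP'|exact: hS'|split].
  by rewrite -hm1; exact: (cmi_SV fV1 (joint fX2 fY) fX1).
apply/(cmi_eq0 hP') => u xy vx.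
rewrite (law_SV (joint fV1 fX2)) (law_SV (joint (joint fX1 fY) (joint fV1 fX2))).
rewrite !(@law_reweight _ _ _ P V2 r _ _ _ u); try by move=> t; rewrite /joint => -[].
by have /(cmi_eq0 hP) e := hm2; rewrite -!mulrA e.
Qed.

Let decomp (Q : T -> R) (w : U2 -> R) : Q =1 reweight P V2 w -> (forall u, 0 <= w u) ->
  forall (A : eqType) (X : T -> A), entropy Q (joint X V2) = entropy Q V2 + \sum_u w u * cH X u.
Proof.
move=> e w0 A X; rewrite !(entropy_eq_pmf _ e); exact: entropy_reweight.
Qed.

Let rates_decomp (Q : T -> R) (w : U2 -> R) : is_pmf Q -> Q =1 reweight P V2 w -> (forall u, 0 <= w u) ->
  rate2 Q X2 Y V1 V2 = entropy Q (joint X2 Y) - entropy Q Y *+ 2 - entropy Q V1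
     + entropy Q (joint Y V1) + \sum_u w u * V2_rate_at u /\
  relevance Q Y V1 V2 = entropy Q Y + \sum_u w u * V2_relevance_at u.
Proof.
move=> hQ e w0; have d := decomp e w0.
have sumB (f g : U2 -> R) : \sum_u w u * (f u - g u) = \sum_u w u * f u - \sum_u w u * g u.
  by rewrite -sumrB; apply: eq_bigr => u _; rewrite mulrBr.
split; rewrite /rate2 /relevance ?cond_mutual_infoE ?mutual_infoE // sumB.
- have -> : entropy Q (joint (joint V1 V2) Y) = entropy Q (joint (joint V1 Y) V2) by solve_entropy.
  have -> : entropy Q (joint (joint X2 (joint V1 V2)) Y) = entropy Q (joint (joint (joint X2 V1) Y) V2) by solve_entropy.
  rewrite !d; ring.
- have -> : entropy Q (joint Y (joint V1 V2)) = entropy Q (joint (joint Y V1) V2) by solve_entropy.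
  rewrite !d; ring.
Qed.

Lemma reweight_V2_rates a b c d : has_rates P S V1 V2 a b c d ->
  exists2 d', has_rates P' S V1 V2 a b c d' & d <= d'.
Proof.
move=> [-> -> -> ->]; rewrite -/X1 -/X2 -/Y.
have [_ _ aux'] := reweight_V2_system.
have [_ _ aux] := hsys.
have r00 u : 0 <= r0 u by rewrite /r0 ler0n.
have [k2 k4] := rates_decomp hP (fsym reweight_r0) r00.
have [k2' k4'] := rates_decomp hP' (frefl _) r_ge0.
have s3 := entropy_SV fY.
have s4 := entropy_SV (joint fX2 fY).
have s5 := entropy_SV fV1.
have s6 := entropy_SV (joint fY fV1).
have s7 := cmi_SV fX1 fV1 fX2.
have s8 := cmi_SV fX1 fV1 (joint fX2 fY).
have s9 := cmi_SV fY fV1 (fun=> tt).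
have e2 : rate2 P X2 Y V1 V2 = rate2 P' X2 Y V1 V2.
  by rewrite k2 k2' r_rate s4 s3 s5 s6.
exists (relevance P' Y V1 V2); last by rewrite k4 k4' s3 lerD2l.
split => //.
- by rewrite (rate1_V1 hP aux) (rate1_V1 hP' aux'); exact: esym s7.
- rewrite (rate12_rate2 hP aux) (rate12_rate2 hP' aux') !mutual_info_cmi //.
  by congr (_ + _ + _); [exact: e2|exact: esym s9|exact: esym s8].
Qed.

End Reweighted.
End ReduceV2.
End ReduceAux.

Section Relabel.
Variables (R : realType) (A1 A2 B : finType) (p : A1 * A2 * B -> R).
Variables (T U1 U2 U1' U2' : finType) (P : T -> R) (S : T -> A1 * A2 * B).
Variables (V1 : T -> U1) (V2 : T -> U2) (V1' : T -> U1') (V2' : T -> U2').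
Hypothesis hP : is_pmf P.
Hypothesis e1 : forall t t', 0 < P t -> 0 < P t' -> (V1 t == V1 t') = (V1' t == V1' t').
Hypothesis e2 : forall t t', 0 < P t -> 0 < P t' -> (V2 t == V2 t') = (V2' t == V2' t').

(** Turns a small support into a small type: a map injective on the support changes no entropy. *)
Lemma relabel_system : aux_system p P S V1 V2 -> aux_system p P S V1' V2'.
Proof.
move=> [_ hS [h1 h2]]; split=> //; split.
- by rewrite -h1; apply: cmi_ker => // t t' Pt Pt'; rewrite e1.
- by rewrite -h2; apply: cmi_ker => // t t' Pt Pt'; rewrite ?joint_eq ?e1 ?e2.
Qed.

Lemma relabel_rates a b c d : has_rates P S V1 V2 a b c d -> has_rates P S V1' V2' a b c d.
Proof.
move=> [-> -> -> ->]; split; rewrite /rate1 /rate2 /rate12 /relevance ?mutual_info_cmi //.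
- by apply: cmi_ker => // t t' Pt Pt'; rewrite ?joint_eq ?e1 ?e2.
- by congr (_ - _); apply: cmi_ker => // t t' Pt Pt'; rewrite ?joint_eq ?e1 ?e2.
- by apply: cmi_ker => // t t' Pt Pt'; rewrite ?joint_eq ?e1 ?e2.
- by apply: cmi_ker => // t t' Pt Pt'; rewrite ?joint_eq ?e1 ?e2.
Qed.

End Relabel.

(** V1 is reduced and relabelled first because the bound for V2 involves the size of V1's alphabet.
    The second reduction may increase the relevance, which only helps. *)
Lemma realizable_bounded (R : realType) (A1 A2 B : finType) (p : A1 * A2 * B -> R) a b c d
    (k1 := (#|A1| + 4)%N) (k2 := (#|A2| * k1 + 1)%N) : is_pmf p ->
  realizable p a b c d ->
  exists2 d', d <= d' & exists q : A1 * A2 * B * 'I_k1 * 'I_k2 -> R, is_aux_extension p q /\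
    has_rates q (@aux_src _ 'I_k1 'I_k2) (@aux_V1 _ _ _) (@aux_V2 _ _ _) a b c d'.
Proof.
move=> hp [U1 [U2 [q [/is_aux_extensionE sys rates]]]].
have [r [r_ge0 r_card r_X1 r_rates]] := V1_reweight sys.
have sys1 := reweight_V1_system hp sys r_ge0 r_X1.
have rates1 := reweight_V1_rates hp sys r_ge0 r_X1 r_rates rates.
move: sys1 rates1; set P1 := reweight _ _ _ => sys1 rates1.
have [|f1 f1_inj] := injection_on_support _ r_card; first by rewrite addn4.
have hP1 : is_pmf P1 by case: sys1.
have e1 t t' : 0 < P1 t -> 0 < P1 t' ->
    (aux_V1 t == aux_V1 t') = (f1 (aux_V1 t) == f1 (aux_V1 t')).
  by move=> /reweight_gt0 h /reweight_gt0 h'; rewrite (inj_in_eq f1_inj).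
have sys2 := relabel_system hP1 e1 (fun _ _ _ _ => erefl) sys1.
have rates2 := relabel_rates hP1 e1 (fun _ _ _ _ => erefl) rates1.
have [s [s_ge0 s_card s_V1X2 s_rate s_rel]] := V2_reweight sys2.
have sys3 := reweight_V2_system hp sys2 s_ge0 s_V1X2.
have [d' rates3 dd'] := reweight_V2_rates hp sys2 s_ge0 s_V1X2 s_rate s_rel rates2.
move: sys3 rates3; set P2 := reweight _ _ _ => sys3 rates3.
rewrite card_ord in s_card.
have [|f2 f2_inj] := injection_on_support _ s_card; first by rewrite addn1.
have hP2 : is_pmf P2 by case: sys3.
have e2 t t' : 0 < P2 t -> 0 < P2 t' ->
    (aux_V2 t == aux_V2 t') = (f2 (aux_V2 t) == f2 (aux_V2 t')).
  by move=> /reweight_gt0 h /reweight_gt0 h'; rewrite (inj_in_eq f2_inj).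
have sys4 := relabel_system hP2 (fun _ _ _ _ => erefl) e2 sys3.
have rates4 := relabel_rates hP2 (fun _ _ _ _ => erefl) e2 rates3.
exists d' => //; eexists; split; [exact: aux_system_push sys4|exact: has_rates_push rates4].
Qed.

(** * Continuity and compactness *)

Section XlogX.
Variable R : realType.

(** Since [ln] is 0 on nonpositive numbers, the function vanishes on the left half-line; the only
    delicate point is 0 from the right. *)
Lemma continuous_xln : continuous (fun x : R => x * ln x).
Proof.
move=> x; have [x0|x0|<-] := ltgtP 0 x.
- by apply: cvgM; [exact: cvg_id|exact: continuous_ln].
- apply/cvgrPdist_lt => e e0; near=> y.
  rewrite !ln0 ?mulr0 ?subrr ?normr0 ?(ltW x0) // ltW //.
  by near: y; exact: lt_nbhsl.
apply/cvgrPdist_lt => e e0.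
near=> y; rewrite /= mul0r sub0r normrN.
have [y0|y0] := leP y 0; first by rewrite ln0 // mulr0 normr0.
(* With y = s^2, the bound -ln s <= 1/s - 1 gives -y ln y = 2 s (s (-ln s)) <= 2 s (1 - s), hence at
   most 2 s. *)
set s := Num.sqrt y.
have s0 : 0 < s by rewrite sqrtr_gt0.
have ys : s ^+ 2 = y by rewrite sqr_sqrtr // ltW.
have ye : y < (e / 2) ^+ 2.
  by near: y; apply: lt_nbhsl; rewrite exprn_gt0 // divr_gt0.
have y1 : y < 1 by near: y; apply: lt_nbhsl.
have se : s < e / 2.
  by rewrite -(@ltr_pXn2r _ 2) ?ys // nnegrE ltW // divr_gt0.
have lnN : - ln s <= s^-1 - 1.
  by rewrite -lnV ?posrE // ln_le_sub1 // invr_gt0.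
rewrite ler0_norm; last by rewrite mulr_ge0_le0 ?ln_le0 // ltW.
have -> : - (y * ln y) = 2 * s * (s * - ln s).
  by rewrite -ys lnXn // -mulr_natl; ring.
apply: le_lt_trans (_ : 2 * s * (s * (s^-1 - 1)) < _).
  by rewrite ler_pM2l ?ler_pM2l // mulr_gt0.
rewrite mulrBr mulfV ?gt_eqF // mulr1.
have : 2 * s * s >= 0 by rewrite !mulr_ge0 // ltW.
lra.
Unshelve. all: by end_near. Qed.

End XlogX.

Section ContinuousFunctions.
Variables (R : realType) (T : topologicalType).
Implicit Types f g : T -> R.

Lemma continuous_add f g : continuous f -> continuous g -> continuous (fun v => f v + g v).
Proof. by move=> hf hg v; apply: cvgD; [exact: hf|exact: hg]. Qed.

Lemma continuous_opp f : continuous f -> continuous (fun v => - f v).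
Proof. by move=> hf v; apply: cvgN; exact: hf. Qed.

Lemma continuous_sub f g : continuous f -> continuous g -> continuous (fun v => f v - g v).
Proof. by move=> hf hg; apply: continuous_add => //; exact: continuous_opp. Qed.

Lemma continuous_norm f : continuous f -> continuous (fun v => `|f v|).
Proof. by move=> hf v; apply: cvg_norm; exact: hf. Qed.

Lemma continuous_const (c : R) : continuous (fun _ : T => c).
Proof. by move=> v; exact: cvg_cst. Qed.

Lemma continuous_sum (I : Type) (s : seq I) (Q : pred I) (f : I -> T -> R) :
  (forall i, continuous (f i)) -> continuous (fun v => \sum_(i <- s | Q i) f i v).
Proof.
move=> hf; elim: s => [|i s IH].
  by under eq_fun do rewrite big_nil; exact: continuous_const.
under eq_fun do rewrite big_cons.
by case: (Q i) => //; apply: continuous_add.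
Qed.

Lemma continuous_xlog2 f : continuous f -> continuous (fun v => f v * log2 (f v)).
Proof.
move=> hf v; rewrite /log2; under eq_fun do rewrite mulrA.
apply: cvgM; last exact: cvg_cst.
apply: (@continuous_comp _ _ _ f (fun x => x * ln x)); first exact: hf.
exact: continuous_xln.
Qed.

(** Twice the positive part; this form makes continuity immediate. *)
Definition pos_part (x : R) := x + `|x|.

Lemma pos_part_ge0 x : 0 <= pos_part x.
Proof. by rewrite /pos_part; case: (ger0P x) => h; lra. Qed.

Lemma pos_part_le x e : 0 <= e -> x <= e -> pos_part x <= 2 * e.
Proof.
by move=> e0 xe; rewrite /pos_part; case: (ger0P x) => h; lra.
Qed.

Lemma pos_part_le0 x : pos_part x <= 0 -> x <= 0.
Proof.
by rewrite /pos_part; case: (ger0P x) => h; lra.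
Qed.

Lemma continuous_pos_part f : continuous f -> continuous (fun v => pos_part (f v)).
Proof. by move=> hf; apply: continuous_add => //; exact: continuous_norm. Qed.

Variables (W : finType) (q : T -> W -> R).
Hypothesis hq : forall w, continuous (fun v => q v w).

Lemma continuous_law (A : finType) (X : W -> A) a : continuous (fun v => law (q v) X a).
Proof. exact: continuous_sum. Qed.

Lemma continuous_entropy (A : finType) (X : W -> A) : continuous (fun v => entropy (q v) X).
Proof.
under eq_fun do rewrite entropyE.
apply: continuous_opp; apply: continuous_sum => a.
by apply: continuous_xlog2; exact: continuous_law.
Qed.

(** Agrees with [cond_mutual_info] on pmfs, but is visibly continuous in all of [Q], because x log x
    is, whereas the quotients of laws are not. *)
Definition cmi_entropy (Q : W -> R) (A B C : finType) (X : W -> A) (Y : W -> B) (Z : W -> C) :=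
  entropy Q (joint X Z) + entropy Q (joint Y Z) - entropy Q (joint (joint X Y) Z) - entropy Q Z.

Lemma continuous_cmi (A B C : finType) (X : W -> A) (Y : W -> B) (Z : W -> C) :
  continuous (fun v => cmi_entropy (q v) X Y Z).
Proof.
by apply: continuous_sub; [apply: continuous_sub; [apply: continuous_add|]|]; exact: continuous_entropy.
Qed.

End ContinuousFunctions.

Lemma sum7_le0 (R : realType) (x1 x2 x3 x4 x5 x6 x7 : R) :
  0 <= x1 -> 0 <= x2 -> 0 <= x3 -> 0 <= x4 -> 0 <= x5 -> 0 <= x6 -> 0 <= x7 ->
  x1 + x2 + x3 + x4 + x5 + x6 + x7 <= 0 ->
  [/\ x1 <= 0, x2 <= 0, x3 <= 0 & x4 <= 0] /\ [/\ x5 <= 0, x6 <= 0 & x7 <= 0].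
Proof. by move=> *; split; split; lra. Qed.

Section Closure.
Variables (R : realType) (A1 A2 B : finType) (p : A1 * A2 * B -> R).
Hypothesis hp : is_pmf p.
Hypothesis hmarkov : markov_chain p (@src_X1 A1 A2 B) (@src_Y A1 A2 B) (@src_X2 A1 A2 B).
Variables (U1 U2 : finType) (R1 R2 mu : R).

Local Notation W := (A1 * A2 * B * U1 * U2)%type.
Local Notation S := (@aux_src (A1 * A2 * B) U1 U2).
Local Notation X1 := (@src_X1 A1 A2 B \o S).
Local Notation X2 := (@src_X2 A1 A2 B \o S).
Local Notation Y := (@src_Y A1 A2 B \o S).
Local Notation V1 := (@aux_V1 (A1 * A2 * B) U1 U2).
Local Notation V2 := (@aux_V2 (A1 * A2 * B) U1 U2).

(* Vanishes exactly on the auxiliary extensions that witness [(R1, R2, mu)];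
   continuous in [q] because everything is written with entropies. *)
Definition violation (q : W -> R) : R :=
  pos_part (cmi_entropy q X1 (joint V1 V2) X2 - R1) +
  pos_part (cmi_entropy q X2 (joint V1 V2) Y - cmi_entropy q Y V1 (fun=> tt) + mu - R2) +
  pos_part (cmi_entropy q (joint X1 X2) (joint V1 V2) Y + mu - (R1 + R2)) +
  pos_part (mu - cmi_entropy q Y (joint V1 V2) (fun=> tt)) +
  `|cmi_entropy q V1 (joint X2 Y) X1| + `|cmi_entropy q V2 (joint X1 Y) (joint V1 X2)| +
  \sum_s `|law q S s - p s|.

(** Normalisation of [q] is not measured separately: it follows from the source marginal being
    [p]. *)
Lemma violation0 q : (forall w, 0 <= q w) -> violation q <= 0 ->
  is_aux_extension p q /\ exists a b c d, [/\ has_rates q S V1 V2 a b c d,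
    a <= R1, b + mu <= R2, c + mu <= R1 + R2 & mu <= d].
Proof.
move=> q0 v0.
have s0 s : 0 <= `|law q S s - p s| by [].
have [] := sum7_le0 (pos_part_ge0 _) (pos_part_ge0 _) (pos_part_ge0 _) (pos_part_ge0 _)
  (normr_ge0 _) (normr_ge0 _) (sumr_ge0 _ (fun s _ => s0 s)) v0.
move=> [/pos_part_le0 h1 /pos_part_le0 h2 /pos_part_le0 h3 /pos_part_le0 h4].
rewrite !normr_le0 => -[/eqP h5 /eqP h6 h7].
have sq : law q S =1 p.
  move=> s; apply/eqP; rewrite -subr_eq0 -normr_le0; apply: le_trans h7.
  by rewrite (bigD1 s) //= lerDl sumr_ge0.
have hq : is_pmf q by exact: law_eq_pmf hp sq q0.
split; first by apply/is_aux_extensionE; split=> //; split; rewrite cond_mutual_infoE.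
do 4!eexists; split; first by split.
- by rewrite /rate1 cond_mutual_infoE // -subr_le0.
- by rewrite /rate2 mutual_info_cmi // !cond_mutual_infoE // -subr_le0.
- by rewrite /rate12 cond_mutual_infoE // -subr_le0.
- by rewrite /relevance mutual_info_cmi // cond_mutual_infoE // -subr_le0.
Qed.

(** 14 = 2 (1 + 2 + 3 + 1): the slacks of [achievable_realizable] are e, 2e, 3e and e, and
    [pos_part] doubles each. *)
Lemma violation_le q e a b c d : 0 <= e -> is_aux_extension p q ->
  has_rates q S V1 V2 a b c d -> a <= R1 + e -> b + mu <= R2 + 2 * e ->
  c + mu <= R1 + R2 + 3 * e -> mu - e <= d -> violation q <= 14 * e.
Proof.
move=> e0 /is_aux_extensionE [hq sq [m1 m2]] [ea eb ec ed] ha hb hc hd.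
have h1 : pos_part (cmi_entropy q X1 (joint V1 V2) X2 - R1) <= 2 * e.
  by apply: pos_part_le => //; move: ha; rewrite ea /rate1 cond_mutual_infoE // -/(cmi_entropy _ _ _ _); lra.
have h2 : pos_part (cmi_entropy q X2 (joint V1 V2) Y - cmi_entropy q Y V1 (fun=> tt) + mu - R2) <= 2 * (2 * e).
  apply: pos_part_le; first lra.
  move: hb; rewrite eb /rate2 mutual_info_cmi // !cond_mutual_infoE // -!/(cmi_entropy _ _ _ _); lra.
have h3 : pos_part (cmi_entropy q (joint X1 X2) (joint V1 V2) Y + mu - (R1 + R2)) <= 2 * (3 * e).
  apply: pos_part_le; first lra.
  move: hc; rewrite ec /rate12 cond_mutual_infoE // -/(cmi_entropy _ _ _ _); lra.
have h4 : pos_part (mu - cmi_entropy q Y (joint V1 V2) (fun=> tt)) <= 2 * e.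
  apply: pos_part_le => //.
  move: hd; rewrite ed /relevance mutual_info_cmi // cond_mutual_infoE // -/(cmi_entropy _ _ _ _); lra.
have k1 : cmi_entropy q V1 (joint X2 Y) X1 = 0 by rewrite -m1 cond_mutual_infoE.
have k2 : cmi_entropy q V2 (joint X1 Y) (joint V1 X2) = 0 by rewrite -m2 cond_mutual_infoE.
rewrite /violation k1 k2 !normr0 big1 => [|s _]; last by rewrite sq subrr normr0.
lra.
Qed.

Lemma continuous_violation (T : topologicalType) (q : T -> W -> R) :
  (forall w, continuous (fun v => q v w)) -> continuous (fun v => violation (q v)).
Proof.
move=> hq; rewrite /violation.
have cc := @continuous_cmi _ _ _ _ hq.
apply: continuous_add; last first.
  by apply: continuous_sum => s; apply: continuous_norm; apply: continuous_sub ; [exact: (@continuous_law _ _ _ q hq)|exact: continuous_const].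
apply: continuous_add; last by apply: continuous_norm; exact: cc.
apply: continuous_add; last by apply: continuous_norm; exact: cc.
apply: continuous_add; last by apply: continuous_pos_part; apply: continuous_sub; [exact: continuous_const|exact: cc].
apply: continuous_add; last by apply: continuous_pos_part; apply: continuous_sub; [apply: continuous_add; [exact: cc|exact: continuous_const]|exact: continuous_const].
apply: continuous_add; last first.
  by apply: continuous_pos_part; apply: continuous_sub; [apply: continuous_add; [apply: continuous_sub; exact: cc|exact: continuous_const]|exact: continuous_const].
by apply: continuous_pos_part; apply: continuous_sub; [exact: cc|exact: continuous_const].
Qed.

Lemma violation_attained : (forall e, 0 < e -> exists2 q, is_aux_extension p q & violation q <= e) ->
  exists2 q, (forall w, 0 <= q w) & violation q <= 0.
Proof.
move=> h; pose q (v : 'rV[R]_#|{: W}|) (w : W) := v ord0 (enum_rank w).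
have cq w : continuous (fun v => q v w) by exact: coord_continuous.
(* The whole cube rather than the simplex: it is compact, contains every pmf, and already gives
   nonnegativity. *)
pose K := [set v : 'rV[R]_#|{: W}| | forall i, `[0, 1]%classic (v ord0 i)]%classic.
have cK : compact K by apply: (@rV_compact R _ (fun=> `[0, 1]%classic)) => i; exact: segment_compact.
pose row (f : W -> R) : 'rV[R]_#|{: W}| := \row_i f (enum_val i).
have qrow f : q (row f) = f by apply/funext => w; rewrite /q /row mxE enum_rankK.
have rowK f : is_pmf f -> K (row f).
  move=> [f0 f1] i /=; rewrite mxE in_itv /= f0 /= -f1 (bigD1 (enum_val i)) //= lerDl.
  exact: sumr_ge0.
have [q1 [hq1 _ _ _] _] := h 1 ltr01.
have [||v vK hmin] := @EVT_min_rV R _ (fun v => violation (q v)) K _ cK.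
- by exists (row q1); exact: rowK.
- by apply: continuous_subspaceT; exact: continuous_violation.
exists (q v).
  by move=> w; move: vK; rewrite inE => /(_ (enum_rank w)) /=; rewrite in_itv /= => /andP[].
apply/ler_addgt0Pr => e e0; rewrite add0r.
have [q2 [hq2 _ _ _] le] := h e e0.
by apply: le_trans le; rewrite -(qrow q2); apply: hmin; rewrite inE; exact: rowK.
Qed.

End Closure.

Lemma achievable_sub_outer (R : realType) (A1 A2 B : finType) (p : A1 * A2 * B -> R) (R1 R2 mu : R) :
  is_pmf p -> markov_chain p (@src_X1 A1 A2 B) (@src_Y A1 A2 B) (@src_X2 A1 A2 B) ->
  achievable_region p (R1, R2, mu) -> outer_region p (R1, R2, mu).
Proof.
move=> hp hmarkov ach; have [R10 R20 mu0 _] := ach; split => //.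
pose k1 := (#|A1| + 4)%N; pose k2 := (#|A2| * k1 + 1)%N.
have [e e0|q q0 v0] := @violation_attained R A1 A2 B p 'I_k1 'I_k2 R1 R2 mu.
  have e14 : 0 < e / 14 by rewrite divr_gt0.
  have [a [b [c [d [r h1 h2 h3 h4]]]]] := achievable_realizable hp hmarkov ach e14.
  have [d' dd' [q [hq rates]]] := realizable_bounded hp r.
  exists q => //.
  have := violation_le (ltW e14) hq rates h1 h2 h3 (le_trans h4 dd').
  by rewrite (_ : 14 * (e / 14) = e); last by field.
have [hq [a [b [c [d [[-> -> -> ->] h1 h2 h3 h4]]]]]] := violation0 hp q0 v0.
exists 'I_k1, 'I_k2, q; split => //=; rewrite ?card_ord //; split => //.
by rewrite ge_max R20 andbT.
Qed.

(** * Random binning *)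

Lemma norm_le_amgm (R : realFieldType) (a x : R) : 0 < x -> a <= x / 2 + a ^+ 2 / (2 * x).
Proof.
move=> x0; rewrite -subr_ge0.
have -> : x / 2 + a ^+ 2 / (2 * x) - a = (a - x) ^+ 2 / (2 * x) by field; rewrite gt_eqF.
by rewrite divr_ge0 ?sqr_ge0 // mulr_ge0 // ltW.
Qed.

Section RandomHash.
Variables (R : realType) (Z H : finType).
Hypothesis H0 : (0 < #|H|)%N.

(** Expectation over a uniformly random map. The weight is a product over [Z], so that sums over
    maps factor by distributivity. *)
Definition hash_avg (f : {ffun Z -> H} -> R) : R :=
  \sum_(t : {ffun Z -> H}) (\prod_(z : Z) #|H|%:R^-1) * f t.

Let nH : #|H|%:R != 0 :> R. Proof. by rewrite pnatr_eq0 -lt0n. Qed.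

Lemma hash_weight_ge0 : 0 <= \prod_(z : Z) (#|H|%:R^-1 : R).
Proof. by apply: prodr_ge0 => z _; rewrite invr_ge0 ler0n. Qed.

Lemma hash_avg_prod (F : Z -> H -> R) :
  hash_avg (fun t => \prod_z F z (t z)) = \prod_z ((\sum_h F z h) / #|H|%:R).
Proof.
rewrite /hash_avg.
transitivity (\sum_(t : {ffun Z -> H}) \prod_z (F z (t z) / #|H|%:R)).
  by apply: eq_bigr => t _; rewrite -big_split; apply: eq_bigr => z _; rewrite mulrC.
rewrite -(bigA_distr_bigA (fun z h => F z h / #|H|%:R)).
by apply: eq_bigr => z _; rewrite mulr_suml.
Qed.

Lemma hash_avg_sum (I : Type) (s : seq I) (Q : pred I) (f : I -> {ffun Z -> H} -> R) :
  hash_avg (fun t => \sum_(i <- s | Q i) f i t) = \sum_(i <- s | Q i) hash_avg (f i).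
Proof.
by rewrite /hash_avg exchange_big; apply: eq_bigr => t _; rewrite mulr_sumr.
Qed.

Lemma hash_avgZ c f : hash_avg (fun t => c * f t) = c * hash_avg f.
Proof. by rewrite /hash_avg mulr_sumr; apply: eq_bigr => t _; rewrite mulrCA. Qed.

Lemma hash_avgD f g : hash_avg (fun t => f t + g t) = hash_avg f + hash_avg g.
Proof. by rewrite /hash_avg -big_split; apply: eq_bigr => t _; rewrite mulrDr. Qed.

Lemma hash_avg_eq f g : f =1 g -> hash_avg f = hash_avg g.
Proof. by move=> e; apply: eq_bigr => t _; rewrite e. Qed.

Lemma hash_avg_le f g : (forall t, f t <= g t) -> hash_avg f <= hash_avg g.
Proof. by move=> h; apply: ler_sum => t _; rewrite ler_wpM2l // hash_weight_ge0. Qed.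

Lemma hash_avg_ge0 f : (forall t, 0 <= f t) -> 0 <= hash_avg f.
Proof. by move=> h; apply: sumr_ge0 => t _; rewrite mulr_ge0 ?hash_weight_ge0. Qed.

Lemma hash_avg_const c : hash_avg (fun=> c) = c.
Proof.
transitivity (hash_avg (fun t => c * \prod_(z : Z) (fun _ _ => 1) z (t z))).
  by apply: hash_avg_eq => t; rewrite big1 // mulr1.
rewrite hash_avgZ (hash_avg_prod (fun _ _ => 1)) big1 ?mulr1 // => z _.
by rewrite big_const iter_addr_0 divff.
Qed.

Lemma hash_avg_exists f c : hash_avg f <= c -> exists t, f t <= c.
Proof.
move=> h; apply/existsP; apply: contraT; rewrite negb_exists => /forallP lt.
have [h0 _] : exists x : H, true by case/card_gt0P: H0 => x _; exists x.
have : c < hash_avg f; last by rewrite ltNge h.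
rewrite -[X in X < _](hash_avg_const c) /hash_avg.
have w0 : 0 < \prod_(z : Z) (#|H|%:R^-1 : R).
  by apply: prodr_gt0 => z _; rewrite invr_gt0 ltr0n.
apply: ltr_sum => [|t _].
  by apply/hasP; exists [ffun=> h0]; rewrite ?mem_index_enum.
by rewrite ltr_pM2l // ltNge.
Qed.

Lemma hash_avg1 (g : H -> R) z : hash_avg (fun t => g (t z)) = (\sum_h g h) / #|H|%:R.
Proof.
pose F y h := if y == z then g h else 1.
transitivity (hash_avg (fun t => \prod_y F y (t y))).
  by apply: hash_avg_eq => t; rewrite (bigD1 z) //= {1}/F eqxx big1 ?mulr1 // => y; rewrite /F => /negPf ->.
rewrite (hash_avg_prod F) (bigD1 z) //= {1}/F eqxx [X in _ * X]big1 ?mulr1 // => y.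
by rewrite /F => /negPf ->; rewrite big_const iter_addr_0 divff.
Qed.

Lemma hash_avg2_prod (g1 g2 : H -> R) z z' : z != z' ->
  hash_avg (fun t => g1 (t z) * g2 (t z')) = (\sum_h g1 h) / #|H|%:R * ((\sum_h g2 h) / #|H|%:R).
Proof.
move=> zz'.
pose F y h := if y == z then g1 h else if y == z' then g2 h else 1.
transitivity (hash_avg (fun t => \prod_y F y (t y))).
  apply: hash_avg_eq => t; rewrite (bigD1 z) //= (bigD1 z') 1?eq_sym //= big1 ?mulr1.
    by rewrite /F eqxx eq_sym (negPf zz') eqxx.
  by move=> y /andP[/negPf e /negPf e']; rewrite /F e e'.
rewrite (hash_avg_prod F) (bigD1 z) //= (bigD1 z') 1?eq_sym //= [X in _ * (_ * X)]big1 ?mulr1.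
  by rewrite {1 2}/F eqxx eq_sym (negPf zz') eqxx.
move=> y /andP[/negPf e /negPf e']; rewrite /F e e'.
by rewrite big_const iter_addr_0 divff.
Qed.

Section Balanced.
Variables (C : finType) (pi : H -> C).
(** [pi] reads off a part of the hash; having fibres of equal size makes that part uniform. *)
Hypothesis bal : forall c, (\sum_(h | pi h == c) 1) / #|H|%:R = #|C|%:R^-1 :> R.

Let ind (c : C) (h : H) : R := (pi h == c)%:R.

Let sum_ind c : (\sum_h ind c h) / #|H|%:R = #|C|%:R^-1.
Proof. by rewrite -(bal c) /ind [in RHS]big_mkcond /=; congr (_ / _); apply: eq_bigr => h _; case: (_ == _). Qed.

Let C0 : (0 < #|C|)%N.
Proof. by case/card_gt0P: H0 => h _; apply/card_gt0P; exists (pi h). Qed.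

Let nC : #|C|%:R != 0 :> R. Proof. by rewrite pnatr_eq0 -lt0n. Qed.

Lemma hash_collision z z' : z != z' ->
  hash_avg (fun t => (pi (t z') == pi (t z))%:R) = #|C|%:R^-1.
Proof.
move=> zz'; transitivity (hash_avg (fun t => \sum_c ind c (t z) * ind c (t z'))).
  apply: hash_avg_eq => t; rewrite (bigD1 (pi (t z))) //= /ind eqxx mul1r big1 ?addr0 // => c.
  by rewrite eq_sym => /negPf ->; rewrite mul0r.
rewrite hash_avg_sum; under eq_bigr do rewrite hash_avg2_prod // !sum_ind.
by rewrite big_const iter_addr_0 -[LHS]mulr_natl mulrA divff // mul1r.
Qed.

(* Slepian--Wolf decoding; correct as soon as the true value is the only candidate in its bin. *)
Definition bin_decode (t : {ffun Z -> H}) (z0 : Z) (A : {set Z}) (c : C) : Z :=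
  if [pick z in A | pi (t z) == c] is Some z then z else z0.

(** Union bound: each wrong candidate shares the bin of [z] with probability 1/|C|. *)
Lemma bin_decode_error (z0 : Z) (A : {set Z}) z :
  hash_avg (fun t => (bin_decode t z0 A (pi (t z)) != z)%:R) <= (z \notin A)%:R + #|A|%:R / #|C|%:R.
Proof.
apply: le_trans (_ : hash_avg (fun t => (z \notin A)%:R +
    \sum_(z' in A :\ z) (pi (t z') == pi (t z))%:R) <= _).
  apply: hash_avg_le => t.
  have s0 : 0 <= \sum_(z' in A :\ z) (pi (t z') == pi (t z))%:R :> R.
    by apply: sumr_ge0 => z' _; rewrite ler0n.
  have [_|ne] := eqVneq; first by rewrite addr_ge0.
  have [zA|zA] := boolP (z \in A); last by rewrite lerDl.
  rewrite add0r; move: ne; rewrite /bin_decode; case: pickP => [z' /andP[z'A e] ne|/(_ z)].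
    by rewrite (bigD1 z') /= ?inE ?ne // e lerDl; apply: sumr_ge0 => y _; rewrite ler0n.
  by rewrite zA eqxx.
rewrite hash_avgD hash_avg_const hash_avg_sum lerD2l.
rewrite (eq_bigr (fun=> #|C|%:R^-1)); last first.
  by move=> z'; rewrite !inE => /andP[ne _]; rewrite hash_collision // eq_sym.
rewrite sumr_const -[_ *+ _]mulr_natl ler_wpM2r ?invr_ge0 ?ler0n // ler_nat.
by rewrite subset_leq_card // subD1set.
Qed.

(* Leftover hash lemma; the second moment bounds the first by AM-GM, not Jensen. *)
Lemma leftover_hash (w : Z -> R) (tau eta : R) : is_pmf w -> 0 < eta -> 0 <= tau ->
  hash_avg (fun t => \sum_c `|\sum_(z | pi (t z) == c) w z - #|C|%:R^-1|) <=
  2 * (\sum_(z | tau < w z) w z) + eta / 2 + tau * #|C|%:R / (2 * eta).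
Proof.
move=> [w0 w1] eta0 tau0.
pose k : R := #|C|%:R^-1.
have k0 : 0 < k by rewrite invr_gt0 ltr0n.
have sumk : \sum_(c : C) k = 1 by rewrite big_const iter_addr_0 -[LHS]mulr_natl divff.
pose D c z (t : {ffun Z -> H}) := ind c (t z) - k.
(* Truncation at [tau]: light values have a small second moment because w^2 <= tau w, and heavy ones
   are bounded by twice their mass. *)
pose N c t := \sum_(z | w z <= tau) w z * D c z t.
pose M c t := \sum_(z | tau < w z) w z * `|D c z t|.
have split1 c (t : {ffun Z -> H}) : `|\sum_(z | pi (t z) == c) w z - k| <= `|N c t| + M c t.
  have -> : \sum_(z | pi (t z) == c) w z - k = N c t + \sum_(z | tau < w z) w z * D c z t.
    transitivity (\sum_z w z * D c z t).
      rewrite /D /ind; under [RHS]eq_bigr do rewrite mulrBr.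
      rewrite sumrB -mulr_suml w1 mul1r big_mkcond; congr (_ - _).
      by apply: eq_bigr => z _; case: eqP; rewrite ?mulr1 ?mulr0.
    rewrite (bigID (fun z => w z <= tau)) /=; congr (_ + _).
    by apply: eq_bigl => z; rewrite -ltNge.
  apply: le_trans (ler_normD _ _) _; rewrite lerD2l.
  apply: le_trans (ler_norm_sum _ _ _) _; apply: ler_sum => z _.
  by rewrite normrM ger0_norm.
have sumM (t : {ffun Z -> H}) : \sum_c M c t <= 2 * \sum_(z | tau < w z) w z.
  rewrite /M exchange_big mulr_sumr; apply: ler_sum => z _.
  rewrite -mulr_sumr mulrC ler_wpM2r //.
  apply: le_trans (_ : \sum_c (ind c (t z) + k) <= _).
    apply: ler_sum => c _; apply: le_trans (ler_normB _ _) _.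
    by rewrite !ger0_norm ?ler0n ?(ltW k0).
  rewrite big_split /= sumk (bigD1 (pi (t z))) //= /ind eqxx big1 ?addr0 //.
  by move=> c; rewrite eq_sym => /negPf ->.
have amgm c (t : {ffun Z -> H}) : `|N c t| <= eta * k / 2 + N c t ^+ 2 / (2 * eta * k).
  rewrite -[N c t ^+ 2](ger0_norm (sqr_ge0 _)) normrX -[2 * eta * k]mulrA.
  exact: norm_le_amgm (mulr_gt0 eta0 k0).
have avgD1 c z : hash_avg (fun t => ind c (t z)) = k by rewrite (hash_avg1 (ind c)) sum_ind.
(* Distinct values are hashed independently and [D] is centred, so only the diagonal of N^2 survives
   the average. *)
have avgD2 c z z' : z != z' -> hash_avg (fun t => D c z t * D c z' t) = 0.
  move=> zz'.
  rewrite (@hash_avg2_prod (fun h => ind c h - k) (fun h => ind c h - k)) //.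
  rewrite sumrB mulrBl sum_ind big_const iter_addr_0 -[k *+ _]mulr_natl [#|H|%:R * k]mulrC mulfK //.
  by rewrite subrr mul0r.
have avgDD c z : hash_avg (fun t => D c z t * D c z t) <= k.
  rewrite (@hash_avg_eq _ (fun t => (1 - 2 * k) * ind c (t z) + k ^+ 2)); last first.
    by move=> t; rewrite /D /ind; case: (_ == _) => /=; ring.
  by rewrite hash_avgD hash_avgZ avgD1 hash_avg_const; have := sqr_ge0 k; rewrite expr2; lra.
have avgN c : hash_avg (fun t => N c t ^+ 2) <= tau * k.
  pose f z z' t := w z * w z' * (D c z t * D c z' t).
  rewrite (@hash_avg_eq _ (fun t => \sum_(z | w z <= tau) \sum_(z' | w z' <= tau) f z z' t)); last first.
    move=> t; rewrite expr2 /N mulr_suml; apply: eq_bigr => z _.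
    by rewrite mulr_sumr; apply: eq_bigr => z' _; rewrite /f mulrACA.
  rewrite hash_avg_sum.
  apply: le_trans (_ : \sum_(z | w z <= tau) w z * (tau * k) <= _).
    apply: ler_sum => z zt; rewrite hash_avg_sum (bigD1 z) //= big1 ?addr0.
      rewrite hash_avgZ -mulrA ler_wpM2l //; apply: ler_pM => //.
      by apply: hash_avg_ge0 => t; rewrite -expr2 sqr_ge0.
    by move=> z' /andP[_ zz']; rewrite hash_avgZ avgD2 ?mulr0 // eq_sym.
  rewrite -mulr_suml ler_piMl ?mulr_ge0 ?(ltW k0) // -w1 [leRHS](bigID (fun z => w z <= tau)) /=.
  by rewrite lerDl sumr_ge0.
apply: le_trans (_ : hash_avg (fun t => (\sum_c (eta * k / 2 + N c t ^+ 2 / (2 * eta * k)) +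
   2 * \sum_(z | tau < w z) w z)) <= _).
  apply: hash_avg_le => t; apply: le_trans (_ : \sum_c (`|N c t| + M c t) <= _).
    by apply: ler_sum => c _; exact: split1.
  rewrite [leLHS]big_split /=; apply: lerD => //; apply: ler_sum => c _; exact: amgm.
rewrite hash_avgD hash_avg_const addrC -addrA lerD2l hash_avg_sum.
apply: le_trans (_ : \sum_(c : C) (eta / 2 + tau * #|C|%:R / (2 * eta)) * k <= _).
  apply: ler_sum => c _; rewrite hash_avgD hash_avg_const [(eta / 2 + _) * k]mulrDl; apply: lerD.
    by rewrite mulrAC.
  rewrite (@hash_avg_eq _ (fun t => (2 * eta * k)^-1 * N c t ^+ 2)); last by move=> t; rewrite mulrC.
  rewrite hash_avgZ mulrC ler_pdivrMr ?mulr_gt0 //; apply: le_trans (avgN c) _.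
  rewrite le_eqVlt; apply/orP; left; apply/eqP; rewrite /k; field.
  by rewrite nC (gt_eqF eta0).
by rewrite -mulr_sumr sumk mulr1.
Qed.

End Balanced.
End RandomHash.

(** * Averages over pmfs, derandomisation and kernels for the encoders *)

Lemma pmf_inhabited (R : realType) (V : finType) (w : V -> R) : is_pmf w -> exists v : V, True.
Proof.
move=> [_ w1]; have [/existsP[v _]|] := boolP [exists v : V, true]; first by exists v.
rewrite negb_exists => /forallP h; move: w1; rewrite big1 => [/eqP|v _]; last by have := h v.
by rewrite eq_sym oner_eq0.
Qed.

Lemma pmf_avg_const (R : realType) (V : finType) (w : V -> R) c : is_pmf w -> \sum_v w v * c = c.
Proof. by move=> [_ w1]; rewrite -mulr_suml w1 mul1r. Qed.

Lemma pmf_avg_le (R : realType) (V : finType) (w f : V -> R) c : is_pmf w ->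
  (forall v, f v <= c) -> \sum_v w v * f v <= c.
Proof.
move=> hw h; rewrite -[leRHS](pmf_avg_const c hw).
by apply: ler_sum => v _; rewrite ler_wpM2l //; have [w0 _] := hw; exact: w0.
Qed.

Lemma pmf_avg_ge (R : realType) (V : finType) (w f : V -> R) c : is_pmf w ->
  (forall v, c <= f v) -> c <= \sum_v w v * f v.
Proof.
move=> hw h; rewrite -[leLHS](pmf_avg_const c hw).
by apply: ler_sum => v _; rewrite ler_wpM2l //; have [w0 _] := hw; exact: w0.
Qed.

Lemma exists_le_avg (R : realType) (V : finType) (w f : V -> R) c : is_pmf w ->
  \sum_v w v * f v <= c -> exists v, f v <= c.
Proof.
move=> [w0 w1] h; apply/existsP; apply: contraT; rewrite negb_exists => /forallP lt.
have [v v0] : exists v, w v != 0.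
  apply/existsP; apply: contraT; rewrite negb_exists => /forallP z.
  by move: w1; rewrite big1 => [/eqP|v _]; [rewrite eq_sym oner_eq0|apply/eqP; rewrite -[_ == _]negbK].
have : c < \sum_v w v * f v; last by rewrite ltNge h.
rewrite -[c]mul1r -w1 mulr_suml (bigD1 v) //= [ltRHS](bigD1 v) //=.
have wv : 0 < w v by rewrite lt0r v0 w0.
apply: ltr_leD; first by rewrite (ltr_pM2l wv) ltNge.
by apply: ler_sum => u _; rewrite ler_wpM2l // ltW // ltNge.
Qed.

(** The cost is linear in the kernel, which depends on [s] only through [x s]; for each value of
    [x s] a best [v] is chosen separately. *)
Lemma derandomise (R : realType) (S X V : finType) (p : S -> R) (x : S -> X)
    (K : X -> V -> R) (C : S -> V -> R) : (forall y, is_pmf (K y)) ->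
  exists k : X -> V, \sum_s p s * C s (k (x s)) <= \sum_s p s * \sum_v K (x s) v * C s v.
Proof.
move=> hK.
have /choice[k hk] y : exists v, \sum_(s | x s == y) p s * C s v <=
    \sum_u K y u * \sum_(s | x s == y) p s * C s u.
  exact: exists_le_avg (hK y) (lexx _).
exists k; rewrite (partition_big x predT) //= [leRHS](partition_big x predT) //=.
apply: ler_sum => y _.
rewrite (eq_bigr (fun s => p s * C s (k y))); last by move=> s /eqP ->.
apply: le_trans (hk y) _; rewrite le_eqVlt; apply/orP; left; apply/eqP.
transitivity (\sum_u \sum_(s | x s == y) p s * (K y u * C s u)).
  by apply: eq_bigr => u _; rewrite mulr_sumr; apply: eq_bigr => s _; rewrite mulrCA.
rewrite exchange_big; apply: eq_bigr => s xs; rewrite (eqP xs) mulr_sumr.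
by [].
Qed.

(** [K f] is the law [w] conditioned on the bin [f]. A bin of mass 0 gets [w] itself, just to have a
    pmf there. *)
Lemma bin_kernel (R : realType) (V F : finType) (w : V -> R) (phi : V -> F) : is_pmf w ->
  exists K : F -> V -> R, (forall f, is_pmf (K f)) /\
    forall f v, (\sum_(u | phi u == f) w u) * K f v = w v * (phi v == f)%:R.
Proof.
move=> hw; have [w0 w1] := hw; pose Z f := \sum_(u | phi u == f) w u.
exists (fun f v => if Z f == 0 then w v else w v * (phi v == f)%:R / Z f).
have Z0 f : 0 <= Z f by exact: sumr_ge0.
split=> [f|f v]; case: (eqVneq (Z f) 0) => [e|n0].
- exact: hw.
- split=> [v|]; first by rewrite divr_ge0 // mulr_ge0 // ler0n.
  rewrite -mulr_suml -[RHS](divff n0); congr (_ / _); rewrite /Z [RHS]big_mkcond.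
  by apply: eq_bigr => v _; case: eqP; rewrite ?mulr1 ?mulr0.
- rewrite -/(Z f) e mul0r; have [/eqP pv|_] := boolP (phi v == f); last by rewrite mulr0.
  by have /eqP := e; rewrite psumr_eq0 // => /allP /(_ v (mem_index_enum _)); rewrite pv eqxx mulr1 => /eqP ->.
- by rewrite -/(Z f) mulrC divfK.
Qed.

(** Drawing [f] from the bin law and then [v] from [K f] reproduces [w]; replacing the bin law by
    the uniform one costs at most [G] times their l1 distance. *)
Lemma bin_kernel_avg (R : realType) (V F : finType) (w : V -> R) (phi : V -> F)
    (K : F -> V -> R) (h : F -> V -> R) (G : R) : is_pmf w -> (forall f, is_pmf (K f)) ->
  (forall f v, (\sum_(u | phi u == f) w u) * K f v = w v * (phi v == f)%:R) ->
  (forall f v, 0 <= h f v <= G) ->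
  \sum_f #|F|%:R^-1 * (\sum_v K f v * h f v) <=
  \sum_v w v * h (phi v) v + G * \sum_f `|\sum_(u | phi u == f) w u - #|F|%:R^-1|.
Proof.
move=> hw hK wK hG; pose Z f := \sum_(u | phi u == f) w u.
have -> : \sum_v w v * h (phi v) v = \sum_f Z f * \sum_v K f v * h f v.
  rewrite (eq_bigr (fun v => \sum_f w v * (phi v == f)%:R * h f v)); last first.
    move=> v _; rewrite (bigD1 (phi v)) //= eqxx mulr1 big1 ?addr0 // => f.
    by rewrite eq_sym => /negPf ->; rewrite mulr0 mul0r.
  rewrite exchange_big; apply: eq_bigr => f _ /=; rewrite mulr_sumr.
  by apply: eq_bigr => v _; rewrite mulrA wK.
rewrite mulr_sumr -big_split; apply: ler_sum => f _ /=.
set c := \sum_v _; rewrite -/(Z f).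
have [K0 K1] := hK f.
have c0 : 0 <= c.
  by apply: sumr_ge0 => v _; rewrite mulr_ge0 //; have /andP[] := hG f v.
have cG : c <= G.
  by apply: pmf_avg_le (hK f) _ => v; have /andP[] := hG f v.
rewrite -lerBlDl -mulrBl mulrC.
apply: le_trans (_ : c * `|Z f - #|F|%:R^-1| <= _); last by rewrite ler_wpM2r.
by rewrite ler_wpM2l // distrC ler_norm.
Qed.

(* The first hash of [V1] has three parts: [F1] plays common randomness that is
   fixed at the end, [M1] is the first message, [M1'] is forwarded by the second
   encoder; likewise [F2] and [M2] for [V2]. The encoders sample from the
   conditional laws given the common randomness, which is close to uniform by
   the leftover hash lemma. *)
Section OneShot.
Variables (R : realType) (S X1 X2 Y V1 V2 F1 M1 M1' F2 M2 : finType).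
Variables (p : S -> R) (x1 : S -> X1) (x2 : S -> X2) (y : S -> Y).
Variables (w1 : X1 -> V1 -> R) (w2 : V1 * X2 -> V2 -> R).
Hypothesis p0 : forall s, 0 <= p s.
Hypotheses (hw1 : forall x, is_pmf (w1 x)) (hw2 : forall vx, is_pmf (w2 vx)).
Variables (loss : Y -> V1 -> V2 -> R) (L : R).
Hypothesis hloss : forall t v1 v2, 0 <= loss t v1 v2 <= L.
Hypothesis L0 : 0 <= L.
Hypotheses (F10 : (0 < #|F1|)%N) (F20 : (0 < #|F2|)%N).
Variables (t1 : {ffun V1 -> F1 * M1 * M1'}) (t2 : {ffun V1 * V2 -> F2 * M2}).
Variables (dec1 : F1 * M1 -> X2 -> V1) (decD : F1 * M1 * M1' -> V1) (dec2 : V1 -> F2 * M2 -> V2).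

Definition err1 (s : S) := \sum_v w1 (x1 s) v * (dec1 (t1 v).1 (x2 s) != v)%:R.
Definition errD (s : S) := \sum_v w1 (x1 s) v * (decD (t1 v) != v)%:R.
Definition err2 (s : S) := \sum_v w1 (x1 s) v *
  \sum_u w2 (v, x2 s) u * (dec2 v (t2 (v, u)) != u)%:R.
Definition hash_dist1 (s : S) := \sum_f `|\sum_(v | (t1 v).1.1 == f) w1 (x1 s) v - #|F1|%:R^-1|.
Definition hash_dist2 (s : S) := \sum_v w1 (x1 s) v *
  \sum_f `|\sum_(u | (t2 (v, u)).1 == f) w2 (v, x2 s) u - #|F2|%:R^-1|.
Definition ideal_loss (s : S) := \sum_v w1 (x1 s) v * \sum_u w2 (v, x2 s) u * loss (y s) v u.

Lemma one_shot_code : exists (f : X1 -> M1) (g : X2 * M1 -> M1' * M2) (D : M1 * (M1' * M2) -> V1 * V2),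
  \sum_s p s * (let m := f (x1 s) in let v := D (m, g (x2 s, m)) in loss (y s) v.1 v.2) <=
  \sum_s p s * (ideal_loss s + L * (err1 s + errD s + err2 s) + (L *+ 2) * (hash_dist1 s + hash_dist2 s)).
Proof.
have /choice[K1 hK1] x := bin_kernel (fun v => (t1 v).1.1) (hw1 x).
have /choice[K2 hK2] vx := bin_kernel (fun u => (t2 (vx.1, u)).1) (hw2 vx).
pose D f1 f2 m m' m2 := let v := decD ((f1, m), m') in (v, dec2 v (f2, m2)).
pose m1 v := (t1 v).1.2; pose m1' v := (t1 v).2; pose m2 v u := (t2 (v, u)).2.
(* The true cost: the second encoder works with its estimate [v'] of the first auxiliary. *)
pose cost f1 f2 m s u := let v' := dec1 (f1, m) (x2 s) in
  let d := D f1 f2 m (m1' v') (m2 v' u) in loss (y s) d.1 d.2.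
pose B f1 f2 s := \sum_v K1 (x1 s) f1 v *
  \sum_u K2 (dec1 (f1, m1 v) (x2 s), x2 s) f2 u * cost f1 f2 (m1 v) s u.
(* A proxy in which the second encoder knows [v] and a wrong estimate is charged [L], the largest
   possible loss. It lies between 0 and 2L, hence the [L *+ 2] before the hash distances. *)
pose g s f1 f2 v u := let d := D f1 f2 (m1 v) (m1' v) (m2 v u) in
  loss (y s) d.1 d.2 + L * (dec1 (f1, m1 v) (x2 s) != v)%:R.
have gG s f1 f2 v u : 0 <= g s f1 f2 v u <= L *+ 2.
  have /andP[l0 lL] := hloss (y s) (decD (f1, m1 v, m1' v)) (dec2 (decD (f1, m1 v, m1' v)) (f2, m2 v u)).
  rewrite /g /=; case: (_ != _); rewrite ?mulr1 ?mulr0 mulr2n; lra.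
have Bg f1 f2 s : B f1 f2 s <= \sum_v K1 (x1 s) f1 v * \sum_u K2 (v, x2 s) f2 u * g s f1 f2 v u.
  apply: ler_sum => v _; rewrite ler_wpM2l //; first by have [/(_ f1)[k0 _] _] := hK1 (x1 s); exact: k0.
  rewrite /cost /g; case: eqVneq => [->|ne].
    by apply: ler_sum => u _; rewrite mulr0 addr0.
  apply: le_trans (_ : L <= _).
    apply: pmf_avg_le => [|u]; first exact: (hK2 (dec1 (f1, m1 v) (x2 s), x2 s)).1.
    by have /andP[] := hloss (y s) (D f1 f2 (m1 v) (m1' (dec1 (f1, m1 v) (x2 s))) (m2 (dec1 (f1, m1 v) (x2 s)) u)).1 (D f1 f2 (m1 v) (m1' (dec1 (f1, m1 v) (x2 s))) (m2 (dec1 (f1, m1 v) (x2 s)) u)).2.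
  apply: pmf_avg_ge => [|u]; first exact: (hK2 (v, x2 s)).1.
  by rewrite /= mulr1 lerDr; have /andP[] := hloss (y s) (decD (f1, m1 v, m1' v)) (dec2 (decD (f1, m1 v, m1' v)) (f2, m2 v u)).
have avg s : \sum_f1 #|F1|%:R^-1 * (\sum_v K1 (x1 s) f1 v *
     \sum_f2 #|F2|%:R^-1 * (\sum_u K2 (v, x2 s) f2 u * g s f1 f2 v u)) <=
   ideal_loss s + L * (err1 s + errD s + err2 s) + (L *+ 2) * (hash_dist1 s + hash_dist2 s).
  pose h f1 v := \sum_f2 #|F2|%:R^-1 * (\sum_u K2 (v, x2 s) f2 u * g s f1 f2 v u).
  have F2u : is_pmf (fun _ : F2 => #|F2|%:R^-1 : R).
    split=> [f|]; first by rewrite invr_ge0 ler0n.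
    by rewrite big_const iter_addr_0 -[LHS]mulr_natl divff // pnatr_eq0 -lt0n.
  have hh f1 v : 0 <= h f1 v <= L *+ 2.
    have inner f2 : 0 <= \sum_u K2 (v, x2 s) f2 u * g s f1 f2 v u <= L *+ 2.
      have hk := (hK2 (v, x2 s)).1 f2; apply/andP; split.
        by apply: (pmf_avg_ge hk) => u; have /andP[] := gG s f1 f2 v u.
      by apply: (pmf_avg_le hk) => u; have /andP[] := gG s f1 f2 v u.
    apply/andP; split.
      by apply: (pmf_avg_ge F2u) => f2; have /andP[] := inner f2.
    by apply: (pmf_avg_le F2u) => f2; have /andP[] := inner f2.
  apply: le_trans (bin_kernel_avg (hw1 (x1 s)) (hK1 (x1 s)).1 (hK1 (x1 s)).2 hh) _.
  suff : \sum_v w1 (x1 s) v * h (t1 v).1.1 v <=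
      ideal_loss s + L * (err1 s + errD s + err2 s) + (L *+ 2) * hash_dist2 s.
    by rewrite -/(hash_dist1 s) [(L *+ 2) * (_ + _)]mulrDr; lra.
  apply: le_trans (_ : \sum_v w1 (x1 s) v * (\sum_u w2 (v, x2 s) u * g s (t1 v).1.1 (t2 (v, u)).1 v u
     + (L *+ 2) * \sum_f `|\sum_(u | (t2 (v, u)).1 == f) w2 (v, x2 s) u - #|F2|%:R^-1|) <= _).
    apply: ler_sum => v _; rewrite ler_wpM2l //; first by have [] := hw1 (x1 s).
    apply: (bin_kernel_avg (hw2 (v, x2 s)) (hK2 (v, x2 s)).1 (hK2 (v, x2 s)).2) => f2 u.
    exact: gG.
  under eq_bigr do rewrite mulrDr; rewrite big_split /=; apply: lerD; last first.
    by rewrite /hash_dist2 mulr_sumr; apply: ler_sum => v _; rewrite mulrCA.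
  have e1 : err1 s = \sum_v w1 (x1 s) v * \sum_u w2 (v, x2 s) u * (dec1 (t1 v).1 (x2 s) != v)%:R.
    by apply: eq_bigr => v _; rewrite -mulr_suml; have [_ ->] := hw2 (v, x2 s); rewrite mul1r.
  have eD : errD s = \sum_v w1 (x1 s) v * \sum_u w2 (v, x2 s) u * (decD (t1 v) != v)%:R.
    by apply: eq_bigr => v _; rewrite -mulr_suml; have [_ ->] := hw2 (v, x2 s); rewrite mul1r.
  rewrite e1 eD /err2 /ideal_loss -!big_split mulr_sumr -big_split; apply: ler_sum => v _ /=.
  rewrite -!mulrDr mulrCA -mulrDr ler_wpM2l //; first by have [] := hw1 (x1 s).
  rewrite -!big_split mulr_sumr -big_split; apply: ler_sum => u _ /=.
  rewrite -!mulrDr mulrCA -mulrDr ler_wpM2l //; first by have [] := hw2 (v, x2 s).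
  have -> : g s (t1 v).1.1 (t2 (v, u)).1 v u =
      loss (y s) (decD (t1 v)) (dec2 (decD (t1 v)) (t2 (v, u))) + L * (dec1 (t1 v).1 (x2 s) != v)%:R.
    by rewrite /g /D /m1 /m1' /m2 /= -!surjective_pairing.
  have /andP[l0 lL] := hloss (y s) (decD (t1 v)) (dec2 (decD (t1 v)) (t2 (v, u))).
  have /andP[l0' lL'] := hloss (y s) v u.
  rewrite -addrA mulrDr [X in _ <= _ + X]addrC addrA.
  have [eq1|ne1] := eqVneq (decD (t1 v)) v; last first.
    have : 0 <= L * (dec2 v (t2 (v, u)) != u)%:R by rewrite mulr_ge0 // ler0n.
    rewrite mulrDr mulr1; lra.
  rewrite eq1; have [->|ne2] := eqVneq (dec2 v (t2 (v, u))) u; first by rewrite mulrDr !mulr0; lra.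
  rewrite eq1 in lL; rewrite mulrDr mulr0 mulr1; lra.
(* The common randomness is uniform, so some fixed pair (f1, f2) does at least as well as the
   average. *)
pose wF (_ : F1 * F2) : R := #|F1|%:R^-1 * #|F2|%:R^-1.
have hwF : is_pmf wF.
  split=> [f|]; first by rewrite /wF mulr_ge0 ?invr_ge0 ?ler0n.
  rewrite big_const iter_addr_0 card_prod -[LHS]mulr_natl natrM /wF mulrACA !divff ?mulr1 //;
    by rewrite pnatr_eq0 -lt0n.
have [[f1 f2] /= hf] : exists f, \sum_s p s * B f.1 f.2 s <=
  \sum_s p s * (ideal_loss s + L * (err1 s + errD s + err2 s) + (L *+ 2) * (hash_dist1 s + hash_dist2 s)).
  apply: (exists_le_avg hwF).
  rewrite -(pair_bigA _ (fun f1 f2 => wF (f1, f2) * \sum_s p s * B f1 f2 s)) /=.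
  apply: le_trans (_ : \sum_s p s * (\sum_f1 #|F1|%:R^-1 * (\sum_v K1 (x1 s) f1 v *
     \sum_f2 #|F2|%:R^-1 * (\sum_u K2 (v, x2 s) f2 u * g s f1 f2 v u))) <= _); last first.
    by apply: ler_sum => s _; rewrite ler_wpM2l.
  apply: le_trans (_ : \sum_s \sum_f1 \sum_f2 wF (f1, f2) * (p s * B f1 f2 s) <= _).
    rewrite [leRHS]exchange_big; apply: ler_sum => f1 _ /=.
    rewrite [leRHS]exchange_big; apply: ler_sum => f2 _ /=.
    by rewrite mulr_sumr.
  apply: ler_sum => s _; rewrite mulr_sumr; apply: ler_sum => f1 _.
  apply: le_trans (_ : \sum_f2 wF (f1, f2) * (p s *
      \sum_v K1 (x1 s) f1 v * \sum_u K2 (v, x2 s) f2 u * g s f1 f2 v u) <= _).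
    apply: ler_sum => f2 _; rewrite ler_wpM2l //; first by have [h _] := hwF; exact: h.
    by rewrite ler_wpM2l.
  rewrite le_eqVlt; apply/orP; left; apply/eqP.
  rewrite [in RHS](eq_bigr (fun v => \sum_f2 K1 (x1 s) f1 v * (#|F2|%:R^-1 *
     (\sum_u K2 (v, x2 s) f2 u * g s f1 f2 v u)))); last by move=> v _; rewrite mulr_sumr.
  rewrite exchange_big !mulr_sumr; apply: eq_bigr => f2 _ /=.
  rewrite /wF !mulr_sumr; apply: eq_bigr => v _; ring.
(* The first encoder is made deterministic while the second is still random; the second then follows
   for the fixed [f]. *)
have [k1 hk1] := derandomise p x1 (fun s v =>
   \sum_u K2 (dec1 (f1, m1 v) (x2 s), x2 s) f2 u * cost f1 f2 (m1 v) s u) (fun x => (hK1 x).1 f1).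
pose f x := m1 (k1 x).
have [k2 hk2] := derandomise p (fun s => (x2 s, f (x1 s))) (fun s u => cost f1 f2 (f (x1 s)) s u)
   (fun xm : X2 * M1 => (hK2 (dec1 (f1, xm.2) xm.1, xm.1)).1 f2).
pose g' (xm : X2 * M1) := let v' := dec1 (f1, xm.2) xm.1 in (m1' v', m2 v' (k2 xm)).
exists f, g', (fun d => D f1 f2 d.1 d.2.1 d.2.2).
apply: le_trans hf; apply: le_trans hk1; exact: hk2.
Qed.

End OneShot.

Lemma balanced_id (R : realType) (H : finType) (c : H) :
  (\sum_(h | id h == c) 1) / #|H|%:R = #|H|%:R^-1 :> R.
Proof. by rewrite big_pred1_eq mul1r. Qed.

Lemma sum_pred_fst (R : realType) (A B : finType) (Q : pred A) :
  \sum_(h : A * B | Q h.1) 1 = #|B|%:R * \sum_(a | Q a) 1 :> R.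
Proof.
transitivity (\sum_(a | Q a) \sum_(b : B) (1 : R)); last first.
  by rewrite mulr_sumr; apply: eq_bigr => a _; rewrite big_const iter_addr_0 mulr1.
by rewrite pair_big; apply: eq_bigl => h; rewrite andbT.
Qed.

Lemma balanced_fst (R : realType) (A B : finType) (a : A) : (0 < #|B|)%N ->
  (\sum_(h : A * B | h.1 == a) 1) / #|{: A * B}|%:R = #|A|%:R^-1 :> R.
Proof.
move=> B0; rewrite (sum_pred_fst R B (pred1 a)) big_pred1_eq mulr1 card_prod natrM.
by rewrite invfM mulrCA divff ?mulr1 // pnatr_eq0 -lt0n.
Qed.

Lemma balanced_fst_fst (R : realType) (A B C : finType) (a : A) : (0 < #|B|)%N -> (0 < #|C|)%N ->
  (\sum_(h : A * B * C | h.1.1 == a) 1) / #|{: A * B * C}|%:R = #|A|%:R^-1 :> R.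
Proof.
move=> B0 C0; rewrite (sum_pred_fst R C (fun ab : A * B => ab.1 == a)).
rewrite (sum_pred_fst R B (pred1 a)) big_pred1_eq mulr1 !card_prod !natrM.
have b0 : #|B|%:R != 0 :> R by rewrite pnatr_eq0 -lt0n.
have c0 : #|C|%:R != 0 :> R by rewrite pnatr_eq0 -lt0n.
have [->|a0] := eqVneq (#|A|%:R : R) 0; first by rewrite !mul0r !invr0 mulr0.
by field; rewrite a0 b0 c0.
Qed.

Lemma sum_pair_at (R : realType) (A B : finType) (a : A) (Q : pred (A * B)) (f : B -> R) :
  \sum_(z | Q z) (if z.1 == a then f z.2 else 0) = \sum_(b | Q (a, b)) f b.
Proof.
transitivity (\sum_x \sum_y if Q (x, y) then if x == a then f y else 0 else 0).
  by rewrite pair_bigA big_mkcond; apply: eq_bigr => -[].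
rewrite (bigD1 a) //= [X in _ + X]big1 ?addr0 => [|x /negPf xa].
  by rewrite [RHS]big_mkcond; apply: eq_bigr => b _; rewrite eqxx.
by rewrite big1 // => b _; rewrite xa if_same.
Qed.

Lemma card_ge_threshold (R : realType) (V : finType) (c : V -> R) (tau : R) : 0 < tau ->
  (forall v, 0 <= c v) -> \sum_v c v <= 1 -> #|[set v | tau <= c v]|%:R <= tau^-1.
Proof.
move=> t0 c0 c1; rewrite -(ler_pM2r t0) mulVf ?gt_eqF //; apply: le_trans c1.
rewrite mulr_natl -sumr_const [leRHS](bigID (fun v => v \in [set v | tau <= c v])) /=.
apply: le_trans (_ : \sum_(v in [set v | tau <= c v]) c v <= _).
  by apply: ler_sum => v; rewrite inE.
by rewrite lerDl sumr_ge0.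
Qed.

(** * Hashes that meet all error bounds at once *)

Section ChooseHashes.
Variables (R : realType) (S X1 X2 Y V1 V2 F1 M1 M1' F2 M2 : finType).
Variables (p : S -> R) (x1 : S -> X1) (x2 : S -> X2) (y : S -> Y).
Variables (w1 : X1 -> V1 -> R) (w2 : V1 * X2 -> V2 -> R).
Hypothesis hp : is_pmf p.
Hypotheses (hw1 : forall x, is_pmf (w1 x)) (hw2 : forall vx, is_pmf (w2 vx)).
Variables (loss : Y -> V1 -> V2 -> R) (L : R).
Hypothesis hloss : forall t v1 v2, 0 <= loss t v1 v2 <= L.
Hypothesis L0 : 0 <= L.
Hypotheses (F10 : (0 < #|F1|)%N) (F20 : (0 < #|F2|)%N) (M10 : (0 < #|M1|)%N)
  (M10' : (0 < #|M1'|)%N) (M20 : (0 < #|M2|)%N).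
Variables (v0 : V1) (u0 : V2).
(** Sub-pmfs used as scores: the typical sets are the sets where the score is at least [tau], and a
    total of at most 1 bounds their size by 1/tau. *)
Variables (c1 : X2 -> V1 -> R) (c2 : V1 -> R) (c3 : V1 -> V2 -> R).
Hypotheses (c1_ge0 : forall x v, 0 <= c1 x v) (c2_ge0 : forall v, 0 <= c2 v)
  (c3_ge0 : forall v u, 0 <= c3 v u).
Hypotheses (c1_le1 : forall x, \sum_v c1 x v <= 1) (c2_le1 : \sum_v c2 v <= 1)
  (c3_le1 : forall v, \sum_u c3 v u <= 1).
Variables (tau1 tau2 tau3 sigma1 sigma2 e : R).
Hypotheses (tau1_gt0 : 0 < tau1) (tau2_gt0 : 0 < tau2) (tau3_gt0 : 0 < tau3)
  (sigma1_ge0 : 0 <= sigma1) (sigma2_ge0 : 0 <= sigma2) (e0 : 0 < e).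

(** Probabilities in the experiment that the code imitates, where the auxiliaries are drawn directly
    from [w1] and [w2]. *)
Definition ideal_pr (E : S -> V1 -> V2 -> bool) : R :=
  \sum_s p s * \sum_v w1 (x1 s) v * \sum_u w2 (v, x2 s) u * (E s v u)%:R.

Lemma ideal_pr_V1 (E : S -> V1 -> bool) :
  ideal_pr (fun s v _ => E s v) = \sum_s p s * \sum_v w1 (x1 s) v * (E s v)%:R.
Proof.
apply: eq_bigr => s _; congr (_ * _); apply: eq_bigr => v _; congr (_ * _).
exact: pmf_avg_const.
Qed.

Hypothesis h1 : ideal_pr (fun s v _ => c1 (x2 s) v < tau1) <= e.
Hypothesis h2 : ideal_pr (fun _ v _ => c2 v < tau2) <= e.
Hypothesis h3 : ideal_pr (fun _ v u => c3 v u < tau3) <= e.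
Hypothesis k1 : 1 <= e * (tau1 * (#|F1| * #|M1|)%:R).
Hypothesis k2 : 1 <= e * (tau2 * (#|F1| * #|M1| * #|M1'|)%:R).
Hypothesis k3 : 1 <= e * (tau3 * (#|F2| * #|M2|)%:R).
(** Either there is no common randomness and the hash distance is 0, or the leftover hash lemma
    applies with truncation at [sigma1] and [eta = e]; then [e ^+ 2] makes its last term at most
    [e / 2]. *)
Hypothesis l1 : #|F1| = 1%N \/ (ideal_pr (fun s v _ => sigma1 < w1 (x1 s) v) <= e /\
  sigma1 * #|F1|%:R <= e ^+ 2).
Hypothesis l2 : #|F2| = 1%N \/ (ideal_pr (fun s v u => sigma2 < w2 (v, x2 s) u) <= e /\
  sigma2 * #|F2|%:R <= e ^+ 2).

Let H1 : (0 < #|{: F1 * M1 * M1'}|)%N. Proof. by rewrite !card_prod !muln_gt0 F10 M10. Qed.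
Let H2 : (0 < #|{: F2 * M2}|)%N. Proof. by rewrite card_prod muln_gt0 F20. Qed.

Let dec1 (t : {ffun V1 -> F1 * M1 * M1'}) (fm : F1 * M1) (x : X2) : V1 :=
  bin_decode fst t v0 [set v | tau1 <= c1 x v] fm.
Let decD (t : {ffun V1 -> F1 * M1 * M1'}) (h : F1 * M1 * M1') : V1 :=
  bin_decode id t v0 [set v | tau2 <= c2 v] h.
(** The hash acts on pairs, and only the slice over the known [v] is searched, so the number of
    candidates is that of typical [u] given [v]. *)
Let dec2 (t : {ffun V1 * V2 -> F2 * M2}) (v : V1) (h : F2 * M2) : V2 :=
  (bin_decode id t (v0, u0) [set vu | (vu.1 == v) && (tau3 <= c3 vu.1 vu.2)] h).2.

Let hash_avg_ideal (Z H : finType) (f : {ffun Z -> H} -> S -> V1 -> R) (g : S -> V1 -> R) :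
  (forall s v, hash_avg (fun t => f t s v) <= g s v) ->
  hash_avg (fun t => \sum_s p s * \sum_v w1 (x1 s) v * f t s v) <=
  \sum_s p s * \sum_v w1 (x1 s) v * g s v.
Proof.
move=> fg; rewrite hash_avg_sum; apply: ler_sum => s _; rewrite hash_avgZ ler_wpM2l //; first by case: hp.
by rewrite hash_avg_sum; apply: ler_sum => v _; rewrite hash_avgZ ler_wpM2l //; case: (hw1 (x1 s)).
Qed.

Let avg_affine (c : R) (f : S -> V1 -> R) : \sum_s p s * \sum_v w1 (x1 s) v * (c * f s v + e) =
  c * (\sum_s p s * \sum_v w1 (x1 s) v * f s v) + e.
Proof.
rewrite -[X in _ = _ + X](pmf_avg_const e hp) mulr_sumr -big_split; apply: eq_bigr => s _ /=.
rewrite mulrCA -mulrDr; congr (_ * _).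
rewrite -[X in _ = _ + X](pmf_avg_const e (hw1 (x1 s))) mulr_sumr -big_split.
by apply: eq_bigr => v _ /=; rewrite mulrCA -mulrDr.
Qed.

Let err1_avg : hash_avg (fun t => \sum_s p s * err1 x1 x2 w1 t (dec1 t) s) <= 2 * e.
Proof.
apply: le_trans (@hash_avg_ideal _ _ _ (fun s v => 1 * (c1 (x2 s) v < tau1)%R%:R + e) _) _ => [s v|].
  apply: le_trans (bin_decode_error H1 (fun c => @balanced_fst R _ _ c M10') _ _ _) _.
  rewrite mul1r inE -ltNge lerD2l card_prod ler_pdivrMr ?ltr0n ?muln_gt0 ?F10 //.
  apply: le_trans (card_ge_threshold tau1_gt0 (c1_ge0 _) (c1_le1 _)) _.
  by rewrite -(ler_pM2l tau1_gt0) mulfV ?gt_eqF // mulrCA.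
by rewrite avg_affine -ideal_pr_V1; have := h1; lra.
Qed.

Let errD_avg : hash_avg (fun t => \sum_s p s * errD x1 w1 t (decD t) s) <= 2 * e.
Proof.
apply: le_trans (@hash_avg_ideal _ _ _ (fun s v => 1 * (c2 v < tau2)%R%:R + e) _) _ => [s v|].
  apply: le_trans (bin_decode_error H1 (@balanced_id R _) _ _ _) _.
  rewrite mul1r inE -ltNge lerD2l !card_prod ler_pdivrMr ?ltr0n ?muln_gt0 ?F10 ?M10 //.
  apply: le_trans (card_ge_threshold tau2_gt0 c2_ge0 c2_le1) _.
  by rewrite -(ler_pM2l tau2_gt0) mulfV ?gt_eqF // mulrCA.
by rewrite avg_affine -(ideal_pr_V1 (fun _ v => c2 v < tau2)); have := h2; lra.
Qed.

Let err2_avg : hash_avg (fun t => \sum_s p s * err2 x1 x2 w1 w2 t (dec2 t) s) <= 2 * e.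
Proof.
apply: le_trans (@hash_avg_ideal _ _ _
  (fun s v => 1 * (\sum_u w2 (v, x2 s) u * (c3 v u < tau3)%R%:R) + e) _) _ => [s v|]; last first.
  by rewrite avg_affine; have := h3; rewrite /ideal_pr; lra.
rewrite mul1r -[X in _ <= _ + X](pmf_avg_const e (hw2 (v, x2 s))) -big_split /=.
rewrite hash_avg_sum; apply: ler_sum => u _; rewrite hash_avgZ -mulrDr ler_wpM2l //.
  by case: (hw2 (v, x2 s)).
pose A := [set vu : V1 * V2 | (vu.1 == v) && (tau3 <= c3 vu.1 vu.2)].
apply: le_trans (_ : hash_avg (fun t : {ffun V1 * V2 -> F2 * M2} =>
   (bin_decode id t (v0, u0) A (t (v, u)) != (v, u))%:R) <= _).
  apply: hash_avg_le => t; rewrite ler_nat /dec2 -/A.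
  by case: (bin_decode _ _ _ _ _) => a b; rewrite xpair_eqE /=; case: (b == u); rewrite ?andbF // leq0n.
apply: le_trans (bin_decode_error H2 (@balanced_id R _) _ _ _) _.
rewrite inE /= eqxx /= -ltNge lerD2l !card_prod ler_pdivrMr ?ltr0n ?muln_gt0 ?F20 //.
have -> : #|A| = #|[set u | tau3 <= c3 v u]|.
  have inj : injective (@pair V1 V2 v) by move=> a b [].
  rewrite -(card_imset _ inj); apply: eq_card => -[a b].
  rewrite !inE /=; apply/andP/imsetP => [[/eqP -> h]|[c]]; first by exists b; rewrite ?inE.
  by rewrite inE => h [-> ->]; rewrite eqxx.
apply: le_trans (card_ge_threshold tau3_gt0 (c3_ge0 v) (c3_le1 v)) _.
by rewrite -(ler_pM2l tau3_gt0) mulfV ?gt_eqF // mulrCA.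
Qed.

Let hash_dist_single (Z C : finType) (phi : Z -> C) (w : Z -> R) :
  is_pmf w -> #|C| = 1%N -> \sum_c `|\sum_(z | phi z == c) w z - #|C|%:R^-1| = 0.
Proof.
move=> [_ w_sum] C1; apply: big1 => c _.
have /fintype_le1P C_le1 : (#|C| <= 1)%N by rewrite C1.
rewrite C1 invr1 (eq_bigl predT) ?w_sum ?subrr ?normr0 // => z.
by rewrite (C_le1 c (phi z)) eqxx.
Qed.

Let hash_dist1_avg : hash_avg (fun t : {ffun V1 -> F1 * M1 * M1'} =>
  \sum_s p s * hash_dist1 x1 w1 t s) <= 3 * e.
Proof.
case: l1 => [F11|[q1 q2]].
  rewrite (@hash_avg_eq _ _ _ _ (fun=> 0)) ?hash_avg_const ?mulr_ge0 ?(ltW e0) // => t.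
  rewrite big1 // => s _; rewrite /hash_dist1 (@hash_dist_single _ _ (fun v => (t v).1.1)) ?mulr0 //.
rewrite hash_avg_sum.
apply: le_trans (_ : \sum_s p s * (2 * (\sum_v w1 (x1 s) v * (sigma1 < w1 (x1 s) v)%R%:R) + e) <= _).
  apply: ler_sum => s _; rewrite hash_avgZ ler_wpM2l //; first by case: hp.
  apply: le_trans (leftover_hash H1 (fun c => balanced_fst_fst R c M10 M10') (hw1 (x1 s)) e0 sigma1_ge0) _.
  rewrite -addrA; apply: lerD.
    rewrite ler_pM2l // big_mkcond; apply: ler_sum => v _; case: (_ < _); rewrite ?mulr1 ?mulr0 //.
  have : sigma1 * #|F1|%:R / (2 * e) <= e / 2.
    by rewrite ler_pdivrMr ?mulr_gt0 // (le_trans q2) // expr2; lra.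
  lra.
under eq_bigr => s _ do rewrite mulrDr mulrCA.
rewrite big_split /= -mulr_sumr pmf_avg_const //.
have := q1; rewrite (ideal_pr_V1 (fun s v => sigma1 < w1 (x1 s) v)); lra.
Qed.

Let hash_dist2_avg : hash_avg (fun t : {ffun V1 * V2 -> F2 * M2} =>
  \sum_s p s * hash_dist2 x1 x2 w1 w2 t s) <= 3 * e.
Proof.
case: l2 => [F21|[q1 q2]].
  rewrite (@hash_avg_eq _ _ _ _ (fun=> 0)) ?hash_avg_const ?mulr_ge0 ?(ltW e0) // => t.
  rewrite big1 // => s _; rewrite /hash_dist2 big1 ?mulr0 // => v _.
  by rewrite (@hash_dist_single _ _ (fun u => (t (v, u)).1)) ?mulr0 //.
apply: le_trans (@hash_avg_ideal _ _ _
  (fun s v => 2 * (\sum_u w2 (v, x2 s) u * (sigma2 < w2 (v, x2 s) u)%R%:R) + e) _) _ => [s v|]; last first.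
  by rewrite avg_affine; have := q1; rewrite /ideal_pr; lra.
pose w (z : V1 * V2) := if z.1 == v then w2 (v, x2 s) z.2 else 0.
have hw : is_pmf w.
  have [w0 w1'] := hw2 (v, x2 s); split=> [z|]; first by rewrite /w; case: ifP.
  by rewrite (sum_pair_at v predT).
rewrite (@hash_avg_eq _ _ _ _ (fun t : {ffun V1 * V2 -> F2 * M2} =>
   \sum_f `|\sum_(z | (t z).1 == f) w z - #|F2|%:R^-1|)); last first.
  by move=> t; apply: eq_bigr => f _; rewrite (sum_pair_at v (fun z => (t z).1 == f)).
apply: le_trans (leftover_hash H2 (fun c => balanced_fst R c M20) hw e0 sigma2_ge0) _.
rewrite -addrA; apply: lerD.
  rewrite ler_pM2l //.
  apply: le_trans (_ : \sum_(z | true) (if z.1 == v then w2 (v, x2 s) z.2 * (sigma2 < w2 (v, x2 s) z.2)%R%:R else 0) <= _); last first.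
    by rewrite (sum_pair_at v predT (fun u => w2 (v, x2 s) u * (sigma2 < w2 (v, x2 s) u)%R%:R)).
  rewrite big_mkcond; apply: ler_sum => z _; rewrite /w.
  by case: eqP => _; [case: (_ < _); rewrite ?mulr1 ?mulr0 | rewrite if_same].
have : sigma2 * #|F2|%:R / (2 * e) <= e / 2.
  by rewrite ler_pdivrMr ?mulr_gt0 // (le_trans q2) // expr2; lra.
lra.
Qed.

(** 18 = (2 + 2 + 2 * 3) + (2 + 2 * 3): on average each decoding error is at most 2e and each hash
    distance at most 3e, the latter counted twice. The two brackets belong to the choices of [t1]
    and [t2]. *)
Lemma one_shot : exists (f : X1 -> M1) (g : X2 * M1 -> M1' * M2) (D : M1 * (M1' * M2) -> V1 * V2),
  \sum_s p s * (let m := f (x1 s) in let v := D (m, g (x2 s, m)) in loss (y s) v.1 v.2) <=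
  \sum_s p s * ideal_loss x1 x2 y w1 w2 loss s + 18 * L * e.
Proof.
have [t1 ht1] : exists t1, \sum_s p s * err1 x1 x2 w1 t1 (dec1 t1) s + \sum_s p s * errD x1 w1 t1 (decD t1) s
    + 2 * \sum_s p s * hash_dist1 x1 w1 t1 s <= 10 * e.
  apply: (hash_avg_exists H1); rewrite !hash_avgD hash_avgZ.
  by have := err1_avg; have := errD_avg; have := hash_dist1_avg; lra.
have [t2 ht2] : exists t2, \sum_s p s * err2 x1 x2 w1 w2 t2 (dec2 t2) s
    + 2 * \sum_s p s * hash_dist2 x1 x2 w1 w2 t2 s <= 8 * e.
  apply: (hash_avg_exists H2); rewrite !hash_avgD hash_avgZ.
  by have := err2_avg; have := hash_dist2_avg; lra.
have p0 s : 0 <= p s by case: hp.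
have [f [g [D hD]]] := one_shot_code x1 x2 y p0 hw1 hw2 hloss L0 F10 F20 t1 t2 (dec1 t1) (decD t1) (dec2 t2).
exists f, g, D; apply: le_trans hD _.
have -> : \sum_s p s * (ideal_loss x1 x2 y w1 w2 loss s + L * (err1 x1 x2 w1 t1 (dec1 t1) s +
    errD x1 w1 t1 (decD t1) s + err2 x1 x2 w1 w2 t2 (dec2 t2) s) +
    (L *+ 2) * (hash_dist1 x1 w1 t1 s + hash_dist2 x1 x2 w1 w2 t2 s)) =
  \sum_s p s * ideal_loss x1 x2 y w1 w2 loss s + L * (
    (\sum_s p s * err1 x1 x2 w1 t1 (dec1 t1) s + \sum_s p s * errD x1 w1 t1 (decD t1) s
    + 2 * \sum_s p s * hash_dist1 x1 w1 t1 s) +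
    (\sum_s p s * err2 x1 x2 w1 w2 t2 (dec2 t2) s + 2 * \sum_s p s * hash_dist2 x1 x2 w1 w2 t2 s)).
  rewrite !mulrDr !mulr_sumr -!big_split; apply: eq_bigr => s _ /=.
  rewrite -mulr_natl; ring.
rewrite lerD2l -mulrA mulrCA ler_wpM2l //; lra.
Qed.

End ChooseHashes.

(** * Typicality *)

Section IID.
Variables (R : realType) (W : finType) (q : W -> R).
Hypothesis hq : is_pmf q.

Lemma sum_ord_fcons n (z : W -> R) s (w : {ffun 'I_n -> W}) :
  \sum_i z (fcons s w i) = z s + \sum_i z (w i).
Proof. by rewrite big_ord_recl fcons0; congr (_ + _); apply: eq_bigr => i _; rewrite fconsS. Qed.

Lemma iid_mean n (z : W -> R) :
  \sum_w iid q w * \sum_(i < n) z (w i) = n%:R * \sum_s q s * z s.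
Proof.
elim: n => [|n IH].
  by rewrite mul0r big1 // => w _; rewrite big_ord0 mulr0.
rewrite sum_fcons -natr1 mulrDl mul1r -IH.
transitivity (\sum_s \sum_(w : {ffun 'I_n -> W}) (q s * (iid q w * z s) + q s * (iid q w * \sum_i z (w i)))).
  apply: eq_bigr => s _; apply: eq_bigr => w _; rewrite iid_fcons sum_ord_fcons; ring.
transitivity (\sum_s (q s * z s + q s * \sum_(w : {ffun 'I_n -> W}) iid q w * \sum_i z (w i))).
  apply: eq_bigr => s _; rewrite big_split /= -!mulr_sumr pmf_avg_const //.
  exact: iid_is_pmf.
by rewrite big_split /= pmf_avg_const // addrC.
Qed.

Lemma iid_variance n (z : W -> R) : \sum_s q s * z s = 0 ->
  \sum_w iid q w * (\sum_(i < n) z (w i)) ^+ 2 = n%:R * \sum_s q s * z s ^+ 2.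
Proof.
move=> z0; elim: n => [|n IH].
  by rewrite mul0r big1 // => w _; rewrite big_ord0 expr0n mulr0.
rewrite sum_fcons -natr1 mulrDl mul1r -IH.
transitivity (\sum_s \sum_(w : {ffun 'I_n -> W}) (q s * (iid q w * z s ^+ 2) +
   q s * (iid q w * (\sum_i z (w i)) ^+ 2) + (2 * (q s * z s)) * (iid q w * \sum_i z (w i)))).
  apply: eq_bigr => s _; apply: eq_bigr => w _; rewrite iid_fcons sum_ord_fcons; ring.
transitivity (\sum_s (q s * z s ^+ 2 + q s * \sum_(w : {ffun 'I_n -> W}) iid q w * (\sum_i z (w i)) ^+ 2)).
  apply: eq_bigr => s _; rewrite !big_split /= -!mulr_sumr pmf_avg_const ?iid_mean ?z0 ?mulr0 ?addr0 //.
  exact: iid_is_pmf.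
by rewrite big_split /= pmf_avg_const // addrC.
Qed.

Lemma chebyshev_iid n (z : W -> R) (d : R) : 0 < d -> (0 < n)%N ->
  \sum_w iid q w * (d * n%:R < `|\sum_(i < n) (z (w i) - \sum_s q s * z s)|)%R%:R <=
  (\sum_s q s * (z s - \sum_s q s * z s) ^+ 2) / (d ^+ 2) / n%:R.
Proof.
move=> d0 n0; set m := \sum_s q s * z s; pose zc s := z s - m.
have n0' : 0 < n%:R :> R by rewrite ltr0n.
have zc0 : \sum_s q s * zc s = 0.
  by under eq_bigr do rewrite mulrBr; rewrite sumrB pmf_avg_const // subrr.
have dn : 0 < d * n%:R by rewrite mulr_gt0.
have := iid_variance n zc0; set v := \sum_s q s * zc s ^+ 2 => hv.
have -> : v / d ^+ 2 / n%:R = (n%:R * v) / (d * n%:R) ^+ 2.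
  by field; rewrite (gt_eqF d0) (gt_eqF n0').
rewrite -hv mulr_suml; apply: ler_sum => w _; rewrite -mulrA ler_wpM2l //.
  by have [h _] := iid_is_pmf n hq; exact: h.
case: ltP => [lt|_] /=; last by rewrite divr_ge0 ?sqr_ge0.
rewrite ler_pdivlMr ?exprn_gt0 // mul1r -[leRHS](ger0_norm (sqr_ge0 _)) normrX.
by rewrite ler_sqr ?nnegrE ?normr_ge0 ?ltW.
Qed.

Lemma log2_prod n (f : 'I_n -> R) : (forall i, 0 < f i) -> log2 (\prod_i f i) = \sum_i log2 (f i).
Proof.
elim: n f => [|n IH] f f0; first by rewrite !big_ord0 log2_1.
by rewrite !big_ord_recl log2M ?IH // prodr_gt0.
Qed.

Lemma log2_powR (x : R) : log2 (2 `^ x) = x.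
Proof. by rewrite /log2 ln_powR mulfK // gt_eqF // ln2_gt0. Qed.

Lemma powR2_gt0 (x : R) : 0 < 2 `^ x.
Proof. by rewrite powR_gt0. Qed.

Lemma log2_lt (x y : R) : 0 < x -> x < y -> log2 x < log2 y.
Proof.
move=> x0 xy; rewrite /log2 ltr_pM2r ?invr_gt0 ?ln2_gt0 //.
by rewrite ltr_ln // posrE ?(lt_trans x0).
Qed.

(** Chebyshev for the logarithm of a score. Since [sc] need not be the law [q] itself, [h] can be a
    conditional entropy. *)
Lemma aep (sc : W -> R) (d e : R) (h := - \sum_w q w * log2 (sc w)) :
  (forall w, 0 < q w -> 0 < sc w) -> 0 < d -> 0 < e ->
  exists n0 : nat, forall n, (n0 < n)%N ->
    \sum_w iid q w * (\prod_(i < n) sc (w i) < 2 `^ (- (n%:R * (h + d))))%R%:R <= e /\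
    \sum_w iid q w * (2 `^ (- (n%:R * (h - d))) < \prod_(i < n) sc (w i))%R%:R <= e.
Proof.
move=> sc0 d0 e0; pose z w := log2 (sc w).
pose d' := d / 2.
have d'0 : 0 < d' by rewrite divr_gt0.
pose c := (\sum_s q s * (z s - \sum_s q s * z s) ^+ 2) / d' ^+ 2.
have c0 : 0 <= c.
  rewrite divr_ge0 ?sqr_ge0 //; apply: sumr_ge0 => w _; rewrite mulr_ge0 ?sqr_ge0 //; by case: hq.
exists (Num.bound (c / e)) => n hn.
have n0 : (0 < n)%N by exact: leq_ltn_trans hn.
have n0' : 0 < n%:R :> R by rewrite ltr0n.
have cn : c / n%:R <= e.
  rewrite ler_pdivrMr // mulrC -ler_pdivrMr //; apply/ltW.
  apply: lt_le_trans (archi_boundP _) _; first by rewrite divr_ge0 // ltW.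
  by rewrite ler_nat ltnW.
have cheb := le_trans (chebyshev_iid z d'0 n0) cn.
have hz : h = - \sum_s q s * z s by [].
have iid0 (w : {ffun 'I_n -> W}) : 0 <= iid q w by have [k _] := iid_is_pmf n hq; exact: k.
have pos (w : {ffun 'I_n -> W}) : iid q w != 0 -> forall i, 0 < sc (w i).
  move=> nz i; apply: sc0; rewrite lt0r; have [q0 _] := hq; rewrite q0 andbT.
  by apply: contra nz => /eqP qz; rewrite /iid (bigD1 i) //= qz mul0r.
have prod_log (w : {ffun 'I_n -> W}) : iid q w != 0 -> log2 (\prod_i sc (w i)) = \sum_i z (w i).
  by move=> /pos k; rewrite log2_prod.
have sumB (w : {ffun 'I_n -> W}) : \sum_i (z (w i) - \sum_s q s * z s) = \sum_i z (w i) + n%:R * h.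
  by rewrite sumrB sumr_const card_ord hz mulrN mulr_natl.
split; apply: le_trans cheb; apply: ler_sum => w _.
- have [->|nz] := eqVneq (iid q w) 0; first by rewrite !mul0r.
  rewrite ler_wpM2l // ler_nat; case: ltP => // lt; rewrite lt0b sumB.
  have := log2_lt (prodr_gt0 _ (fun i _ => pos w nz i)) lt; rewrite prod_log // log2_powR => k.
  rewrite ltr0_norm; last by move: k; rewrite mulrDr; have := mulr_gt0 n0' d0; lra.
  by move: k; rewrite /d' mulrDr; have := mulr_gt0 n0' d0; lra.
- have [->|nz] := eqVneq (iid q w) 0; first by rewrite !mul0r.
  rewrite ler_wpM2l // ler_nat; case: ltP => // lt; rewrite lt0b sumB.
  have := log2_lt (powR2_gt0 _) lt; rewrite prod_log // log2_powR => k.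
  apply: lt_le_trans (ler_norm _).
  by move: k; rewrite /d' mulrBr; have := mulr_gt0 n0' d0; lra.
Qed.

End IID.

(** * Conditional laws as kernels, and their n-fold products *)

Section CondKernel.
Variables (R : realType) (T A B : finType) (P : T -> R) (X : T -> A) (V : T -> B) (b0 : B).
Hypothesis hP : is_pmf P.

(** Where the condition has mass 0 the kernel is the point mass at [b0]: the binning argument needs
    a pmf for every value of the condition. *)
Definition cond_kernel (a : A) (b : B) : R :=
  if law P X a == 0 then (b == b0)%:R else law P (joint V X) (b, a) / law P X a.

Lemma cond_kernel_pmf a : is_pmf (cond_kernel a).
Proof.
rewrite /cond_kernel; case: eqVneq => [e|n0]; split=> [b|].
- by rewrite ler0n.
- by rewrite (bigD1 b0) //= eqxx big1 ?addr0 // => b /negPf ->.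
- by rewrite divr_ge0 ?law_ge0.
- by rewrite -mulr_suml law_joint_suml divff.
Qed.

Lemma cond_kernelE a b : law P (joint V X) (b, a) = law P X a * cond_kernel a b.
Proof.
rewrite /cond_kernel; case: eqVneq => [e|n0]; last by rewrite mulrC divfK.
by rewrite e mul0r (law_eq0_sub hP e) // => t [].
Qed.

Lemma cond_kernel_gt0 t : 0 < P t -> 0 < cond_kernel (X t) (V t).
Proof.
move=> Pt; have h1 := law_gt0 hP X Pt; have h2 := law_gt0 hP (joint V X) Pt.
by rewrite /cond_kernel gt_eqF // divr_gt0.
Qed.

Lemma cond_kernel_entropy :
  - (\sum_t P t * log2 (cond_kernel (X t) (V t))) = entropy P (joint V X) - entropy P X.
Proof.
rewrite /entropy opprK -[RHS]opprK opprD opprK -sumrB; congr (- _); apply: eq_bigr => t _.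
have [->|n0] := eqVneq (P t) 0; first by rewrite !mul0r subr0.
have Pt : 0 < P t by rewrite lt0r n0; case: hP => h _; exact: h.
have h1 := law_gt0 hP X Pt; have h2 := law_gt0 hP (joint V X) Pt.
by rewrite /cond_kernel gt_eqF // log2_div // mulrBr.
Qed.

End CondKernel.

Section ProductKernel.
Variables (R : realType) (A B : finType) (k : A -> B -> R) (n : nat).
Hypothesis hk : forall a, is_pmf (k a).

Definition product_kernel (a : {ffun 'I_n -> A}) (b : {ffun 'I_n -> B}) : R := \prod_i k (a i) (b i).

Lemma product_kernel_pmf a : is_pmf (product_kernel a).
Proof.
split=> [b|]; first by apply: prodr_ge0 => i _; case: (hk (a i)).
rewrite /product_kernel -(bigA_distr_bigA (fun i b => k (a i) b)) big1 // => i _.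
by case: (hk (a i)).
Qed.

Lemma product_kernel_le1 a b : product_kernel a b <= 1.
Proof.
have [h0 h1] := product_kernel_pmf a; rewrite -h1 (bigD1 b) //= lerDl.
by apply: sumr_ge0.
Qed.

End ProductKernel.

Section LetterwiseLaw.
Variables (R : realType) (S A : finType) (p : S -> R) (X : S -> A).
Hypothesis hp : is_pmf p.

Lemma law_letterwise n a : law (iid p (n := n)) (letterwise X) a = \prod_i law p X (a i).
Proof.
transitivity (\sum_(w : {ffun 'I_n -> S}) \prod_i (if X (w i) == a i then p (w i) else 0)).
  rewrite /law big_mkcond; apply: eq_bigr => w _; case: eqP => [e|ne].
    by apply: eq_bigr => i _; rewrite -e ffunE eqxx.
  have [i ni] : exists i, X (w i) != a i.
    apply/existsP; apply: contraT; rewrite negb_exists => /forallP h; case: ne.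
    by apply/ffunP => i; rewrite ffunE; apply/eqP; rewrite -[_ == _]negbK.
  by rewrite (bigD1 i) //= (negPf ni) mul0r.
rewrite -(bigA_distr_bigA (fun i s => if X s == a i then p s else 0)).
by apply: eq_bigr => i _; rewrite /law [RHS]big_mkcond.
Qed.

Lemma entropy_letterwise n : entropy (iid p (n := n)) (letterwise X) = n%:R * entropy p X.
Proof.
rewrite /entropy mulrN; congr (- _).
rewrite -(iid_mean hp n (fun s => log2 (law p X (X s)))); apply: eq_bigr => w _.
have [->|nz] := eqVneq (iid p w) 0; first by rewrite !mul0r.
congr (_ * _); rewrite -/(law _ _ _) law_letterwise log2_prod => [|i].
  by apply: eq_bigr => i _; rewrite ffunE.
rewrite ffunE; apply: law_gt0 => //; rewrite lt0r; have [p0 _] := hp; rewrite p0 andbT.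
by apply: contra nz => /eqP z; rewrite /iid (bigD1 i) //= z mul0r.
Qed.

End LetterwiseLaw.

Section Factor.
Variables (R : realType) (S A1 A2 U1 U2 : finType) (p : S -> R) (x1 : S -> A1) (x2 : S -> A2).
Variables (k1 : A1 -> U1 -> R) (k2 : U1 * A2 -> U2 -> R) (q : S * U1 * U2 -> R).
Hypothesis factor : forall s v u, q (s, v, u) = p s * (k1 (x1 s) v * k2 (v, x2 s) u).
Variable n : nat.

Definition ffun_pair (A B : finType) (ab : {ffun 'I_n -> A} * {ffun 'I_n -> B}) : {ffun 'I_n -> A * B} :=
  [ffun i => (ab.1 i, ab.2 i)].

Let zip (s : {ffun 'I_n -> S}) (v : {ffun 'I_n -> U1}) (u : {ffun 'I_n -> U2}) : {ffun 'I_n -> S * U1 * U2} :=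
  [ffun i => (s i, v i, u i)].

(** Product kernels applied to an i.i.d. source give n i.i.d. copies of [q], so the ideal experiment
    is governed by [aep] for [q]. *)
Lemma sum_letterwise (G : {ffun 'I_n -> S} -> {ffun 'I_n -> U1} -> {ffun 'I_n -> U2} -> R) :
  \sum_s iid p s * (\sum_v product_kernel k1 (letterwise x1 s) v *
    (\sum_u product_kernel k2 (ffun_pair (v, letterwise x2 s)) u * G s v u)) =
  \sum_w iid q w * G (letterwise (@aux_src S U1 U2) w) (letterwise (@aux_V1 S U1 U2) w)
     (letterwise (@aux_V2 S U1 U2) w).
Proof.
rewrite [RHS](reindex (fun svu : {ffun 'I_n -> S} * {ffun 'I_n -> U1} * {ffun 'I_n -> U2} =>
  zip svu.1.1 svu.1.2 svu.2)) /=; last first.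
  exists (fun w => (letterwise (@aux_src S U1 U2) w, letterwise (@aux_V1 S U1 U2) w,
     letterwise (@aux_V2 S U1 U2) w)) => [[[s v] u] _|w _] /=.
    by congr (_, _, _); apply/ffunP => i; rewrite !ffunE.
  by apply/ffunP => i; rewrite !ffunE /aux_src /aux_V1 /aux_V2; case: (w i) => [[]].
transitivity (\sum_s \sum_v \sum_u iid q (zip s v u) * G s v u).
  apply: eq_bigr => s _; rewrite mulr_sumr; apply: eq_bigr => v _; rewrite !mulr_sumr.
  apply: eq_bigr => u _; rewrite !mulrA; congr (_ * _).
  rewrite /iid /product_kernel -!big_split; apply: eq_bigr => i _ /=.
  by rewrite !ffunE factor mulrA.
rewrite pair_bigA pair_bigA /=; apply: eq_bigr => -[[s v] u] _ /=; congr (_ * G _ _ _);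
  by apply/ffunP => i; rewrite !ffunE.
Qed.

End Factor.

Section Pow2.
Variable R : realType.

Lemma pow2_le (x y : R) : x <= y -> 2 `^ x <= 2 `^ y :> R.
Proof. by move=> xy; rewrite ler_powR // ler1n. Qed.

Lemma pow2_ge1 (x : R) : 0 <= x -> 1 <= 2 `^ x.
Proof. by move=> /pow2_le; rewrite powRr0. Qed.

(** Rounding down costs at most one bit, which is later absorbed in [n * d >= 1]. *)
Lemma pow2_nat (y : R) : 0 <= y -> exists k : nat, [/\ (0 < k)%N, k%:R <= 2 `^ y & 2 `^ (y - 1) <= k%:R].
Proof.
move=> y0; have y1 := pow2_ge1 y0.
have y0' : 0 <= 2 `^ y := le_trans ler01 y1.
have /andP[h1 h2] := truncn_itv y0'.
have k0 : (0 < Num.truncn (2 `^ y))%N by rewrite truncn_gt0.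
exists (Num.truncn (2 `^ y)); split => //.
have -> : 2 `^ (y - 1) = 2 `^ y / 2 :> R by rewrite powRD ?pnatr_eq0 ?implybT // powR_inv1 ?ler0n.
rewrite ler_pdivrMr //; apply/ltW/(lt_le_trans h2).
by rewrite -natrM ler_nat mulnC mul2n -addnn -addn1 leq_add2l.
Qed.

Lemma pow2D (x y : R) : 2 `^ (x + y) = 2 `^ x * 2 `^ y :> R.
Proof. by rewrite powRD // pnatr_eq0 implybT. Qed.

Lemma pow2_log2 (x : R) : 0 < x -> 2 `^ (log2 x) = x.
Proof.
move=> x0; rewrite /powR pnatr_eq0 /= /log2 divfK ?lnK ?posrE // gt_eqF //.
exact: ln2_gt0.
Qed.

End Pow2.

(** * Block codes *)

Section Exponents.
Variables (R : realFieldType) (n d g1 gA g2 g3 gB R1 R2 r2 : R).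
Hypotheses (n0 : 0 <= n) (d0 : 0 <= d).

(** In units of [n * d], a bin loses 4 in the size of the common randomness, 1 by rounding the
    message, 1 in the typicality threshold and 1 to push the error below [e]. The bin of V2 gets
    exactly these 7; the second message has two parts with 7 each, hence 14. *)
Lemma exponent_bin1 : g1 - gA <= R1 ->
  n * (g1 + d) + n * d <= n * (gA - 4 * d) + (n * (R1 + 14 * d) - n * d).
Proof.
move=> h; rewrite -subr_ge0.
rewrite (_ : _ - _ = n * (R1 - (g1 - gA) + 7 * d)); last by ring.
by rewrite mulr_ge0 // addr_ge0 ?subr_ge0 // mulr_ge0.
Qed.

Lemma exponent_bin12 : r2 + (g2 - gA) <= R1 + R2 -> n * (g2 + d) + n * d <=
  n * (gA - 4 * d) + (n * (R1 + 14 * d) - n * d) + (n * (R2 - r2 + 7 * d) - n * d).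
Proof.
move=> h; rewrite -subr_ge0.
rewrite (_ : _ - _ = n * (R1 + R2 - (r2 + (g2 - gA)) + 13 * d)); last by ring.
by rewrite mulr_ge0 // addr_ge0 ?subr_ge0 // mulr_ge0.
Qed.

Lemma exponent_bin2 : g3 - gB = r2 ->
  n * (g3 + d) + n * d <= n * (gB - 4 * d) + (n * (r2 + 7 * d) - n * d).
Proof. by move=> <-; rewrite le_eqVlt; apply/orP; left; apply/eqP; ring. Qed.

End Exponents.

Section Achievability.
Variables (R : realType) (A1 A2 B : finType) (p : A1 * A2 * B -> R).
Hypothesis hp : is_pmf p.
Hypothesis hmarkov : markov_chain p (@src_X1 A1 A2 B) (@src_Y A1 A2 B) (@src_X2 A1 A2 B).
Variables (U1 U2 : finType) (q : A1 * A2 * B * U1 * U2 -> R).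

Local Notation S := (A1 * A2 * B)%type.
Local Notation src := (@aux_src S U1 U2).
Local Notation rX1 := (@src_X1 A1 A2 B).
Local Notation rX2 := (@src_X2 A1 A2 B).
Local Notation rY := (@src_Y A1 A2 B).
Local Notation X1 := (rX1 \o src).
Local Notation X2 := (rX2 \o src).
Local Notation Y := (rY \o src).
Local Notation V1 := (@aux_V1 S U1 U2).
Local Notation V2 := (@aux_V2 S U1 U2).

Hypothesis hsys : aux_system p q src V1 V2.
Variables (v0 : U1) (u0 : U2) (y0 : B).

Let hq : is_pmf q. Proof. by case: hsys. Qed.
Let sq : law q src =1 p. Proof. by case: hsys. Qed.
Let aux : aux_markov q X1 X2 Y V1 V2. Proof. by case: hsys. Qed.

Let k1 := cond_kernel q X1 V1 v0.
Let k2 := cond_kernel q (joint V1 X2) V2 u0.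
Let c1 := cond_kernel q X2 V1 v0.
Let c2 := cond_kernel q (fun=> tt) V1 v0.
Let c3 := cond_kernel q V1 V2 u0.
Let kY := cond_kernel q (joint V1 V2) Y y0.

Let law_src_V1 s v : law q (joint src V1) (s, v) = p s * k1 (rX1 s) v.
Proof.
case: s => [[a1 a2] b]; rewrite /src_X1 /=.
have [e|n0] := eqVneq (law q X1 a1) 0.
  have ps : p (a1, a2, b) = 0.
    by rewrite -sq (law_eq0_sub hq e) // => w ew; rewrite /src_X1 /= ew.
  by rewrite ps mul0r; rewrite -sq in ps; rewrite (law_eq0_sub hq ps) // => w [].
apply: (mulIf n0); rewrite (law_S_V1 hsys) -mulrA [p _ * _]mulrC; congr (_ * _).
rewrite mulrC -cond_kernelE //; apply: eq_bigl => w.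
by rewrite /joint !xpair_eqE andbC.
Qed.

Let factor s v u : q (s, v, u) = p s * (k1 (rX1 s) v * k2 (v, rX2 s) u).
Proof.
have -> : q (s, v, u) = law q (joint (joint src V1) V2) (s, v, u).
  by rewrite /law (big_pred1 (s, v, u)) // => -[[s' v'] u'].
rewrite mulrA -law_src_V1; case: s => [[a1 a2] b]; rewrite /src_X2 /=.
have [e|n0] := eqVneq (law q (joint V1 X2) (v, a2)) 0.
  have e' : law q (joint src V1) ((a1, a2, b), v) = 0.
    by rewrite (law_eq0_sub hq e) // => w; rewrite /joint /src_X2 /= => -[-> ->].
  by rewrite e' mul0r (law_eq0_sub hq e') // => w; rewrite /joint => -[-> -> _].
apply: (mulIf n0); rewrite (law_S_V1_V2 hsys) -mulrA [k2 _ _ * _]mulrC -cond_kernelE //.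
rewrite mulrC; congr (_ * _); apply: eq_bigl => w.
by rewrite /joint !xpair_eqE andbC.
Qed.

(** Size of the common randomness: with [sigma] of exponent [h - d], the upper exponent [h - 3 * d]
    gives sigma |F| <= 2^(-2nd) <= e^2, and rounding costs one more [d]. If that exponent is
    negative, a single value is used. *)
Lemma pick_size (n : nat) (h d : R) : 0 <= d -> 1 <= n%:R * d -> exists k : nat, [/\ (0 < k)%N,
  2 `^ (n%:R * (h - 4 * d)) <= k%:R & k = 1%N \/ k%:R <= 2 `^ (n%:R * (h - 3 * d))].
Proof.
move=> d0 nd.
have e c : n%:R * (h - c * d) = n%:R * h - c * (n%:R * d) by ring.
have [yge|ylt] := leP 0 (n%:R * (h - 3 * d)).
  have [k [kpos klo khi]] := pow2_nat yge.
  exists k; split => //; last by right.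
  by apply: le_trans khi; apply: pow2_le; rewrite !e; lra.
exists 1%N; split => //; last by left.
rewrite -[leRHS](powRr0 2); apply: pow2_le.
by move: ylt; rewrite !e; lra.
Qed.

Let HY := entropy q Y.
Let gA := entropy q (joint V1 X1) - entropy q X1.
Let gB := entropy q (joint V2 (joint V1 X2)) - entropy q (joint V1 X2).
Let g1 := entropy q (joint V1 X2) - entropy q X2.
Let g2 := entropy q V1.
Let g3 := entropy q (joint V2 V1) - entropy q V1.
Let gY := entropy q (joint Y (joint V1 V2)) - entropy q (joint V1 V2).

Section Block.
Variables (n : nat) (d e : R).
Hypotheses (n0 : (0 < n)%N) (d0 : 0 < d) (e0 : 0 < e).

Let P := iid p (n := n).
Let x1 := letterwise (n := n) rX1.
Let x2 := letterwise (n := n) rX2.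
Let y := letterwise (n := n) rY.
Let w1 := product_kernel k1 (n := n).
Let w2 vx := product_kernel k2 (n := n) (ffun_pair vx).

Let hk1 a : is_pmf (k1 a). Proof. exact: cond_kernel_pmf. Qed.
Let hk2 a : is_pmf (k2 a). Proof. exact: cond_kernel_pmf. Qed.
Let hc1 a : is_pmf (c1 a). Proof. exact: cond_kernel_pmf. Qed.
Let hc2 a : is_pmf (c2 a). Proof. exact: cond_kernel_pmf. Qed.
Let hc3 a : is_pmf (c3 a). Proof. exact: cond_kernel_pmf. Qed.
Let hkY a : is_pmf (kY a). Proof. exact: cond_kernel_pmf. Qed.

Let ideal_prE (E : {ffun 'I_n -> S} -> {ffun 'I_n -> U1} -> {ffun 'I_n -> U2} -> bool) :
  ideal_pr P x1 x2 w1 w2 E =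
  \sum_w iid q w * (E (letterwise src w) (letterwise V1 w) (letterwise V2 w))%:R.
Proof. exact: (sum_letterwise factor (fun s v u => (E s v u)%:R)). Qed.

Let tt_n : {ffun 'I_n -> unit} := [ffun=> tt].

(* Mixing with the uniform law makes the logarithmic loss bounded. *)
Definition block_loss (t : {ffun 'I_n -> B}) (v : {ffun 'I_n -> U1}) (u : {ffun 'I_n -> U2}) : R :=
  - log2 (2^-1 * product_kernel kY (ffun_pair (v, u)) t + 2^-1 * (#|B|%:R ^- n)).

Let B0 : 0 < #|B|%:R :> R. Proof. by rewrite ltr0n; apply/card_gt0P; exists y0. Qed.
Let LB := log2 (#|B|%:R : R).
Let LB0 : 0 <= LB.
Proof. by apply: log2_ge0; rewrite ler1n; apply/card_gt0P; exists y0. Qed.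
Let L := 1 + n%:R * LB.
Let L0 : 0 <= L. Proof. by rewrite /L addr_ge0 // mulr_ge0 // ler0n. Qed.

Let pk_ge0 t v u : 0 <= product_kernel kY (n := n) (ffun_pair (v, u)) t.
Proof. by have [h _] := product_kernel_pmf hkY (ffun_pair (v, u)); exact: h. Qed.

Let arg_gt0 t v u : 0 < 2^-1 * product_kernel kY (n := n) (ffun_pair (v, u)) t + 2^-1 * (#|B|%:R ^- n).
Proof.
apply: ltr_wpDl; first by rewrite mulr_ge0 ?invr_ge0.
by rewrite mulr_gt0 ?invr_gt0 ?exprn_gt0.
Qed.

Let log2X : log2 (#|B|%:R ^- n : R) = - (n%:R * LB).
Proof. by rewrite log2V ?exprn_gt0 // /log2 lnXn // !mulrnAl mul1r. Qed.

Lemma block_loss_bounds t v u : 0 <= block_loss t v u <= L.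
Proof.
rewrite /block_loss; apply/andP; split.
  rewrite oppr_ge0 log2_le0 //.
  have h1 := product_kernel_le1 hkY (ffun_pair (v, u)) t.
  have h2 : (#|B|%:R ^- n : R) <= 1.
    by rewrite invf_le1 ?exprn_gt0 // exprn_ege1 // ler1n; apply/card_gt0P; exists y0.
  lra.
rewrite lerNl; apply: le_trans (_ : log2 (2^-1 * (#|B|%:R ^- n)) <= _).
  by rewrite log2M ?invr_gt0 ?exprn_gt0 // log2X log2V // log2_2 /L opprD.
apply: log2_le; first by rewrite mulr_gt0 ?invr_gt0 ?exprn_gt0.
by rewrite lerDr mulr_ge0 ?invr_ge0.
Qed.

(** The 1 is the bit lost by the factor 1/2 in [block_loss]; [gY] is H(Y|V1V2). *)
Lemma ideal_block_loss : \sum_s P s * ideal_loss x1 x2 y w1 w2 block_loss s <= 1 + n%:R * gY.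
Proof.
have -> : \sum_s P s * ideal_loss x1 x2 y w1 w2 block_loss s =
    \sum_w iid q w * block_loss (letterwise rY (letterwise src w)) (letterwise V1 w) (letterwise V2 w).
  exact: (sum_letterwise factor (fun s v u => block_loss (letterwise rY s) v u)).
pose sc w := kY (joint V1 V2 w) (Y w).
have -> : 1 + n%:R * gY = \sum_w iid q w * (1 - \sum_(i < n) log2 (sc (w i))).
  have hP : is_pmf (iid q (n := n)) by exact: iid_is_pmf.
  under eq_bigr do rewrite mulrBr.
  rewrite sumrB pmf_avg_const // (iid_mean hq n (fun w => log2 (sc w))) /gY.
  by rewrite -(cond_kernel_entropy _ _ y0 hq) mulrN.
apply: ler_sum => w _; have [->|nz] := eqVneq (iid q w) 0; first by rewrite !mul0r.
rewrite ler_wpM2l //; first by have [h _] := iid_is_pmf n hq; exact: h.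
have pos i : 0 < sc (w i).
  apply: cond_kernel_gt0 => //; rewrite lt0r; have [q0 _] := hq; rewrite q0 andbT.
  by apply: contra nz => /eqP qz; rewrite /iid (bigD1 i) //= qz mul0r.
have pkE : product_kernel kY (ffun_pair (letterwise V1 w, letterwise V2 w)) (letterwise rY (letterwise src w))
    = \prod_i sc (w i).
  by apply: eq_bigr => i _; rewrite !ffunE.
rewrite /block_loss pkE -log2_prod // lerNl opprB.
apply: le_trans (_ : log2 (2^-1 * \prod_i sc (w i)) <= _).
  by rewrite log2M ?invr_gt0 ?prodr_gt0 // log2V // log2_2 addrC.
apply: log2_le; first by rewrite mulr_gt0 ?invr_gt0 ?prodr_gt0.
by rewrite lerDl mulr_ge0 ?invr_ge0 ?exprn_ge0 // ltW.
Qed.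

Let aep_below (sc : A1 * A2 * B * U1 * U2 -> R) h := \sum_w iid q w * (\prod_(i < n) sc (w i) < 2 `^ (- (n%:R * (h + d))))%R%:R <= e.
Let aep_above (sc : A1 * A2 * B * U1 * U2 -> R) h := \sum_w iid q w * (2 `^ (- (n%:R * (h - d))) < \prod_(i < n) sc (w i))%R%:R <= e.

Hypothesis t1 : aep_below (fun w => c1 (X2 w) (V1 w)) g1.
Hypothesis t2 : aep_below (fun w => c2 tt (V1 w)) g2.
Hypothesis t3 : aep_below (fun w => c3 (V1 w) (V2 w)) g3.
Hypothesis t4 : aep_above (fun w => k1 (X1 w) (V1 w)) gA.
Hypothesis t5 : aep_above (fun w => k2 (joint V1 X2 w) (V2 w)) gB.
Hypothesis nd : 1 <= n%:R * d.
Hypothesis ne : 2 `^ (- (n%:R * d)) <= e.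

Variables (R1 R2 r2 : R).
Hypothesis R1_ge0 : 0 <= R1.
Hypothesis r2_ge0 : 0 <= r2 <= R2.
Hypothesis hR1 : g1 - gA <= R1.
Hypothesis hr2 : g3 - gB = r2.
Hypothesis hR12 : r2 + (g2 - gA) <= R1 + R2.

Lemma block_code : exists (M1 M2 : finType) (f : {ffun 'I_n -> A1} -> M1)
    (g : {ffun 'I_n -> A2} * M1 -> M2),
  [/\ log2 #|M1|%:R <= n%:R * (R1 + 14 * d), log2 #|M2|%:R <= n%:R * (R2 + 14 * d) &
    n%:R * HY - (1 + n%:R * gY + 18 * L * e) <=
    mutual_info P y (joint (fun w => f (x1 w)) (fun w => g (x2 w, f (x1 w))))].
Proof.
have nR0 : 0 <= n%:R :> R by rewrite ler0n.
have nR : 0 < n%:R :> R by rewrite ltr0n.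
have d0' := ltW d0.
have [F1 [F10 F1lo F1hi]] := pick_size gA d0' nd.
have [F2 [F20 F2lo F2hi]] := pick_size gB d0' nd.
have /andP[r20 r2R] := r2_ge0.
have [|M1 [M10 M1hi M1lo]] := @pow2_nat R (n%:R * (R1 + 14 * d)).
  by rewrite mulr_ge0 // addr_ge0 // mulr_ge0.
(* [Ma] is the forwarded part of the hash of V1; it uses the rate [R2 - r2] left over by [Mb], the
   bin of V2. This is how the sum-rate bound enters. *)
have [|Ma [Ma0 Mahi Malo]] := @pow2_nat R (n%:R * (R2 - r2 + 7 * d)).
  by rewrite mulr_ge0 // addr_ge0 ?subr_ge0 // mulr_ge0.
have [|Mb [Mb0 Mbhi Mblo]] := @pow2_nat R (n%:R * (r2 + 7 * d)).
  by rewrite mulr_ge0 // addr_ge0 // mulr_ge0.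
pose tau h : R := 2 `^ (- (n%:R * (h + d))).
pose sigma h : R := 2 `^ (- (n%:R * (h - d))).
have expand (a : R) (x : R) : n%:R * (a * x) = a * (n%:R * x) by rewrite mulrCA.
have sizes (h1 h2 : R) (m1 m2 : nat) : 2 `^ h1 <= m1%:R :> R -> 2 `^ h2 <= m2%:R :> R ->
    2 `^ (h1 + h2) <= (m1 * m2)%:R :> R.
  by move=> a b; rewrite natrM pow2D; apply: ler_pM => //; rewrite powR_ge0.
have cond h m z : 2 `^ z <= m%:R :> R -> n%:R * (h + d) + n%:R * d <= z -> 1 <= e * (tau h * m%:R).
  move=> hm hz; apply: le_trans (_ : 2 `^ (- (n%:R * d)) * (tau h * 2 `^ z) <= _).
    by rewrite /tau -!pow2D; apply: pow2_ge1; lra.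
  apply: ler_pM => //; rewrite ?mulr_ge0 ?powR_ge0 //.
  by apply: ler_pM => //; rewrite ?powR_ge0.
have cond' h (F : nat) : F = 1%N \/ F%:R <= 2 `^ (n%:R * (h - 3 * d)) :> R ->
    F = 1%N \/ sigma h * F%:R <= e ^+ 2.
  case=> [->|hF]; [by left|right].
  apply: le_trans (_ : sigma h * 2 `^ (n%:R * (h - 3 * d)) <= _); first by rewrite ler_wpM2l ?powR_ge0.
  apply: le_trans (_ : 2 `^ (- (n%:R * d)) * 2 `^ (- (n%:R * d)) <= _).
    by rewrite /sigma -!pow2D; apply: pow2_le; rewrite !mulrBr expand; lra.
  by rewrite expr2; apply: ler_pM => //; rewrite powR_ge0.
have prodE (A C : finType) (k : A -> C -> R) (a : _ -> A) (c : _ -> C) (w : {ffun 'I_n -> S * U1 * U2}) :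
    product_kernel k (letterwise a w) (letterwise c w) = \prod_i k (a (w i)) (c (w i)).
  by apply: eq_bigr => i _; rewrite !ffunE.
have lwE (A : finType) (a : S -> A) (w : {ffun 'I_n -> S * U1 * U2}) :
    letterwise a (letterwise src w) = letterwise (a \o src) w.
  by apply/ffunP => i; rewrite !ffunE.
have hP : is_pmf P by exact: iid_is_pmf.
have hw1 x : is_pmf (w1 x) by exact: product_kernel_pmf.
have hw2 x : is_pmf (w2 x) by exact: product_kernel_pmf.
have ge0 (A C : finType) (k : A -> C -> R) a b : (forall a, is_pmf (k a)) -> 0 <= product_kernel k (n := n) a b.
  by move=> hk; have [h _] := product_kernel_pmf hk a; exact: h.
have le1 (A C : finType) (k : A -> C -> R) a : (forall a, is_pmf (k a)) -> \sum_b product_kernel k (n := n) a b <= 1.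
  by move=> hk; have [_ ->] := product_kernel_pmf hk a.
have p1 : ideal_pr P x1 x2 w1 w2 (fun s v _ => product_kernel c1 (x2 s) v < tau g1) <= e.
  by rewrite ideal_prE; apply: le_trans t1; under eq_bigr do rewrite /x2 lwE prodE.
have p2 : ideal_pr P x1 x2 w1 w2 (fun _ v _ => product_kernel c2 tt_n v < tau g2) <= e.
  rewrite ideal_prE; apply: le_trans t2; apply: ler_sum => w _.
  rewrite (_ : product_kernel c2 tt_n _ = \prod_i c2 tt (V1 (w i))) //.
  by apply: eq_bigr => i _; rewrite !ffunE.
have p3 : ideal_pr P x1 x2 w1 w2 (fun _ v u => product_kernel c3 v u < tau g3) <= e.
  by rewrite ideal_prE; apply: le_trans t3; under eq_bigr do rewrite prodE.
have p4 : ideal_pr P x1 x2 w1 w2 (fun s v _ => sigma gA < w1 (x1 s) v) <= e.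
  by rewrite ideal_prE; apply: le_trans t4; under eq_bigr do rewrite /x1 lwE /w1 prodE.
have p5 : ideal_pr P x1 x2 w1 w2 (fun s v u => sigma gB < w2 (v, x2 s) u) <= e.
  rewrite ideal_prE; apply: le_trans t5; apply: ler_sum => w _.
  rewrite (_ : w2 _ _ = \prod_i k2 (joint V1 X2 (w i)) (V2 (w i))) //.
  by apply: eq_bigr => i _; rewrite !ffunE.
have lM1 : 2 `^ (n%:R * (R1 + 14 * d) - n%:R * d) <= M1%:R :> R.
  by apply: le_trans M1lo; apply: pow2_le; rewrite lerD2l lerN2.
have lMa : 2 `^ (n%:R * (R2 - r2 + 7 * d) - n%:R * d) <= Ma%:R :> R.
  by apply: le_trans Malo; apply: pow2_le; rewrite lerD2l lerN2.
have lMb : 2 `^ (n%:R * (r2 + 7 * d) - n%:R * d) <= Mb%:R :> R.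
  by apply: le_trans Mblo; apply: pow2_le; rewrite lerD2l lerN2.
have q1 : 1 <= e * (tau g1 * (F1 * M1)%:R).
  apply: (cond _ _ _ (sizes _ _ _ _ F1lo lM1)).
  exact: exponent_bin1.
have q2 : 1 <= e * (tau g2 * (F1 * M1 * Ma)%:R).
  apply: (cond _ _ _ (sizes _ _ _ _ (sizes _ _ _ _ F1lo lM1) lMa)).
  exact: exponent_bin12.
have q3 : 1 <= e * (tau g3 * (F2 * Mb)%:R).
  apply: (cond _ _ _ (sizes _ _ _ _ F2lo lMb)).
  exact: exponent_bin2.
rewrite -[F1]card_ord in F10 q1 q2; rewrite -[F2]card_ord in F20 q3.
rewrite -[M1]card_ord in M10 q1 q2; rewrite -[Ma]card_ord in Ma0 q2; rewrite -[Mb]card_ord in Mb0 q3.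
have s1 : #|'I_F1| = 1%N \/ (ideal_pr P x1 x2 w1 w2 (fun s v _ => sigma gA < w1 (x1 s) v) <= e /\
    sigma gA * #|'I_F1|%:R <= e ^+ 2).
  by rewrite card_ord; case: (cond' _ _ F1hi) => h; [left|right].
have s2 : #|'I_F2| = 1%N \/ (ideal_pr P x1 x2 w1 w2 (fun s v u => sigma gB < w2 (v, x2 s) u) <= e /\
    sigma gB * #|'I_F2|%:R <= e ^+ 2).
  by rewrite card_ord; case: (cond' _ _ F2hi) => h; [left|right].
have sg h : 0 <= sigma h by exact: powR_ge0.
have tg h : 0 < tau h by exact: powR2_gt0.
have [f [g [D hD]]] := one_shot y hP hw1 hw2 block_loss_bounds L0 F10 F20 M10 Ma0 Mb0
  [ffun=> v0] [ffun=> u0] (fun x v => ge0 _ _ c1 x v hc1) (fun v => ge0 _ _ c2 tt_n v hc2)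
  (fun v u => ge0 _ _ c3 v u hc3) (fun x => le1 _ _ c1 x hc1) (le1 _ _ c2 tt_n hc2)
  (fun v => le1 _ _ c3 v hc3) (tg g1) (tg g2) (tg g3) (sg gA) (sg gB) e0 p1 p2 p3 q1 q2 q3 s1 s2.
exists 'I_M1, ('I_Ma * 'I_Mb)%type, f, g; split.
- rewrite card_ord -[leRHS]log2_powR; apply: log2_le M1hi.
  by rewrite ltr0n -[M1]card_ord.
- rewrite card_prod !card_ord -[leRHS]log2_powR; apply: log2_le.
    by rewrite ltr0n muln_gt0 -[Ma]card_ord -[Mb]card_ord Ma0.
  rewrite (_ : n%:R * (R2 + 14 * d) = n%:R * (R2 - r2 + 7 * d) + n%:R * (r2 + 7 * d)); last by ring.
  by rewrite natrM pow2D; apply: ler_pM.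
pose I w := f (x1 w); pose J w := g (x2 w, I w).
(* The smoothed posterior of the n letters of Y at the decoded pair; its negative logarithm is
   [block_loss], so [mutual_info_ge] turns the bound on the loss into one on the relevance. *)
pose r (z : 'I_M1 * ('I_Ma * 'I_Mb)) (t : {ffun 'I_n -> B}) : R :=
  2^-1 * product_kernel kY (ffun_pair ((D z).1, (D z).2)) t + 2^-1 * (#|B|%:R ^- n).
have r_sum z : \sum_t r z t <= 1.
  rewrite big_split /= -mulr_sumr.
  have [_ ->] := product_kernel_pmf hkY (ffun_pair ((D z).1, (D z).2)).
  have -> : \sum_(t : {ffun 'I_n -> B}) 2^-1 * (#|B|%:R ^- n) = #|B|%:R ^+ n * (2^-1 * (#|B|%:R ^- n)) :> R.
    by rewrite big_const iter_addr_0 card_ffun card_ord -natrX mulr_natl.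
  rewrite mulrCA mulfV; first by lra.
  by rewrite expf_neq0 // gt_eqF.
have := mutual_info_ge hP y (joint I J) (fun z t => arg_gt0 t (D z).1 (D z).2) r_sum.
apply: le_trans.
have -> : entropy P y = n%:R * HY.
  rewrite entropy_letterwise //; congr (_ * _).
  have e1 : law p id =1 law q src by move=> s; rewrite sq /law big_pred1_eq.
  exact: (entropy_law rY e1).
rewrite lerD2l lerNl -sumrN.
apply: le_trans (_ : \sum_s P s * (let m := f (x1 s) in let v := D (m, g (x2 s, m)) in
  block_loss (y s) v.1 v.2) <= _).
  by apply: ler_sum => w _; rewrite -mulrN.
by apply: le_trans hD _; rewrite lerD2r; exact: ideal_block_loss.
Qed.

End Block.
End Achievability.

Section InnerAchievable.
Variables (R : realType) (A1 A2 B : finType) (p : A1 * A2 * B -> R).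
Hypothesis hp : is_pmf p.
Hypothesis hmarkov : markov_chain p (@src_X1 A1 A2 B) (@src_Y A1 A2 B) (@src_X2 A1 A2 B).

Lemma aep_cond_kernel (W C U : finType) (q : W -> R) (X : W -> C) (V : W -> U) (b0 : U) (d e : R) :
  is_pmf q -> 0 < d -> 0 < e ->
  let h := entropy q (joint V X) - entropy q X in
  exists n0 : nat, forall n, (n0 < n)%N ->
    \sum_w iid q w * (\prod_(i < n) cond_kernel q X V b0 (X (w i)) (V (w i)) <
      2 `^ (- (n%:R * (h + d))))%R%:R <= e /\
    \sum_w iid q w * (2 `^ (- (n%:R * (h - d))) <
      \prod_(i < n) cond_kernel q X V b0 (X (w i)) (V (w i)))%R%:R <= e.
Proof.
move=> hq d0 e0 h.
have := @aep _ _ _ hq (fun w => cond_kernel q X V b0 (X w) (V w)) d e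
  (cond_kernel_gt0 X V b0 hq) d0 e0.
by rewrite /= (cond_kernel_entropy X V b0 hq).
Qed.

Lemma leq_natr_bound (x : R) (n : nat) : 0 <= x -> (Num.bound x < n)%N -> x <= n%:R.
Proof.
move=> x0 hn; apply/ltW/(lt_le_trans (archi_boundP x0)).
by rewrite ler_nat ltnW.
Qed.

Lemma inner_sub_achievable (R1 R2 mu : R) :
  inner_region p (R1, R2, mu) -> achievable_region p (R1, R2, mu).
Proof.
move=> /(inner_regionP hp hmarkov)[R10 R20 mu0 [a [b [c [m [[U1 [U2 [q [hq [-> -> -> ->]]]]] h1 h2 h12 hmu]]]]]].
have hsys := (is_aux_extensionE p q).1 hq.
have [qp sq aux] := hsys.
have src := source_cmi hp hmarkov sq.
have [[[[[_ _] y0] v0] u0] _] := pmf_inhabited qp.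
pose X1 := @src_X1 A1 A2 B \o @aux_src _ U1 U2.
pose X2 := @src_X2 A1 A2 B \o @aux_src _ U1 U2.
pose Y := @src_Y A1 A2 B \o @aux_src _ U1 U2.
pose V1 := @aux_V1 (A1 * A2 * B) U1 U2.
pose V2 := @aux_V2 (A1 * A2 * B) U1 U2.
split => // eps eps0.
pose LB : R := log2 #|B|%:R.
have LB0 : 0 <= LB by apply: log2_ge0; rewrite ler1n; apply/card_gt0P; exists y0.
(* [14 * d] is the rate overhead in [block_code]. The loss there is at most 1 + 18 n (1 + LB) e = 1
   + n eps / 2, and [n8] ensures 1 <= n eps / 2. *)
pose d := eps / 14; pose e := eps / (36 * (1 + LB)).
have LB1 : 0 < 1 + LB by lra.
have d0 : 0 < d by rewrite divr_gt0.
have e0 : 0 < e by rewrite divr_gt0 // mulr_gt0.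
have [n1 t1] := aep_cond_kernel X2 V1 v0 qp d0 e0.
(* A constant condition gives plain typicality of V1, for the final decoder, which has no side
   information. *)
have [n2 t2] := aep_cond_kernel (fun=> tt) V1 v0 qp d0 e0.
have [n3 t3] := aep_cond_kernel V1 V2 u0 qp d0 e0.
have [n4 t4] := aep_cond_kernel X1 V1 v0 qp d0 e0.
have [n5 t5] := aep_cond_kernel (joint V1 X2) V2 u0 qp d0 e0.
pose n6 := Num.bound d^-1; pose n7 := Num.bound (`|log2 e| / d); pose n8 := Num.bound (2 / eps).
exists (maxn n1 (maxn n2 (maxn n3 (maxn n4 (maxn n5 (maxn n6 (maxn n7 n8))))))) => n.
rewrite !gtn_max => /and5P[n_1 n_2 n_3 n_4 /and4P[n_5 n_6 n_7 n_8]].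
have {}t1 := (t1 n n_1).1.
have {}t2 := (t2 n n_2).1.
have {}t3 := (t3 n n_3).1.
have {}t4 := (t4 n n_4).2.
have {}t5 := (t5 n n_5).2.
have n0 : (0 < n)%N by exact: leq_ltn_trans n_1.
have nR : 0 < n%:R :> R by rewrite ltr0n.
have nd : 1 <= n%:R * d.
  rewrite -ler_pdivrMr // mul1r; apply: leq_natr_bound n_6.
  by rewrite invr_ge0 ltW.
have ne : 2 `^ (- (n%:R * d)) <= e.
  rewrite -[leRHS]pow2_log2 //; apply: pow2_le; rewrite lerNl.
  apply: le_trans (ler_norm _) _; rewrite normrN -ler_pdivrMr //.
  by apply: leq_natr_bound n_7; rewrite divr_ge0 // ltW.
have neps : 2 / eps <= n%:R.
  by apply: leq_natr_bound n_8; rewrite divr_ge0 // ltW.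
have tt0 : entropy q (fun=> tt) = 0 by exact: entropy_const.
have V1tt : entropy q (joint V1 (fun=> tt)) = entropy q V1.
  by apply: entropy_eq => // t t'; rewrite /joint xpair_eqE eqxx andbT.
rewrite tt0 V1tt subr0 in t2.
have r2E := rate2_relevance qp src aux.
have r20 : 0 <= cond_mutual_info q X2 V2 V1 by exact: cmi_ge0.
have r2R : cond_mutual_info q X2 V2 V1 <= R2 by rewrite -r2E.
have r2H : (entropy q (joint V2 V1) - entropy q V1) -
    (entropy q (joint V2 (joint V1 X2)) - entropy q (joint V1 X2)) = cond_mutual_info q X2 V2 V1.
  rewrite cond_mutual_infoE //.
  have -> : entropy q (joint X2 V1) = entropy q (joint V1 X2) by solve_entropy.
  have -> : entropy q (joint (joint X2 V2) V1) = entropy q (joint V2 (joint V1 X2)) by solve_entropy.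
  ring.
have hR1 := h1; rewrite (rate1_entropy qp aux) in hR1.
have hR12 := h12; rewrite (rate12_entropy qp src aux) r2E in hR12.
have r2b : 0 <= cond_mutual_info q X2 V2 V1 <= R2 by rewrite r20.
have [M1 [M2 [f [g [m1 m2 mI]]]]] :=
  block_code hp hsys y0 n0 d0 e0 t1 t2 t3 t4 t5 nd ne R10 r2b hR1 r2H hR12.
have dE : 14 * d = eps by rewrite /d; field.
rewrite dE in m1 m2.
exists M1, M2, f, g; split.
- by rewrite ler_pdivrMl.
- by rewrite ler_pdivrMl.
rewrite ler_pdivlMl //; apply: le_trans mI.
have relE : relevance q Y V1 V2 =
  entropy q Y - (entropy q (joint Y (joint V1 V2)) - entropy q (joint V1 V2)).
  by rewrite /relevance mutual_infoE //; ring.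
have n2eps : 2 <= n%:R * eps by rewrite -ler_pdivrMr.
have eE : 36 * (e * (1 + LB)) = eps.
  by rewrite /e; field; rewrite gt_eqF.
have n1R : 1 <= n%:R :> R by rewrite ler1n.
have k1 : e * (1 + n%:R * LB) <= e * (n%:R * (1 + LB)).
  by rewrite ler_pM2l // mulrDr mulr1 lerD2r.
have k2 : 36 * (e * (n%:R * (1 + LB))) = n%:R * eps by rewrite -eE; ring.
have k3 : n%:R * mu <= n%:R * relevance q Y V1 V2 by rewrite ler_pM2l.
move: k3; rewrite relE -/Y -/V1 -/V2 -/LB => k3.
move: k3 k2 k1 n2eps; rewrite !mulrBr !mulrDr; clearbody LB e; move: (n%:R : R) => *; lra.
Qed.

End InnerAchievable.

Theorem theorem4 (R : realType) (A1 A2 B : finType) (p : A1 * A2 * B -> R)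
  (hp : is_pmf p)
  (hmarkov : markov_chain p (@src_X1 A1 A2 B) (@src_Y A1 A2 B)
               (@src_X2 A1 A2 B)) :
  outer_region p = inner_region p /\ inner_region p = achievable_region p.
Proof.
have e1 t : outer_region p t -> inner_region p t.
  by case: t => -[R1 R2] mu; exact: outer_sub_inner.
have e2 t : inner_region p t -> achievable_region p t.
  by case: t => -[R1 R2] mu; exact: inner_sub_achievable.
have e3 t : achievable_region p t -> outer_region p t.
  by case: t => -[R1 R2] mu; exact: achievable_sub_outer.
split; apply/seteqP; split=> t.
- exact: e1.
- by move=> /e2/e3.
- exact: e2.
- by move=> /e3/e1.
Qed.
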